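(* Let $T\in(0,\infty]$, let $c\colon[0,T)\to M$ be a non-closed integral curve of a vector field $X$ on a manifold $M$, and let $(X,\mathcal V)$ be a regular dynamic pair, $m=\operatorname{rk}\mathcal V$, defined in a neighbourhood of $c$, with curvature operator $K$. Suppose that, along $c$, $K$ is symmetric with respect to some positive definite metric $g$ on $\mathcal V$ along $c$ which is parallel with respect to $D_X$, and that for some constant $\kappa$ $$\operatorname{tr}K\ge\kappa>0\quad\text{along } c.$$ Put $T^*=\pi\sqrt{m/\kappa}$. If $T^*<T$, then there is a conjugate time along $c$ in the interval $(0,T^*]$.
   Context: All data are $C^\infty$. A dynamic pair $(X,\mathcal V)$ consists of a vector field $X$ and a smooth distribution $\mathcal V$ of rank $m$ on a manifold. Put $\mathcal D=\mathcal V+[X,\mathcal V]$ (spanned by the sections $V$ of $\mathcal V$ and the brackets $[X,V]$). The pair is regular if $X(x)\ne0$ for all $x$, $\operatorname{rk}\mathcal D=2m$, and $[X,\mathcal D]\subset\mathcal D$. Curvature. For a local frame $\hat W=(W_1,\dots,W_m)$ of $\mathcal V$ (a row vector) there are unique $m\times m$ matrices of functions $H_0,H_1$ with $[X,[X,\hat W]]=\hat W H_0+[X,\hat W]H_1$. The matrix $-H_0+\frac12X(H_1)-\frac14H_1^2$ is, in the frame $\hat W$, the matrix of a well-defined (frame-independent) bundle endomorphism $K\colon\mathcal V\to\mathcal V$, the curvature operator. Covariant derivative. The distribution $\mathcal H=\operatorname{span}\{[X,\hat W]-\frac12\hat W H_1\}$ does not depend on the frame and $\mathcal D=\mathcal V\oplus\mathcal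 H$, with projection $\pi_{\mathcal V}\colon\mathcal D\to\mathcal V$. For a section $V$ of $\mathcal V$, $D_XV:=\pi_{\mathcal V}[X,V]$; thus $D_XW_j=\frac12\sum_i(H_1)^i_jW_i$. For sections along an integral curve $c$ of $X$, $D_X\big(\sum_jf^jW_j\big)=\sum_j\frac{df^j}{dt}W_j+\frac12\sum_{i,j}f^j(H_1)^i_jW_i$, where $f^j$ are functions of $t$. A (smooth) metric $g$ on $\mathcal V$ along $c$ is parallel with respect to $D_X$ (invariant) if $\frac{d}{dt}g(Y,Z)=g(D_XY,Z)+g(Y,D_XZ)$ for all sections $Y,Z$ of $\mathcal V$ along $c$. $K$ is symmetric with respect to $g$ along $c$ if $g(Kv,w)=g(v,Kw)$ for all $v,w\in\mathcal V(c(t))$ and all $t$. Conjugate times. A number $t^*>0$ in the domain of $c$ is a conjugate time along $c$ (and $c(t^* )$ a conjugate point) if $\exp(t^*X)_*\mathcal V(c(0))\cap\mathcal V(c(t^* ))\ne\{0\}$, where $\exp(tX)$ is the flow of $X$. *)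

(* Defs.v *)
From mathcomp Require Import all_boot all_order all_algebra.
From mathcomp Require Import all_classical all_reals all_analysis.

Set Implicit Arguments.
Unset Strict Implicit.
Unset Printing Implicit Defensive.

Import Order.TTheory GRing.Theory Num.Theory.
Import numFieldNormedType.Exports.

Local Open Scope classical_set_scope.
Local Open Scope ring_scope.

(** In finite dimension and for an open [U] this is C^oo on [U]: all iterated
    directional derivatives are (Frechet) differentiable. *)
Definition smooth_on (R : realType) (E F : normedModType R) (U : set E)
    (f : E -> F) : Prop :=
  forall (s : seq E) (x : E), U x ->
    differentiable (foldr (fun v h => 'D_v h) f s) x.

(** [f] has derivative [l] at [t] relatively to [A]; this is a one-sided
    derivative when [t] is an endpoint of the interval [A]. *)
Definition has_deriv_within (R : realType) (F : normedModType R) (A : set R)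
    (f : R -> F) (t : R) (l : F) : Prop :=
  (fun s => (s - t)^-1 *: (f s - f t)) @ within A t^' --> l.

Definition smooth_within (R : realType) (F : normedModType R) (A : set R)
    (f : R -> F) : Prop :=
  exists d : nat -> R -> F, d 0%N = f /\
    forall k t, A t -> has_deriv_within A (d k) t (d k.+1 t).

Record chart (R : realType) (n : nat) (M : topologicalType) := Chart {
  cdom : set M ;
  ccoord : M -> 'rV[R]_n ;     (* meaningful on [cdom] *)
  param : 'rV[R]_n -> M       (* inverse of [ccoord], meaningful on its image *)
}.

Definition cimage (R : realType) (n : nat) (M : topologicalType)
  (e : chart R n M) (U : set M) : set 'rV[R]_n := ccoord e @` (cdom e `&` U).

Definition is_chart (R : realType) (n : nat) (M : topologicalType)
    (e : chart R n M) : Prop :=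
  [/\ open (cdom e),
      open (cimage e setT),
      (forall p, cdom e p -> param e (ccoord e p) = p),
      (forall p, cdom e p -> {for p, continuous (ccoord e)}) &
      (forall y, cimage e setT y -> {for y, continuous (param e)})].

(** [chart_at p] is a preferred chart around [p], used only to represent the
    tangent space at [p]; the smooth structure is that of [atlas]. *)
Record manifold (R : realType) (n : nat) := Manifold {
  points :> topologicalType ;
  points_hausdorff : hausdorff_space points ;
  points_second_countable : @second_countable points ;
  atlas : set (chart R n points) ;
  atlas_chart : forall e, atlas e -> is_chart e ;
  atlas_compatible : forall e e', atlas e -> atlas e' ->
    smooth_on (cimage e (cdom e')) (ccoord e' \o param e) ;
  chart_at : points -> chart R n points ;
  chart_at_atlas : forall p, atlas (chart_at p) ;
  chart_at_dom : forall p, cdom (chart_at p) p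
}.

(** The tangent space at [p] is ['rV[R]_n]: a tangent vector is given by its
    coordinates in [chart_at p].  Hence a vector field is a map from [M] to
    ['rV[R]_n], and its smoothness has to be tested after changing coordinates
    to a fixed chart. *)

Section Fields.
Context {R : realType} {n : nat} {M : manifold R n}.
Local Notation tvec := ('rV[R]_n).
Local Notation vfield := (M -> tvec).

(** coordinates in the chart [e] of the tangent vector [v] at [p], by the
    differential of the change of coordinates *)
Definition tcoord (e : chart R n M) (p : M) (v : tvec) : tvec :=
  'd (ccoord e \o param (chart_at p)) (ccoord (chart_at p) p) v.

Definition field_rep (e : chart R n M) (Y : vfield) : tvec -> tvec :=
  fun y => tcoord e (param e y) (Y (param e y)).

Definition smooth_field (U : set M) (Y : vfield) : Prop :=
  forall e, atlas e -> smooth_on (cimage e U) (field_rep e Y).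

Definition bracket (X Y : vfield) : vfield := fun p =>
  let e := chart_at p in
  'd (field_rep e Y) (ccoord e p) (X p) - 'd (field_rep e X) (ccoord e p) (Y p).

(** [X(f)] for a vector-valued function [f] *)
Definition field_deriv (F : normedModType R) (X : vfield) (f : M -> F) (p : M)
  : F := 'd (f \o param (chart_at p)) (ccoord (chart_at p) p) (X p).

(** the differential at [p] of a map [f], from the tangent space at [p] to the
    tangent space at [f p] *)
Definition mdiff (f : M -> M) (p : M) : tvec -> tvec :=
  'd (ccoord (chart_at (f p)) \o f \o param (chart_at p))
     (ccoord (chart_at p) p).

Definition integral_curve (X : vfield) (J : set R) (c : R -> M) : Prop :=
  {within J, continuous c} /\
  forall t, J t ->
    has_deriv_within J (ccoord (chart_at (c t)) \o c) t (X (c t)).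

(** For [0 < t], [flow X t] is exp(tX).  It is a total function, whose value
    at [p] is meaningful when the integral curve from [p] exists up to
    time [t]. *)
Definition flow (X : vfield) (t : R) (p : M) : M :=
  xget p [set q | exists c : R -> M,
    [/\ integral_curve X [set s | 0 <= s <= t] c, c 0 = p & c t = q]].

(** A distribution is a map [V] sending [p] to a subspace of the tangent space
    at [p]; it is only meaningful on the open set [N] where it is defined. *)

Local Notation dist := (M -> {vspace 'rV[R]_n}).

Definition local_frame (m : nat) (N : set M) (V : dist) (U : set M)
    (W : 'I_m -> vfield) : Prop :=
  [/\ open U, U `<=` N, (forall i, smooth_field U (W i)) &
      forall q, U q -> basis_of (V q) [tuple W i q | i < m]].

Definition smooth_distribution (m : nat) (N : set M) (V : dist) : Prop :=
  forall p, N p -> exists (U : set M) (W : 'I_m -> vfield),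
    U p /\ local_frame N V U W.

Definition lspan (S : set tvec) : set tvec :=
  [set u | exists2 vs : seq tvec,
    (forall v, v \in vs -> S v) & u \in span vs].

Definition has_rank (S : set tvec) (r : nat) : Prop :=
  exists2 E : {vspace tvec}, \dim E = r & S = [set u | u \in E].

(** the distribution V + [X, V], spanned by the local sections Y of V and the
    brackets [X, Y] *)
Definition derived (N : set M) (X : vfield) (V : dist) (p : M) : set tvec :=
  lspan [set u | exists (U : set M) (Y : vfield),
    [/\ open U, U `<=` N /\ U p, smooth_field U Y,
        (forall q, U q -> Y q \in V q) & u = Y p \/ u = bracket X Y p]].

Definition regular_dynamic_pair (m : nat) (N : set M) (X : vfield) (V : dist)
    : Prop :=
  [/\ smooth_field N X,
      smooth_distribution m N V,
      (forall p, N p -> X p != 0),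
      (forall p, N p -> has_rank (derived N X V p) (2 * m)%N) &
      forall (U : set M) (Z : vfield), open U -> U `<=` N ->
        smooth_field U Z -> (forall q, U q -> derived N X V q (Z q)) ->
        forall q, U q -> derived N X V q (bracket X Z q)].

Definition structure_matrices (m : nat) (X : vfield) (U : set M)
    (W : 'I_m -> vfield) (H0 H1 : M -> 'M[R]_m) : Prop :=
  forall q, U q -> forall j,
    bracket X (bracket X (W j)) q =
      \sum_i H0 q i j *: W i q + \sum_i H1 q i j *: bracket X (W i) q.

Definition curvature_mx (m : nat) (X : vfield) (H0 H1 : M -> 'M[R]_m) (p : M)
    : 'M[R]_m :=
  - H0 p + 2^-1 *: field_deriv X H1 p - 4^-1 *: (H1 p *m H1 p).

(** The curvature operator at [p], as a function on [V p]: since it does not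
    depend on the frame, the set below is a singleton when [v] is in [V p]. *)
Definition curvature (m : nat) (N : set M) (X : vfield) (V : dist) (p : M)
    (v : tvec) : tvec :=
  xget 0 [set w | exists (U : set M) (W : 'I_m -> vfield)
      (H0 H1 : M -> 'M[R]_m) (a : 'cV[R]_m),
    [/\ local_frame N V U W, U p, structure_matrices X U W H0 H1,
        v = \sum_i a i 0 *: W i p &
        w = \sum_i (curvature_mx X H0 H1 p *m a) i 0 *: W i p]].

Definition trace_on (E : {vspace 'rV[R]_n}) (f : tvec -> tvec) : R :=
  \sum_(i < \dim E) coord (vbasis E) i (f (vbasis E)`_i).

Definition rel_open (J A : set R) : Prop :=
  exists2 O : set R, open O & A = O `&` J.

Definition section_along (V : dist) (c : R -> M) (A : set R)
    (Y : R -> tvec) : Prop :=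
  (forall t, A t -> Y t \in V (c t)) /\
  forall e, atlas e ->
    smooth_within (A `&` c @^-1` cdom e) (fun t => tcoord e (c t) (Y t)).

(** D_X Y at time [t], for a section [Y] along [c] defined near [t] in [J];
    again the set below is a singleton. *)
Definition covariant_deriv (m : nat) (N : set M) (X : vfield) (V : dist)
    (J : set R) (c : R -> M) (Y : R -> tvec) (t : R) : tvec :=
  xget 0 [set u | exists (U : set M) (W : 'I_m -> vfield)
      (H0 H1 : M -> 'M[R]_m) (f : 'I_m -> R -> R) (df : 'I_m -> R),
    [/\ [/\ local_frame N V U W, U (c t) & structure_matrices X U W H0 H1],
        (\forall s \near within J (nbhs t),
           Y s = \sum_j f j s *: W j (c s)),
        (forall j, has_deriv_within J (f j : R -> R^o) t (df j)) &
        u = \sum_j df j *: W j (c t) +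
            2^-1 *: \sum_i \sum_j (f j t * H1 (c t) i j) *: W i (c t)]].

(** A smooth positive definite metric on [V] along [c]; [g t] is only
    meaningful on [V (c t)]. *)
Definition metric_along (V : dist) (c : R -> M) (J : set R)
    (g : R -> tvec -> tvec -> R) : Prop :=
  [/\ (forall t, J t -> forall (a : R) u v w,
         u \in V (c t) -> v \in V (c t) -> w \in V (c t) ->
         g t (a *: u + v) w = a * g t u w + g t v w),
      (forall t, J t -> forall v w, v \in V (c t) -> w \in V (c t) ->
         g t v w = g t w v),
      (forall t, J t -> forall v, v \in V (c t) -> v != 0 -> 0 < g t v v) &
      forall A Y Z, rel_open J A ->
        section_along V c A Y -> section_along V c A Z ->
        smooth_within A (fun t => g t (Y t) (Z t) : R^o)].

Definition parallel_metric (m : nat) (N : set M) (X : vfield) (V : dist)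
    (c : R -> M) (J : set R) (g : R -> tvec -> tvec -> R) : Prop :=
  forall A Y Z, rel_open J A ->
    section_along V c A Y -> section_along V c A Z ->
    forall t, A t ->
      has_deriv_within A (fun s => g s (Y s) (Z s) : R^o) t
        (g t (covariant_deriv m N X V J c Y t) (Z t) +
         g t (Y t) (covariant_deriv m N X V J c Z t)).

Definition curvature_symmetric (m : nat) (N : set M) (X : vfield) (V : dist)
    (c : R -> M) (J : set R) (g : R -> tvec -> tvec -> R) : Prop :=
  forall t, J t -> forall v w, v \in V (c t) -> w \in V (c t) ->
    g t (curvature m N X V (c t) v) w = g t v (curvature m N X V (c t) w).

Definition conjugate_time (X : vfield) (V : dist) (c : R -> M) (J : set R)
    (t : R) : Prop :=
  [/\ 0 < t, J t &
      (mdiff (flow X t) (c 0) @` [set v | v \in V (c 0)]) `&`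
        [set v | v \in V (c t)] <> [set 0]].

End Fields.

(* Main.v *)
Require Import Defs.
From mathcomp Require Import all_boot all_order all_algebra.
From mathcomp Require Import all_classical all_reals all_analysis.
From mathcomp Require Import ring lra.

(** Let [Q t] be the matrix of the differential at [c 0] of the flow, and pull
    a frame of [V] along [c], viewed as a matrix of rows, back to the fixed
    tangent space at [c 0]: [w = W * (Q t)^-1].  Then [w' = z] is the pulled
    back bracket and, as [D] is [X]-invariant, [z' = p w + l z] with
    [l = H1^T] and [p = H0^T].  Setting [h = z - l w / 2], this becomes
    [w' = h + l w / 2] and [h' = - K^T w + l h / 2].  The row space of
    [(w, h)] is constant, so the initial frame can be written as
    [w(0) = alpha w + beta h], and [t] is a conjugate time as soon as [beta t]
    is singular.  If [beta] were invertible on ]0, T*], then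
    [S = - beta^-1 alpha] would satisfy, up to a commutator with [l / 2], the
    Riccati equation [S' = - S^2 - K^T].  It is self-adjoint for [g]: the
    Wronskian [beta G alpha^T - alpha G beta^T] is constant, since [g] is
    parallel and [K] symmetric, and it vanishes at 0.  Hence [u = tr S]
    satisfies [u' <= - kappa - u^2 / m] with [t u(t)] bounded near 0, which is
    impossible on ]0, T*] by comparison with [m omega cot (omega t)], where
    [omega = sqrt (kappa / m)].
    Since [tr S] and the Wronskian do not depend on the frame, local frames are
    enough. *)

Set Implicit Arguments.
Unset Strict Implicit.
Unset Printing Implicit Defensive.

Import Order.TTheory GRing.Theory Num.Theory.
Import numFieldNormedType.Exports.

Local Open Scope classical_set_scope.
Local Open Scope ring_scope.

(** * Differentiation of matrix-valued maps *)

(** The obstacle is that neither one chart nor one frame covers the curve, while [flow], [curvature]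
    and [covariant_deriv] are defined by choosing an element of a set. Each object is therefore
    computed in any frame adapted at the given time, the rule for changing frames shows that the
    choice does not matter, and statements are carried along the curve by a supremum argument on
    times. The time 0 is apart: it is an end point, where derivatives exist only within [J]. There
    one needs the values of [alpha] and [beta], the slope of [beta], and the mere existence of the
    other derivatives. The bracket is replaced by [h] because [l] then enters the equations of
    [alpha] and [beta] only as a right multiplication by [- l / 2], and parallelism of [g] makes
    these terms cancel in the Wronskian. The number [m] in [T*] comes from
    [tr (S^2) >= (tr S)^2 / m], valid for self-adjoint [S], and [T* = pi / omega] is the first
    positive pole of the comparison function. Since [beta] vanishes at 0 with derivative [- 1],
    [t u(t)] tends to [m], as it does for that function. *)

Section Diff.
Context {R : realType} {E F : normedModType R}.

Lemma differentiable_remainder (f : E -> F) (x : E) (e : R) :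
  differentiable f x -> 0 < e ->
  \forall h \near 0, `|f (h + x) - f x - 'd f x h| <= e * `|h|.
Proof.
move=> /diff_locallyP[_ fx] e0; move/eqaddoP: fx => /(_ e e0).
apply: filterS => h.
rewrite (_ : (_ - _) h = f (h + x) - (f x + 'd f x h)) //.
by rewrite opprD addrA.
Qed.

Lemma differentiable_of_remainder (f : E -> F) (L : {linear E -> F}) (x : E) :
  continuous L ->
  (forall e, 0 < e -> \forall h \near 0, `|f (h + x) - f x - L h| <= e * `|h|) ->
  differentiable f x /\ 'd f x = L :> (E -> F).
Proof.
move=> cL H.
have fL : f \o shift x = cst (f x) + L +o_ 0 id.
  apply/eqaddoP => e e0; apply: filterS (H e e0) => h.
  rewrite (_ : (_ - _) h = f (h + x) - (f x + L h)) //.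
  by rewrite opprD addrA.
have dE := diff_unique cL fL.
by split=> //; apply/diff_locallyP; rewrite dE; split.
Qed.

Lemma near_eq_differentiable (f g : E -> F) (x : E) :
  (\forall y \near x, f y = g y) -> differentiable g x ->
  differentiable f x /\ 'd f x = 'd g x :> (E -> F).
Proof.
move=> fg dg; apply: differentiable_of_remainder; first exact: diff_continuous.
move=> e e0; have fgx := nbhs_singleton fg.
move: fg; rewrite (near_shift 0 x) subr0 => fg.
near=> h; rewrite fgx.
have -> : f (h + x) = g (h + x) by near: h.
by near: h; exact: differentiable_remainder.
Unshelve. all: by end_near. Qed.

End Diff.

Lemma diff_cstE {R : realType} {E F : normedModType R} (a : F) (x v : E) :
  'd (cst a) x v = 0.
Proof. by rewrite diff_cst. Qed.

Lemma diff_idE {R : realType} {E : normedModType R} (x v : E) : 'd id x v = v.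
Proof. by rewrite diff_val. Qed.

(** Solves the differentiated identity [A *m invmx A = 1] for the derivative [D] of the inverse in
    the direction [H]. *)
Lemma invmx_derivE (F : comUnitRingType) (n : nat) (A H D : 'M[F]_n) :
  A \in unitmx -> H *m invmx A + A *m D = 0 -> D = - (invmx A *m H *m invmx A).
Proof.
move=> Au /(congr1 (mulmx (invmx A))).
rewrite mulmxDr mulKmx // mulmx0 mulmxA => /eqP.
by rewrite addrC addr_eq0 => /eqP.
Qed.

Section MatrixNorm.
Context {R : realType}.

Lemma mx_norm_leP (p q : nat) (A : 'M[R]_(p, q)) (c : R) : 0 <= c ->
  (forall i j, `|A i j| <= c) -> `|A| <= c.
Proof.
move=> c0 H; rewrite /Num.Def.normr/= mx_normrE.
by apply: bigmax_le => // -[i j] _.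
Qed.

Lemma mx_entry_le (p q : nat) (A : 'M[R]_(p, q)) i j : `|A i j| <= `|A|.
Proof.
rewrite [leRHS]/Num.Def.normr/= mx_normrE.
exact: (le_bigmax _ (fun ij => `|A ij.1 ij.2|) (i, j)).
Qed.

Lemma mx_norm_mul (p q r : nat) (A : 'M[R]_(p, q)) (B : 'M[R]_(q, r)) :
  `|A *m B| <= q%:R * `|A| * `|B|.
Proof.
apply: mx_norm_leP => [|i j]; first by rewrite !mulr_ge0.
rewrite mxE (le_trans (ler_norm_sum _ _ _))//.
rewrite -mulrA -[X in _ <= X%:R * _](card_ord q) mulr_natl.
rewrite -sumr_const; apply: ler_sum => k _.
by rewrite normrM ler_pM// mx_entry_le.
Qed.

Lemma cvg_mx (T : Type) (G : set_system T) {FG : Filter G} (p q : nat)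
    (f : T -> 'M[R]_(p, q)) (A : 'M[R]_(p, q)) :
  (forall i j, f x i j @[x --> G] --> A i j) -> f @ G --> A.
Proof.
move=> H; apply/cvgrPdist_le => e e0; near=> x.
apply: mx_norm_leP => [|i j]; first exact: ltW.
rewrite !mxE; move: i j; near: x.
apply: filter_forall => i; apply: filter_forall => j.
by move/cvgrPdist_le: (H i j); apply.
Unshelve. all: by end_near. Qed.

Lemma cvg_mx_entry (T : Type) (G : set_system T) {FG : Filter G} (p q : nat)
    (f : T -> 'M[R]_(p, q)) (A : 'M[R]_(p, q)) i j :
  f @ G --> A -> f x i j @[x --> G] --> A i j.
Proof.
by move=> fA; exact: (cvg_comp _ _ fA (@coord_continuous R p q i j A)).
Qed.

Lemma cvg_mulmx (T : Type) (G : set_system T) {FG : Filter G} (p q r : nat)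
    (f : T -> 'M[R]_(p, q)) (g : T -> 'M[R]_(q, r)) (A : 'M[R]_(p, q))
    (B : 'M[R]_(q, r)) :
  f @ G --> A -> g @ G --> B -> f x *m g x @[x --> G] --> A *m B.
Proof.
move=> fA gB; apply: cvg_mx => i j.
under eq_fun do rewrite mxE.
rewrite mxE; apply: cvg_big => //; first exact: add_continuous.
by move=> k _; apply: cvgM; apply: cvg_mx_entry.
Qed.

Lemma mulmx_continuous (p q r : nat) :
  continuous (fun x : 'M[R]_(p, q) * 'M[R]_(q, r) => x.1 *m x.2).
Proof. by move=> [A B]; apply: cvg_mulmx; [exact: cvg_fst|exact: cvg_snd]. Qed.

Lemma mulmx_diff (E : normedModType R) (p q r : nat)
    (f : E -> 'M[R]_(p, q)) (g : E -> 'M[R]_(q, r)) x :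
  differentiable f x -> differentiable g x ->
  differentiable (fun y => f y *m g y) x /\
  forall v fv gv, 'd f x v = fv -> 'd g x v = gv ->
    'd (fun y => f y *m g y) x v = fv *m g x + f x *m gv.
Proof.
move=> df dg.
have c := @mulmx_continuous p q r.
pose b : 'M[R]_(p, q) * 'M[R]_(q, r) -> 'M[R]_(p, r) := fun z => z.1 *m z.2.
have db := @differentiable_bilin _ _ _ _ (@mulmx R p q r) (f x, g x) c.
have dfg := differentiable_pair df dg.
split; first exact: (@differentiable_comp _ _ _ _ (fun y => (f y, g y)) b x dfg db).
move=> v _ _ <- <-; have := @diff_comp _ _ _ _ (fun y => (f y, g y)) b x dfg db.
move=> /(congr1 (fun h : E -> _ => h v)) /=.
rewrite (_ : b \o _ = fun y => f y *m g y) // => ->.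
rewrite diff_pair // (@diff_bilin _ _ _ _ (@mulmx R p q r)) //=.
by rewrite addrC.
Qed.

Lemma differentiable_bigsum (E F : normedModType R) (I : Type) (s : seq I)
    (P : pred I) (f : I -> E -> F) x :
  (forall i, differentiable (f i) x) ->
  differentiable (fun y => \sum_(i <- s | P i) f i y) x.
Proof.
move=> df; elim: s => [|i s IH].
  by under eq_fun do rewrite big_nil; exact: differentiable_cst.
under eq_fun do rewrite big_cons.
by case: (P i) => //; exact: (@differentiableD _ _ _ (f i)).
Qed.

Lemma differentiable_bigprod (E : normedModType R) (I : Type) (s : seq I)
    (P : pred I) (f : I -> E -> R) x :
  (forall i, differentiable (f i) x) ->
  differentiable (fun y => \prod_(i <- s | P i) f i y) x.
Proof.
move=> df; elim: s => [|i s IH].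
  by under eq_fun do rewrite big_nil; exact: differentiable_cst.
under eq_fun do rewrite big_cons.
by case: (P i) => //; exact: (@differentiableM _ _ (f i)).
Qed.

Lemma differentiable_mx (E : normedModType R) (p q : nat)
    (f : E -> 'M[R]_(p, q)) x :
  (forall i j, differentiable (fun y => f y i j : R) x) -> differentiable f x.
Proof.
move=> df.
rewrite (_ : f = fun y => \sum_i \sum_j f y i j *: delta_mx i j); last first.
  by apply/funext => y; exact: matrix_sum_delta.
apply: differentiable_bigsum => i; apply: differentiable_bigsum => j.
exact: differentiableZl.
Qed.

Lemma differentiable_entry (E : normedModType R) (p q : nat)
    (f : E -> 'M[R]_(p, q)) x i j :
  differentiable f x -> differentiable (fun y => f y i j : R) x.
Proof.
by move=> df; have := differentiable_comp df (@differentiable_coord R p q (f x) i j).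
Qed.

Lemma differentiable_det (n : nat) (A : 'M[R]_n) :
  differentiable (fun B : 'M[R]_n => \det B : R) A.
Proof.
rewrite /determinant; apply: differentiable_bigsum => s.
apply: differentiableM; first exact: differentiable_cst.
by apply: differentiable_bigprod => i; exact: differentiable_coord.
Qed.

Lemma unitmx_near (n : nat) (A : 'M[R]_n) : A \in unitmx ->
  \forall B \near A, B \in unitmx.
Proof.
rewrite unitmxE unitfE => A0.
have /differentiable_continuous c := differentiable_det A.
have := c _ (open_nbhs_nbhs (conj (@open_neq R 0) A0)).
by apply: (@filterS _ (nbhs A)) => B /=; rewrite unitmxE unitfE.
Qed.

(** Near [A] the inverse is the adjugate divided by the determinant, so its entries are polynomials
    over a nonvanishing polynomial. *)
Lemma differentiable_invmx (n : nat) (A : 'M[R]_n) : A \in unitmx ->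
  differentiable (@invmx R n) A.
Proof.
move=> Au; have Au' := unitmx_near Au.
apply: (near_eq_differentiable (g := fun B => (\det B)^-1 *: \adj B) _ _).1.
  by apply: filterS Au' => B Bu; rewrite /invmx Bu.
apply: differentiable_mx => i j.
under eq_fun do rewrite mxE.
apply: differentiableM.
  apply: differentiableV; first exact: differentiable_det.
  by move: Au; rewrite unitmxE unitfE.
under eq_fun do rewrite mxE /cofactor.
apply: differentiableM; first exact: differentiable_cst.
have dm : differentiable (fun B : 'M[R]_n => row' j (col' i B)) A.
  apply: differentiable_mx => k l.
  under eq_fun do rewrite !mxE.
  exact: differentiable_coord.
exact: (differentiable_comp dm (differentiable_det _)).
Qed.

Lemma diff_invmx (n : nat) (A H : 'M[R]_n) : A \in unitmx ->
  'd (@invmx R n) A H = - (invmx A *m H *m invmx A).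
Proof.
move=> Au; have dI := differentiable_invmx Au.
have did : differentiable (@id 'M[R]_n) A by [].
have [d1 d1E] := mulmx_diff did dI.
have [_ d2E] : differentiable (fun B : 'M[R]_n => B *m invmx B) A /\
    'd (fun B : 'M[R]_n => B *m invmx B) A = 'd (cst 1%:M) A :> (_ -> 'M[R]_n).
  apply: near_eq_differentiable; last exact: differentiable_cst.
  by apply: filterS (unitmx_near Au) => B Bu; rewrite mulmxV.
move: d2E => /(congr1 (fun h : 'M[R]_n -> 'M[R]_n => h H)).
move=> d0.
apply: (invmx_derivE Au); apply: esym.
exact: (etrans (esym (diff_cstE (1%:M : 'M[R]_n) A H))
  (etrans (esym d0) (d1E H _ _ (diff_idE A H) erefl))).
Qed.

(** Multiplying [g = C f] on the right by a fixed right inverse [B] of [f x] makes the square matrix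
    [f y *m B] the identity at [x], hence invertible nearby, and [C = g B (f B)^-1] there.
    Coefficients with respect to a differentiable free family are thus differentiable. *)
Lemma differentiable_coef (E : normedModType R) (p q r : nat)
    (C : E -> 'M[R]_(p, q)) (f : E -> 'M[R]_(q, r)) (g : E -> 'M[R]_(p, r)) x :
  differentiable f x -> differentiable g x -> row_free (f x) ->
  (\forall y \near x, g y = C y *m f y) -> differentiable C x.
Proof.
move=> df dg fx gE; pose B := pinvmx (f x).
have dB : differentiable (cst B : E -> _) x by exact: differentiable_cst.
have [dfB _] := mulmx_diff df dB; have [dgB _] := mulmx_diff dg dB.
have u : f x *m B \in unitmx by rewrite mulmxVp // unitmx1.
have dI := differentiable_comp dfB (differentiable_invmx u).
have [dC _] := mulmx_diff dgB dI.
apply: (near_eq_differentiable _ dC).1.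
have fBn : \forall y \near x, f y *m B \in unitmx.
  exact: (differentiable_continuous dfB (unitmx_near u)).
apply: (@filterS2 _ (nbhs x) _ _ _ _ _ gE fBn) => y gy fBu /=.
by rewrite gy -(mulmxA (C y)) mulmxK.
Qed.

Lemma cvg_invmx (T : Type) (G : set_system T) {FG : Filter G} (n : nat)
    (f : T -> 'M[R]_n) (A : 'M[R]_n) : A \in unitmx ->
  f @ G --> A -> invmx (f x) @[x --> G] --> invmx A.
Proof.
move=> Au fA; apply: (cvg_comp _ _ fA).
exact: (differentiable_continuous (differentiable_invmx Au)).
Qed.

End MatrixNorm.

(** * Derivatives relative to a set of times *)

Section DerivWithin.
Context {R : realType} {E F : normedModType R}.
Implicit Types (A : set R) (t : R).

Lemma hdw_cvg A (f : R -> E) t l :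
  has_deriv_within A f t l -> f @ within A t^' --> f t.
Proof.
move=> fl.
have : (fun s => (s - t) *: ((s - t)^-1 *: (f s - f t)) + f t) @ within A t^'
    --> 0 *: l + f t.
  apply: cvgD; last exact: cvg_cst.
  apply: cvgZ => //.
  have : (fun s : R => s - t) @ within A t^' --> t - t.
    apply: cvgB; last exact: cvg_cst.
    apply: cvg_within_filter; exact: cvg_within.
  by rewrite subrr.
rewrite scale0r add0r => H; apply: cvg_trans H; apply: near_eq_cvg.
have : \forall s \near within A t^', s != t.
  by rewrite near_withinE; apply: filterS (nbhs_dnbhs_neq t).
apply: filterS => s st.
by rewrite scalerA divff ?scale1r ?subrK // subr_eq0.
Qed.

Lemma hdw_eq A (f g : R -> E) t l :
  (\forall s \near within A t^', f s = g s) -> f t = g t ->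
  has_deriv_within A f t l -> has_deriv_within A g t l.
Proof.
move=> fg ft H; apply: cvg_trans H; apply: near_eq_cvg.
by apply: filterS fg => s ->; rewrite ft.
Qed.

Lemma hdw_near A (f g : R -> E) t l :
  (\forall s \near t, A s -> f s = g s) -> f t = g t ->
  has_deriv_within A f t l -> has_deriv_within A g t l.
Proof.
move=> fg; apply: hdw_eq.
by apply: (@filterS _ (nbhs t) _ _ _ _ fg) => s h _; exact: h.
Qed.

Lemma hdw_sub A B (f : R -> E) t l : (\forall s \near t, B s -> A s) ->
  has_deriv_within A f t l -> has_deriv_within B f t l.
Proof.
move=> BA H; apply: cvg_trans H; apply: cvg_app => P.
rewrite /within /= !near_simpl => AP.
have BA' : \forall s \near t^', B s -> A s by apply: cvg_within.
by apply: filterS2 BA' AP => s BAs APs Bs; apply: APs; exact: BAs.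
Qed.

Lemma hdw_cst A (a : E) t : has_deriv_within A (fun=> a) t 0.
Proof.
by rewrite /has_deriv_within subrr; under eq_fun do rewrite scaler0; exact: cvg_cst.
Qed.

Lemma hdwD A (f g : R -> E) t l k : has_deriv_within A f t l ->
  has_deriv_within A g t k -> has_deriv_within A (fun s => f s + g s) t (l + k).
Proof.
move=> fl gk; rewrite /has_deriv_within.
under eq_fun do rewrite opprD addrACA scalerDr.
exact: cvgD.
Qed.

Lemma hdwN A (f : R -> E) t l : has_deriv_within A f t l ->
  has_deriv_within A (fun s => - f s) t (- l).
Proof.
move=> fl; rewrite /has_deriv_within.
under eq_fun do rewrite -opprD scalerN.
exact: cvgN.
Qed.

Lemma hdwZ A (f : R -> E) (c : R) t l : has_deriv_within A f t l ->
  has_deriv_within A (fun s => c *: f s) t (c *: l).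
Proof.
move=> fl; rewrite /has_deriv_within.
under eq_fun do rewrite -scalerBr scalerA mulrC -scalerA.
by apply: cvgZ => //; exact: cvg_cst.
Qed.

Lemma dnbhs_shift (t : R) : (fun h => h + t) @ 0^' = t^'.
Proof.
rewrite predeqE => P; rewrite /= /dnbhs /within /= !near_simpl.
rewrite [in X in _ <-> X](near_shift 0) subr0.
have e h : (h + t != t) = (h != 0).
  by rewrite -subr_eq0 addrK.
split=> H; apply: (@filterS R (nbhs (0 : R)) _ _ _ _ H) => h /=;
  by rewrite -?e // e.
Qed.

(** Gives access to the scalar results stated with [is_derive], such as the mean value theorem. *)
Lemma hdwTE (f : R -> E) t l : has_deriv_within setT f t l <-> is_derive t 1 f l.
Proof.
have e : (fun h => h^-1 *: ((f \o shift t) (h *: 1) - f t)) =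
    (fun s => (s - t)^-1 *: (f s - f t)) \o (fun h => h + t).
  by apply/funext => h /=; rewrite addrK [h *: 1]mulr1.
have e2 : has_deriv_within setT f t l <->
   (fun h => h^-1 *: ((f \o shift t) (h *: 1) - f t)) @ 0^' --> l.
  rewrite /has_deriv_within e.
  have -> : within setT t^' = t^'.
    by rewrite predeqE => P; rewrite /within /=; split; apply: filterS => s; auto.
  rewrite -(dnbhs_shift t) /=; split; apply: cvg_trans; exact: cvg_id.
rewrite e2; split=> [H|[/cvg_ex[k H]]].
  by split; [apply/cvg_ex; exists l|exact: cvg_lim].
by rewrite /derive (cvg_lim _ H) // => <-.
Qed.

Lemma hdwT A (f : R -> E) t l : has_deriv_within setT f t l -> has_deriv_within A f t l.
Proof. by move=> H; apply: hdw_sub H; apply: (@filterE _ (nbhs t)). Qed.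

Lemma hdw_interior A (f : R -> E) t l : nbhs t A ->
  has_deriv_within A f t l -> has_deriv_within setT f t l.
Proof. by move=> tA; apply: hdw_sub; apply: filterS tA. Qed.

Lemma hdw_unique (f : R -> E) t l k : has_deriv_within setT f t l ->
  has_deriv_within setT f t k -> l = k.
Proof. by move=> /hdwTE[_ <-] /hdwTE[_ <-]. Qed.

Lemma hdw_comp A (f : R -> E) (G : E -> F) t l : has_deriv_within A f t l ->
  differentiable G (f t) -> has_deriv_within A (G \o f) t ('d G (f t) l).
Proof.
move=> fl dG; have fc := hdw_cvg fl.
have dl : ('d G (f t) ((s - t)^-1 *: (f s - f t))) @[s --> within A t^'] -->
    'd G (f t) l.
  by apply: (cvg_comp _ _ fl); exact: diff_continuous.
suff H : (fun s => (s - t)^-1 *: (G (f s) - G (f t) - 'd G (f t) (f s - f t)))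
    @ within A t^' --> (0 : F).
  rewrite /has_deriv_within
    (_ : (fun s => (s - t)^-1 *: ((G \o f) s - (G \o f) t)) =
    (fun s => (s - t)^-1 *: (G (f s) - G (f t) - 'd G (f t) (f s - f t)) +
      'd G (f t) ((s - t)^-1 *: (f s - f t)))).
    by rewrite -['d G _ l]add0r; exact: cvgD.
  by apply/funext => s /=; rewrite linearZ -scalerDr subrK.
apply/cvgr0Pnorm_le => e e0.
(* The difference quotient of [f] is eventually at most [|l| + 1], so a remainder bounded by this
   factor times the increment of [f] has quotient at most [e]. *)
have d0 : 0 < e / (`|l| + 1) by rewrite divr_gt0 // ltr_wpDl.
have fc0 : f s - f t @[s --> within A t^'] --> (0 : E).
  by rewrite -(subrr (f t)); apply: cvgB => //; exact: cvg_cst.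
have rem : \forall s \near within A t^',
    `|G (f s) - G (f t) - 'd G (f t) (f s - f t)| <= e / (`|l| + 1) * `|f s - f t|.
  have := fc0 _ (differentiable_remainder dG d0).
  by apply: (@filterS _ (within A t^')) => s /=; rewrite subrK.
have lb : \forall s \near within A t^', `|(s - t)^-1 *: (f s - f t)| <= `|l| + 1.
  have /cvgrPdist_le/(_ 1 ltr01) := fl; apply: filterS => s H.
  by rewrite -lerBlDl (le_trans (ler_norm _))// (le_trans (ler_dist_dist _ _)) // distrC.
apply: filterS2 rem lb => s; rewrite !normrZ => H1 H2.
rewrite (le_trans (ler_wpM2l _ H1)) // mulrCA -ler_pdivlMl // invf_div mulrC.
by rewrite divfK ?gt_eqF // mulrC.
Qed.

End DerivWithin.

Section MatrixDerivWithin.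
Context {R : realType}.
Implicit Types (A : set R) (t : R).

Lemma hdw_mulmx (p q r : nat) A (f : R -> 'M[R]_(p, q)) (g : R -> 'M[R]_(q, r))
    t (df : 'M[R]_(p, q)) (dg : 'M[R]_(q, r)) : has_deriv_within A f t df ->
  has_deriv_within A g t dg ->
  has_deriv_within A (fun s => f s *m g s) t (df *m g t + f t *m dg).
Proof.
move=> fl gl; have gc := hdw_cvg gl; rewrite /has_deriv_within.
rewrite (_ : (fun s => (s - t)^-1 *: (f s *m g s - f t *m g t)) =
  (fun s => (s - t)^-1 *: (f s - f t) *m g s + f t *m ((s - t)^-1 *: (g s - g t)))).
  apply: cvgD; apply: cvg_mulmx => //; exact: cvg_cst.
apply/funext => s.
by rewrite -scalemxAl -scalemxAr -scalerDr mulmxBl mulmxBr addrA subrK.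
Qed.

Lemma hdw_entry (p q : nat) A (f : R -> 'M[R]_(p, q)) t df i j :
  has_deriv_within A f t df ->
  has_deriv_within A (fun s => f s i j : R^o) t (df i j : R^o).
Proof.
move=> H; rewrite /has_deriv_within.
rewrite (_ : (fun _ => _) = fun s => ((s - t)^-1 *: (f s - f t)) i j).
  exact: cvg_mx_entry.
by apply/funext => s; rewrite !mxE.
Qed.

Lemma hdw_mx (p q : nat) A (f : R -> 'M[R]_(p, q)) t (df : 'M[R]_(p, q)) :
  (forall i j, has_deriv_within A (fun s => f s i j : R^o) t (df i j : R^o)) ->
  has_deriv_within A f t df.
Proof.
move=> H; apply: cvg_mx => i j.
by under eq_fun do rewrite !mxE; exact: H.
Qed.

Lemma hdw_tr (p q : nat) A (f : R -> 'M[R]_(p, q)) t (df : 'M[R]_(p, q)) :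
  has_deriv_within A f t df -> has_deriv_within A (fun s => (f s)^T) t df^T.
Proof.
move=> H; apply: hdw_mx => i j; rewrite mxE.
by under eq_fun do rewrite mxE; exact: hdw_entry.
Qed.

Lemma hdw_trace (n : nat) A (f : R -> 'M[R]_n) t (df : 'M[R]_n) :
  has_deriv_within A f t df -> has_deriv_within A (fun s => \tr (f s) : R^o) t (\tr df : R^o).
Proof.
move=> H; rewrite /has_deriv_within /mxtrace.
rewrite (_ : (fun _ => _) = fun s => \sum_i ((s - t)^-1 *: (f s i i - f t i i : R^o))).
  by apply: cvg_big => [|i _]; [exact: add_continuous|exact: hdw_entry].
by apply/funext => s; rewrite -scaler_sumr sumrB.
Qed.

Lemma hdw_col_mx (p q r : nat) A (f : R -> 'M[R]_(p, r)) (g : R -> 'M[R]_(q, r))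
    t (df : 'M[R]_(p, r)) (dg : 'M[R]_(q, r)) : has_deriv_within A f t df ->
  has_deriv_within A g t dg ->
  has_deriv_within A (fun s => col_mx (f s) (g s)) t (col_mx df dg).
Proof.
move=> Hf Hg; apply: hdw_mx => i j.
by case: (split_ordP i) => k ->; rewrite ?col_mxEu ?col_mxEd;
  under eq_fun do rewrite ?col_mxEu ?col_mxEd; exact: hdw_entry.
Qed.

Lemma hdw_invmx (n : nat) A (f : R -> 'M[R]_n) t (df : 'M[R]_n) : f t \in unitmx ->
  has_deriv_within A f t df ->
  has_deriv_within A (fun s => invmx (f s)) t (- (invmx (f t) *m df *m invmx (f t))).
Proof.
move=> u H; have := hdw_comp H (differentiable_invmx u).
by rewrite (diff_invmx _ u).
Qed.

End MatrixDerivWithin.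

(** * Mean value and Gronwall estimates *)

Section MeanValue.
Context {R : realType} {p q : nat}.
Implicit Types (f df : R -> 'M[R]_(p, q)) (a b K L e : R).

Lemma hdw_within_cvg (E : normedModType R) (A : set R) (f : R -> E) t l :
  has_deriv_within A f t l -> f @ within A (nbhs t) --> f t.
Proof.
move=> /hdw_cvg fc P /= Pt.
have : nbhs t (fun s => s != t -> A s -> P (f s)) := fc _ Pt.
apply: (@filterS _ (nbhs t)) => s H As.
by have [->|st] := eqVneq s t; [exact: nbhs_singleton Pt|exact: H].
Qed.

Lemma hdw_continuous (E : normedModType R) (f : R -> E) t l :
  has_deriv_within setT f t l -> {for t, continuous f}.
Proof.
move=> /hdw_within_cvg fc P /= Pt.
have : nbhs t (fun s => setT s -> P (f s)) := fc _ Pt.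
by apply: (@filterS _ (nbhs t)) => s; exact.
Qed.

Lemma hdw_within_continuous (E : normedModType R) (A : set R) (f df : R -> E) :
  (forall x, A x -> has_deriv_within A f x (df x)) -> {within A, continuous f}.
Proof.
by move=> fd; apply/subspace_continuousP => x /fd; exact: hdw_within_cvg.
Qed.

Lemma continuous_within_entry f (A : set R) i j :
  {within A, continuous f} -> {within A, continuous (fun x => f x i j)}.
Proof.
move=> /subspace_continuousP H; apply/subspace_continuousP => x Ax.
by apply: cvg_mx_entry; exact: H.
Qed.

(** The norm of a matrix is the maximum of its entries, so the scalar mean value theorem applied
    entry by entry loses no constant. *)
Lemma mvt_mx f df K a b : a <= b ->
  (forall x, a < x < b -> has_deriv_within setT f x (df x)) ->
  (forall x, a < x < b -> `|df x| <= K) ->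
  {within `[a, b], continuous f} -> `|f b - f a| <= K * (b - a).
Proof.
rewrite le_eqVlt => /predU1P[->|ab] fd fK fc.
  by rewrite !subrr normr0 mulr0.
have K0 : 0 <= K.
  by apply: le_trans (normr_ge0 _) (fK ((a + b) / 2) _); rewrite !midf_lt.
apply: mx_norm_leP => [|i j]; first by rewrite mulr_ge0 // subr_ge0 ltW.
rewrite !mxE.
have [||c cab ->] := @MVT _ (fun x => f x i j) (fun x => df x i j) _ _ ab.
- by move=> x; rewrite in_itv /= => xab; apply/hdwTE/hdw_entry/fd.
- exact: continuous_within_entry.
- have ba0 : 0 <= b - a by rewrite subr_ge0 ltW.
  rewrite normrM (ger0_norm ba0) ler_wpM2r // (le_trans (mx_entry_le _ _ _)) // fK //.
Qed.

Lemma gronwall_short f df L e a b x0 x : 0 <= L -> 0 <= e -> L * (b - a) <= 2^-1 ->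
  (forall x, a < x < b -> has_deriv_within setT f x (df x)) ->
  (forall x, a < x < b -> `|df x| <= L * `|f x| + e) ->
  {within `[a, b], continuous f} -> a <= x0 <= b -> a <= x <= b ->
  `|f x| <= 2 * `|f x0| + 2 * (b - a) * e.
Proof.
move=> L0 e0 Lab fd fK fc x0ab xab.
have ab : a <= b by case/andP: xab; exact: le_trans.
have nc : {within `[a, b], continuous (fun x => `|f x|)}.
  by move=> y; apply: cvg_norm; exact: fc.
have [c cab cmax] := EVT_max ab nc.
have {}cmax y : a <= y <= b -> `|f y| <= `|f c| by move=> ?; apply: cmax; rewrite in_itv.
suff H : `|f c - f x0| <= (L * `|f c| + e) * (b - a).
  have : `|f c| <= `|f x0| + (L * `|f c| + e) * (b - a).
    by rewrite -lerBlDl (le_trans _ H) // (le_trans (ler_norm _)) // ler_dist_dist.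
  have := ler_wpM2r (normr_ge0 (f c)) Lab.
  have := cmax x xab; nra.
have P y z : a <= y -> z <= b -> y <= z -> `|f z - f y| <= (L * `|f c| + e) * (b - a).
  move=> ay zb yz.
  have : `|f z - f y| <= (L * `|f c| + e) * (z - y).
    apply: (mvt_mx yz (df := df)).
    - by move=> u /andP[yu uz]; apply: fd; rewrite (le_lt_trans ay) // (lt_le_trans uz).
    - move=> u /andP[yu uz].
      have uab : a < u < b by rewrite (le_lt_trans ay) // (lt_le_trans uz).
      rewrite (le_trans (fK u uab)) // lerD2r ler_wpM2l // cmax //.
      by case/andP: uab => *; rewrite !ltW.
    - apply: continuous_subspaceW fc; apply: subset_itv; by rewrite bnd_simp.
  move=> /le_trans; apply; apply: ler_wpM2l; first by rewrite addr_ge0 // mulr_ge0.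
  lra.
move: x0ab cab; rewrite in_itv /= => /andP[x0a x0b] /andP[ca cb].
by have [h|/ltW h] := leP x0 c; [|rewrite distrC]; exact: P.
Qed.

End MeanValue.

Section SegmentMVT.
Context {R : realType} {E : normedModType R} {p q : nat}.

Lemma hdw_affine (A : set R) (x v : E) t : has_deriv_within A (fun s => x + s *: v) t v.
Proof.
apply: (@cvg_trans _ (cst v @ within A t^')); last exact: cvg_cst.
apply: near_eq_cvg; rewrite near_withinE; apply: filterS (nbhs_dnbhs_neq t) => s st _ /=.
by rewrite opprD addrACA subrr add0r -scalerBl scalerA mulVf ?scale1r // subr_eq0.
Qed.

Lemma mvt_segment (f : E -> 'M[R]_(p, q)) x y K :
  (forall s, 0 <= s <= 1 -> differentiable f (x + s *: (y - x)) /\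
     `|'d f (x + s *: (y - x)) (y - x)| <= K) -> `|f y - f x| <= K.
Proof.
move=> H; pose g := f \o (fun s : R => x + s *: (y - x)).
have gd A s : 0 <= s <= 1 -> has_deriv_within A g s ('d f (x + s *: (y - x)) (y - x)).
  by move=> s01; apply: hdw_comp; [exact: hdw_affine|exact: (H s s01).1].
have -> : f y - f x = g 1 - g 0.
  by rewrite /g /= scale1r scale0r addr0 (addrC x) subrK.
have := @mvt_mx _ _ _ g _ K 0 1 ler01 _ _ _; rewrite subr0 mulr1; apply.
- by move=> s /andP[s0 s1]; apply: gd; rewrite !ltW.
- by move=> s /andP[s0 s1]; apply: (H s _).2; rewrite !ltW.
- by apply: hdw_within_continuous => s /=; rewrite in_itv /=; exact: gd.
Qed.

End SegmentMVT.

(** * Smooth maps *)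

Section Smooth.
Context {R : realType}.

(** Regroups the condition of [smooth_on] by order of differentiation, so that closure properties
    follow by induction. The index 0 already means differentiable. *)
Fixpoint Ck (E F : normedModType R) (k : nat) (U : set E) (f : E -> F) : Prop :=
  (forall x, U x -> differentiable f x) /\
  if k is k'.+1 then forall v, Ck k' U ('D_v f) else True.

Lemma smooth_onP (E F : normedModType R) (U : set E) (f : E -> F) :
  smooth_on U f <-> forall k, Ck k U f.
Proof.
split=> [H k|].
  elim: k f H => [|k IH] f H /=; split; try by [|move=> x; exact: (H [::])].
  (* The last direction of the list is the innermost derivative. *)
  by move=> v; apply: IH => s x Ux; have := H (rcons s v) x Ux; rewrite foldr_rcons.
move=> H s; elim/last_ind: s f H => [|s v IH] f H x Ux; first exact: (H 0%N).1.
by rewrite foldr_rcons; apply: IH => // k; have [_] := H k.+1; exact.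
Qed.

Lemma Ck_differentiable (E F : normedModType R) k (U : set E) (f : E -> F) x :
  Ck k U f -> U x -> differentiable f x.
Proof. by case: k => [|k] [H _]; exact: H. Qed.

Lemma smooth_differentiable (E F : normedModType R) (U : set E) (f : E -> F) x :
  smooth_on U f -> U x -> differentiable f x.
Proof. by move=> H; exact: (H [::]). Qed.

Lemma smooth_derive (E F : normedModType R) (U : set E) (f : E -> F) v :
  smooth_on U f -> smooth_on U ('D_v f).
Proof. by move=> /smooth_onP H; apply/smooth_onP => k; have [_] := H k.+1; exact. Qed.

Lemma smooth_on_sub (E F : normedModType R) (U V : set E) (f : E -> F) :
  V `<=` U -> smooth_on U f -> smooth_on V f.
Proof. by move=> VU H s x Vx; apply: H; exact: VU. Qed.

Lemma near_eq_derive_open (E F : normedModType R) (U : set E) (f g : E -> F) x v :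
  open U -> (forall x, U x -> f x = g x) -> U x -> differentiable f x ->
  differentiable g x /\ 'D_v f x = 'D_v g x.
Proof.
move=> oU fg Ux fd.
have gf : \forall y \near x, g y = f y.
  by apply: filterS (open_nbhs_nbhs (conj oU Ux)) => y /fg.
have [gd gE] := near_eq_differentiable gf fd.
split; first exact: gd.
exact: (etrans (deriveE v fd) (etrans (congr1 (@^~ v) (esym gE)) (esym (deriveE v gd)))).
Qed.

Lemma Ck_eq (E F : normedModType R) k (U : set E) (f g : E -> F) : open U ->
  (forall x, U x -> f x = g x) -> Ck k U f -> Ck k U g.
Proof.
move=> oU.
have P (h1 h2 : E -> F) x v := @near_eq_derive_open _ _ U h1 h2 x v oU.
elim: k f g => [|k IH] f g fg [fd fk].
  by split; [move=> x Ux; exact: (P _ _ _ 0 fg Ux (fd x Ux)).1|exact: I].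
split; first by move=> x Ux; exact: (P _ _ _ 0 fg Ux (fd x Ux)).1.
move=> v; apply: IH (fk v) => x Ux; exact: (P _ _ _ v fg Ux (fd x Ux)).2.
Qed.

Lemma CkW (E F : normedModType R) k (U : set E) (f : E -> F) : Ck k.+1 U f -> Ck k U f.
Proof.
elim: k f => [|k IH] f; first by case.
by move=> [fd fk]; split; [exact: fd|move=> v; apply: IH; exact: fk].
Qed.

Lemma CkS (E F : normedModType R) k (U : set E) (f : E -> F) (df : E -> E -> F) :
  open U -> (forall x, U x -> differentiable f x) ->
  (forall v x, U x -> 'd f x v = df v x) ->
  (forall v, Ck k U (df v)) -> Ck k.+1 U f.
Proof.
move=> oU fd dfE H; split; first exact: fd.
move=> v; apply: (Ck_eq oU _ (H v)) => x Ux.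
exact: (etrans (esym (dfE v x Ux)) (esym (deriveE v (fd x Ux)))).
Qed.

Lemma Ck_diff (E F : normedModType R) k (U : set E) (f : E -> F) v : open U ->
  Ck k.+1 U f -> Ck k U (fun x => 'd f x v).
Proof.
move=> oU [fd fk]; apply: (Ck_eq oU _ (fk v)) => x Ux.
exact: deriveE (fd x Ux).
Qed.

Lemma CkD (E F : normedModType R) k (U : set E) (f g : E -> F) : open U ->
  Ck k U f -> Ck k U g -> Ck k U (f + g).
Proof.
move=> oU; elim: k f g => [|k IH] f g fC gC.
  split; [move=> x Ux|exact: I].
  exact: differentiableD (Ck_differentiable fC Ux) (Ck_differentiable gC Ux).
apply: (CkS (df := fun v x => 'd f x v + 'd g x v) oU).
- move=> x Ux.
  exact: differentiableD (Ck_differentiable fC Ux) (Ck_differentiable gC Ux).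
- move=> v x Ux.
  by have /(congr1 (@^~ v)) := diffD (Ck_differentiable fC Ux) (Ck_differentiable gC Ux).
- by move=> v; exact: IH (Ck_diff v oU fC) (Ck_diff v oU gC).
Qed.

Lemma Ck_cst (E F : normedModType R) k (U : set E) (a : F) : open U -> Ck k U (cst a).
Proof.
move=> oU; elim: k a => [|k IH] a.
  by split; [move=> x _; exact: differentiable_cst|exact: I].
apply: (CkS (df := fun v => cst 0) oU).
- move=> x _; exact: differentiable_cst.
- by move=> v x _; exact: diff_cstE.
- by move=> v; exact: IH.
Qed.

Lemma Ck_sum (E F : normedModType R) k (U : set E) (I : Type) (s : seq I)
    (f : I -> E -> F) : open U ->
  (forall i, Ck k U (f i)) -> Ck k U (fun x => \sum_(i <- s) f i x).
Proof.
move=> oU H; elim: s => [|i s IH].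
  by under eq_fun do rewrite big_nil; exact: Ck_cst.
under eq_fun do rewrite big_cons.
exact: (CkD oU (H i) IH).
Qed.

Lemma Ck_linear (E F G : normedModType R) k (U : set E) (f : E -> F)
    (L : {linear F -> G}) : open U -> continuous L -> Ck k U f -> Ck k U (L \o f).
Proof.
move=> oU cL.
have Ld y : differentiable L y by exact: linear_differentiable.
have Lf (g : E -> F) x : differentiable g x -> differentiable (L \o g) x.
  by move=> gd; exact: differentiable_comp gd (Ld _).
elim: k f => [|k IH] f fC.
  by split; [move=> x Ux; exact: Lf (Ck_differentiable fC Ux)|exact: I].
apply: (CkS (df := fun v x => L ('d f x v)) oU).
- by move=> x Ux; exact: Lf (Ck_differentiable fC Ux).
- move=> v x Ux; have /(congr1 (@^~ v)) := diff_comp (Ck_differentiable fC Ux) (Ld (f x)).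
  move=> H; have Lx := congr1 (@^~ ('d f x v)) (diff_lin (f x) cL).
  exact: (etrans H Lx).
- by move=> v; exact: IH (Ck_diff v oU fC).
Qed.

Lemma Ck_mulmx (E : normedModType R) k (U : set E) (p q r : nat)
    (f : E -> 'M[R]_(p, q)) (g : E -> 'M[R]_(q, r)) : open U ->
  Ck k U f -> Ck k U g -> Ck k U (fun x => f x *m g x).
Proof.
move=> oU; elim: k f g => [|k IH] f g fC gC.
  split; [move=> x Ux|exact: I].
  exact: (mulmx_diff (Ck_differentiable fC Ux) (Ck_differentiable gC Ux)).1.
have P x Ux := mulmx_diff (@Ck_differentiable _ _ _ _ _ x fC Ux)
  (@Ck_differentiable _ _ _ _ _ x gC Ux).
apply: (CkS (df := fun v x => 'd f x v *m g x + f x *m 'd g x v) oU).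
- by move=> x Ux; exact: (P x Ux).1.
- by move=> v x Ux; exact: (P x Ux).2.
- move=> v; exact: (CkD oU (IH _ _ (Ck_diff v oU fC) (CkW gC))
    (IH _ _ (CkW fC) (Ck_diff v oU gC))).
Qed.

Lemma smoothB (E F : normedModType R) (U : set E) (f g : E -> F) : open U ->
  smooth_on U f -> smooth_on U g -> smooth_on U (fun x => f x - g x).
Proof.
move=> oU /smooth_onP Hf /smooth_onP Hg; apply/smooth_onP => k.
apply: (CkD oU (Hf k)).
under eq_fun do rewrite -scaleN1r.
exact: (@Ck_linear _ _ _ k U g ( *:%R (-1)) oU (@scaler_continuous _ _ (-1)) (Hg k)).
Qed.

Lemma diff_rV_sum (n : nat) (F : normedModType R) (f : 'rV[R]_n -> F) x v :
  'd f x v = \sum_j v 0 j *: 'd f x (delta_mx 0 j).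
Proof.
rewrite {1}(row_sum_delta v) linear_sum.
by apply: eq_bigr => j _; rewrite linearZ.
Qed.

(** Expanding the direction in the standard basis leaves products of the components of [g] with
    derivatives of [f] in constant directions. *)
Lemma smooth_diff_apply (n q : nat) (U : set 'rV[R]_n) (f : 'rV[R]_n -> 'rV[R]_q)
    (g : 'rV[R]_n -> 'rV[R]_n) : open U ->
  smooth_on U f -> smooth_on U g -> smooth_on U (fun x => 'd f x (g x)).
Proof.
move=> oU /smooth_onP Hf /smooth_onP Hg; apply/smooth_onP => k.
(* The component [g x 0 j] is written as a 1 x 1 matrix, so that [Ck_mulmx] covers the
   multiplication by this scalar. *)
have H : Ck k U (fun x => \sum_j (g x *m delta_mx j (0 : 'I_1)) *m 'd f x (delta_mx 0 j)).
  apply: Ck_sum => // j; apply: Ck_mulmx => //; last exact: Ck_diff.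
  by apply: Ck_mulmx => //; exact: Ck_cst.
apply: (Ck_eq oU _ H) => x Ux.
rewrite diff_rV_sum; apply: eq_bigr => j _.
rewrite -colE; move: ('d f x _ : 'rV[R]_q) => w.
by apply/rowP => i; rewrite !mxE big_ord1 !mxE.
Qed.

End Smooth.

(** * Symmetry of second derivatives *)

Section Schwarz.
Context {R : realType} {E : normedModType R} {p q : nat}.

Lemma second_difference_sub (a b c d u v : 'M[R]_(p, q)) k :
  k *: (u - v) = (a - c - (b - d) - k *: v) - (a - b - (c - d) - k *: u).
Proof. by apply/matrixP => i j; rewrite !mxE; ring. Qed.

(** The error is [chi s - chi 0], where [chi] lets the displacement along [u] vary from 0 to [s].
    The derivative of [chi] is a difference of two values of [D] minus its linear part, which the
    first order expansion of [D] at [x] controls. *)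
Lemma second_difference (f : E -> 'M[R]_(p, q)) x u v e : 0 < e ->
  (\forall y \near x, differentiable f y) ->
  differentiable (fun y => 'd f y u) x ->
  exists2 d, 0 < d & forall s, 0 < s < d ->
    `|f (x + s *: u + s *: v) - f (x + s *: u) - (f (x + s *: v) - f x) -
      s ^+ 2 *: 'd (fun y => 'd f y u) x v| <= e * s ^+ 2.
Proof.
move=> e0 fd Dd; set D := fun y => 'd f y u; set L := 'd D x.
(* [s * (2 * |u| + |v|)] bounds the sum of the norms of the two displacements [s *: v + r *: u] and
   [r *: u]; adding 1 keeps the denominator positive. *)
have c0 : 0 < 2 * `|u| + `|v| + 1 by rewrite ltr_wpDl // addr_ge0 // mulr_ge0.
have [d1 d10 fd1] := (nbhs_ballP _ _).1 fd.
have [d2 d20 D2] := (nbhs_ballP _ _).1 (differentiable_remainder Dd (divr_gt0 e0 c0)).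
exists (Num.min d1 d2 / (2 * `|u| + `|v| + 1)).
  by rewrite divr_gt0 // lt_min; apply/andP.
move=> s /andP[s0]; rewrite ltr_pdivlMr // lt_min => /andP[sd1 sd2].
have small w : `|w| <= s * (2 * `|u| + `|v|) -> `|w| < d1 /\ `|w| < d2.
  by move=> h; split; apply: le_lt_trans h _; apply: lt_trans sd1 || apply: lt_trans sd2;
    rewrite ltr_pM2l // ltrDl.
have fdw w : `|w| <= s * (2 * `|u| + `|v|) -> differentiable f (x + w).
  move=> /small[h _]; apply: fd1.
  by rewrite -ball_normE /ball_ /= opprD addrA subrr add0r normrN.
have Dw w : `|w| <= s * (2 * `|u| + `|v|) ->
    `|D (w + x) - D x - L w| <= e / (2 * `|u| + `|v| + 1) * `|w|.
  move=> /small[_ h]; apply: (D2 w).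
  by rewrite -ball_normE /ball_ /= sub0r normrN.
pose chi r := f (x + s *: v + r *: u) - f (x + r *: u) - (r * s) *: L v.
pose dchi r := D (x + s *: v + r *: u) - D (x + r *: u) - s *: L v.
have bnd1 r : 0 <= r <= s -> `|s *: v + r *: u| <= s * (`|u| + `|v|).
  move=> /andP[r0 rs]; rewrite (le_trans (ler_normD _ _)) // !normrZ !ger0_norm //.
    by rewrite mulrDr addrC lerD // ler_wpM2r.
  exact: ltW.
have bnd2 r : 0 <= r <= s -> `|r *: u| <= s * `|u|.
  by move=> /andP[r0 rs]; rewrite normrZ ger0_norm // ler_wpM2r.
have le1 r : 0 <= r <= s -> `|s *: v + r *: u| <= s * (2 * `|u| + `|v|).
  move=> /bnd1 /le_trans; apply; rewrite ler_pM2l // lerD2r.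
  by rewrite mulr_natl mulr2n lerDl.
have le2 r : 0 <= r <= s -> `|r *: u| <= s * (2 * `|u| + `|v|).
  move=> /bnd2 /le_trans; apply; rewrite ler_pM2l //.
  by have := normr_ge0 u; have := normr_ge0 v; lra.
have chid r : 0 <= r <= s -> has_deriv_within setT chi r (dchi r).
  move=> rs.
  have A w : `|w + r *: u| <= s * (2 * `|u| + `|v|) ->
      has_deriv_within setT (f \o (fun t => (x + w) + t *: u)) r (D (x + w + r *: u)).
    by move=> h; apply: hdw_comp; [exact: hdw_affine|rewrite -addrA; exact: fdw].
  have h1 := A _ (le1 r rs); have h2 := A 0; rewrite add0r addr0 in h2.
  have {}h2 := h2 (le2 r rs).
  have h3 : has_deriv_within setT (fun t => (t * s) *: L v) r (s *: L v).
    have := @hdw_affine R _ setT 0 (s *: L v) r.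
    by under eq_fun do rewrite add0r scalerA.
  exact: hdwD (hdwD h1 (hdwN h2)) (hdwN h3).
have chiE : f (x + s *: u + s *: v) - f (x + s *: u) - (f (x + s *: v) - f x) -
      s ^+ 2 *: L v = chi s - chi 0.
  rewrite /chi !scale0r !addr0 mul0r scale0r subr0 expr2 addrAC.
  by rewrite (addrAC x).
rewrite chiE.
have := @mvt_mx _ _ _ chi dchi (e * s) 0 s (ltW s0) _ _ _.
rewrite subr0 -mulrA -expr2; apply.
- by move=> r /andP[r0 rs]; apply: chid; rewrite !ltW.
- move=> r /andP[/ltW r0 /ltW rs]; have r0s : 0 <= r <= s by apply/andP.
  have H1 := Dw _ (le1 r r0s); have H2 := Dw _ (le2 r r0s).
  have -> : dchi r = (D (s *: v + r *: u + x) - D x - L (s *: v + r *: u)) -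
      (D (r *: u + x) - D x - L (r *: u)).
    have -> : L (s *: v + r *: u) = s *: L v + L (r *: u) by rewrite linearD linearZ.
    rewrite (addrC _ x) (addrC (r *: u)) addrA.
    rewrite /dchi; move: (D _) (D _) (D _) (L v) (L _) => A1 A2 A3 A4 A5.
    by apply/matrixP => i j; rewrite !mxE; ring.
  rewrite (le_trans (ler_normB _ _)) // (le_trans (lerD H1 H2)) // -mulrDr.
  rewrite mulrAC ler_pdivrMr // -mulrA ler_pM2l //.
  have := bnd1 r r0s; have := bnd2 r r0s; nra.
- apply: hdw_within_continuous => r /=; rewrite in_itv /= => r0s.
  exact/hdwT/chid.
Qed.

(** The second difference is symmetric in [u] and [v], and it agrees with [s ^+ 2] times either
    mixed derivative up to [e / 2 * s ^+ 2]. *)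
Lemma schwarz (f : E -> 'M[R]_(p, q)) x u v :
  (\forall y \near x, differentiable f y) ->
  differentiable (fun y => 'd f y u) x -> differentiable (fun y => 'd f y v) x ->
  'd (fun y => 'd f y u) x v = 'd (fun y => 'd f y v) x u.
Proof.
move=> fd ud vd; apply/eqP; rewrite -subr_eq0 -normr_eq0 eq_le normr_ge0 andbT.
apply/ler_addgt0Pl => e e0; rewrite addr0.
have e20 : 0 < e / 2 by rewrite divr_gt0.
have [d1 d10 H1] := second_difference v e20 fd ud.
have [d2 d20 H2] := second_difference u e20 fd vd.
pose s := Num.min d1 d2 / 2.
have m0 : 0 < Num.min d1 d2 by rewrite lt_min; apply/andP.
have s0 : 0 < s by rewrite divr_gt0.
have sm : s < Num.min d1 d2 by rewrite ltr_pdivrMr // ltr_pMr // ltr1n.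
move: (sm); rewrite lt_min => /andP[sd1 sd2].
have {}H1 := H1 s (introT andP (conj s0 sd1)).
have {}H2 := H2 s (introT andP (conj s0 sd2)).
have s20 : 0 < s ^+ 2 by rewrite exprn_gt0.
rewrite -(ler_pM2l s20) -[X in X * _](ger0_norm (ltW s20)) -normrZ.
have -> : s ^+ 2 * e = e / 2 * s ^+ 2 + e / 2 * s ^+ 2 by field.
apply: le_trans (lerD H2 H1); apply: le_trans (ler_normB _ _).
rewrite (addrAC x (s *: u)).
rewrite le_eqVlt; apply/orP; left; apply/eqP; congr (`|_|).
exact: second_difference_sub.
Qed.

End Schwarz.

(** * Lipschitz and second order bounds for smooth maps *)

Section LocalLipschitz.
Context {R : realType} {n q : nat}.
Implicit Types (F : 'rV[R]_n -> 'rV[R]_q) (U : set 'rV[R]_n).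

Lemma dist_le_trans (G : normedModType R) (a b a' b' : G) (K : R) :
  a = a' -> b = b' -> `|a - b| <= K -> `|a' - b'| <= K.
Proof. by move=> -> ->. Qed.

Lemma linear_sub_norm_le (G : normedModType R) (L1 L2 : {linear 'rV[R]_n -> G}) v K :
  (forall j, `|L1 (delta_mx 0 j) - L2 (delta_mx 0 j)| <= K) ->
  `|L1 v - L2 v| <= (n%:R * K) * `|v|.
Proof.
have E (L : {linear 'rV[R]_n -> G}) : L v = \sum_j v 0 j *: L (delta_mx 0 j).
  rewrite {1}(row_sum_delta v) linear_sum.
  by apply: eq_bigr => j _; rewrite linearZ.
move=> H; rewrite !E -sumrB (le_trans (ler_norm_sum _ _ _)) //.
apply: (@le_trans _ _ (\sum_(j < n) K * `|v|)).
  apply: ler_sum => j _; rewrite -scalerBr normrZ mulrC.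
  by apply: ler_pM => //; exact: mx_entry_le.
by rewrite sumr_const card_ord -[leLHS]mulr_natl mulrA.
Qed.

Lemma diff_norm_le F x v K :
  (forall j, `|'d F x (delta_mx 0 j)| <= K) -> `|'d F x v| <= (n%:R * K) * `|v|.
Proof.
move=> H; rewrite -['d F x v]subr0.
by apply: (@linear_sub_norm_le _ ('d F x) \0) => j; rewrite subr0.
Qed.

Lemma smooth_diff_bounded U F x0 : open U -> smooth_on U F -> U x0 ->
  exists2 K, 0 <= K & \forall x \near x0, U x /\ forall v, `|'d F x v| <= K * `|v|.
Proof.
move=> oU sF Ux0.
have nU : \forall x \near x0, U x by exact: open_nbhs_nbhs.
pose K0 := \sum_j `|'D_(delta_mx 0 j) F x0| + 1.
exists (n%:R * K0); first by rewrite mulr_ge0 // addr_ge0 // sumr_ge0.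
have H : \forall x \near x0, forall j : 'I_n, `|'D_(delta_mx 0 j) F x| <= K0.
  apply: (@filter_forall _ _ (fun j x => `|'D_(delta_mx 0 j) F x| <= K0) (nbhs x0)) => j.
  have cj := differentiable_continuous
    (smooth_differentiable (smooth_derive (delta_mx 0 j) sF) Ux0).
  have /cvgrPdistC_le/(_ 1 ltr01) := cj; apply: filterS => x h.
  rewrite /K0 (bigD1 j) //= -addrA -lerBlDl.
  apply: (@le_trans _ _ 1); last by rewrite lerDr sumr_ge0.
  exact: le_trans (lerB_dist _ _) h.
apply: filterS2 nU H => x Ux Hx; split => // v.
by apply: diff_norm_le => j; rewrite -(deriveE _ (smooth_differentiable sF Ux)).
Qed.

Lemma ball_segment (E : normedModType R) (x0 x y : E) r s :
  `|x - x0| < r -> `|y - x0| < r -> 0 <= s <= 1 -> `|x + s *: (y - x) - x0| < r.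
Proof.
move=> xr yr /andP[s0 s1].
have -> : x + s *: (y - x) - x0 = (1 - s) *: (x - x0) + s *: (y - x0).
  rewrite scalerBl scale1r -[RHS]addrA -scalerN -scalerDr opprB.
  by rewrite [x0 - x + _]addrC addrA subrK addrAC.
rewrite (le_lt_trans (ler_normD _ _)) // !normrZ !ger0_norm ?subr_ge0 //.
have Mr : Num.max `|x - x0| `|y - x0| < r by rewrite gt_max xr.
apply: le_lt_trans Mr.
have xM : `|x - x0| <= Num.max `|x - x0| `|y - x0| by rewrite le_max lexx.
have yM : `|y - x0| <= Num.max `|x - x0| `|y - x0| by rewrite le_max lexx orbT.
move: xM yM; move: `|x - x0| `|y - x0| (Num.max _ _) => a b M; nra.
Qed.

(** On a small ball, which is convex, the differential of [F] and those of its partial derivatives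
    are bounded. The quadratic estimate of the remainder is what makes local flows differentiable in
    the initial point. *)
Lemma smooth_local_lipschitz U F x0 : open U -> smooth_on U F -> U x0 ->
  exists r K, [/\ 0 < r, 0 <= K & forall x, `|x - x0| < r ->
    [/\ U x, forall v, `|'d F x v| <= K * `|v| &
     forall y, `|y - x0| < r ->
       `|F y - F x| <= K * `|y - x| /\
       `|F y - F x - 'd F x (y - x)| <= K * `|y - x| ^+ 2]].
Proof.
move=> oU sF Ux0.
have [K K0 nK] := smooth_diff_bounded oU sF Ux0.
have /choice[k kP] j : exists Kj, 0 <= Kj /\ \forall x \near x0,
    U x /\ forall v, `|'d ('D_(delta_mx 0 j) F) x v| <= Kj * `|v|.
  have [Kj *] := smooth_diff_bounded oU (smooth_derive (delta_mx (0 : 'I_1) (j : 'I_n)) sF) Ux0.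
  by exists Kj.
pose K2 := n%:R * \sum_j k j.
have K20 : 0 <= K2 by rewrite mulr_ge0 // sumr_ge0 // => j _; exact: (kP j).1.
have nk : \forall x \near x0, forall j : 'I_n,
    U x /\ forall v, `|'d ('D_(delta_mx 0 j) F) x v| <= k j * `|v|.
  apply: (@filter_forall _ _ (fun j x => U x /\
    forall v, `|'d ('D_(delta_mx 0 j) F) x v| <= k j * `|v|) (nbhs x0)) => j.
  exact: (kP j).2.
have [r r0 H] := (nbhs_ballP _ _).1 (filterI nK nk).
have {}H x : `|x - x0| < r -> (U x /\ forall v, `|'d F x v| <= K * `|v|) /\
    forall j : 'I_n, U x /\ forall v, `|'d ('D_(delta_mx 0 j) F) x v| <= k j * `|v|.
  by move=> xr; apply: H; rewrite -ball_normE /ball_ /= distrC.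
exists r, (K + K2); split=> // [|x xr]; first exact: addr_ge0.
have [[Ux dx] _] := H x xr; split=> // [v|y yr].
  by rewrite (le_trans (dx v)) // ler_wpM2r // lerDl.
have seg s : 0 <= s <= 1 -> `|x + s *: (y - x) - x0| < r by exact: ball_segment.
split.
  apply: (@mvt_segment _ _ _ _ F x y) => s s01; have [[Us ds] _] := H _ (seg s s01).
  split; first exact: smooth_differentiable sF Us.
  by rewrite (le_trans (ds _)) // ler_wpM2r // lerDl.
have dlip z : `|z - x0| < r -> forall v, `|'d F z v - 'd F x v| <= K2 * `|z - x| * `|v|.
  move=> zr v; rewrite /K2 -(mulrA n%:R).
  apply: linear_sub_norm_le => j.
  apply: (dist_le_trans (deriveE _ (smooth_differentiable sF (H z zr).1.1))
    (deriveE _ (smooth_differentiable sF Ux))).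
  apply: (@le_trans _ _ (k j * `|z - x|)); last first.
    by rewrite ler_wpM2r // (bigD1 j) //= lerDl sumr_ge0 // => i _; exact: (kP i).1.
  apply: (@mvt_segment _ _ _ _ ('D_(delta_mx 0 j) F) x z) => s s01.
  have zs : `|x + s *: (z - x) - x0| < r by exact: ball_segment.
  have [_ /(_ j)[Us ds]] := H _ zs.
  by split; [exact: smooth_differentiable (smooth_derive _ sF) Us|exact: ds].
(* Once the differential at [x] is subtracted, the derivative along the segment is at most
   [K2 * |y - x| ^+ 2]. *)
pose G z := F z - 'd F x z.
have dL : differentiable ('d F x) x.
  by apply: linear_differentiable; apply: diff_continuous; exact: smooth_differentiable sF Ux.
have -> : F y - F x - 'd F x (y - x) = G y - G x.
  by rewrite /G linearB !opprB addrACA [RHS]addrACA; congr (_ + _); exact: addrC.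
rewrite expr2 mulrA; apply: (@mvt_segment _ _ _ _ G x y) => s s01.
have [[Us _] _] := H _ (seg s s01).
have dF := smooth_differentiable sF Us.
have dL' : differentiable ('d F x) (x + s *: (y - x)).
  by apply: linear_differentiable; apply: diff_continuous; exact: smooth_differentiable sF Ux.
split; first exact: differentiableB dF dL'.
have -> : 'd G (x + s *: (y - x)) (y - x) =
    'd F (x + s *: (y - x)) (y - x) - 'd F x (y - x).
  have E1 := congr1 (@^~ (y - x)) (diffB dF dL').
  have E2 := congr1 (@^~ (y - x)) (diff_lin (x + s *: (y - x))
    (diff_continuous (smooth_differentiable sF Ux))).
  exact: (etrans E1 (congr1 (fun w => 'd F (x + s *: (y - x)) (y - x) - w) E2)).
rewrite (le_trans (dlip _ (seg s s01) _)) // ler_wpM2r //.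
have -> : x + s *: (y - x) - x = s *: (y - x) by rewrite addrAC subrr add0r.
case/andP: s01 => s0 s1; rewrite normrZ ger0_norm //.
have := normr_ge0 (y - x); move: `|y - x| => d d0.
rewrite ler_pM //; [exact: mulr_ge0|by rewrite lerDr|by rewrite ler_piMl].
Qed.

End LocalLipschitz.

Lemma near_dist_lt (R : realType) (E : normedModType R) (x x0 : E) (r : R) :
  `|x - x0| < r -> \forall y \near x, `|y - x0| < r.
Proof.
move=> xr; apply/nbhs_ballP; exists (r - `|x - x0|) => /= [|y].
  by rewrite subr_gt0.
rewrite -ball_normE /ball_ /= distrC ltrBrDr; apply: le_lt_trans.
by rewrite (le_trans _ (ler_normD _ _)) // addrA subrK.
Qed.

(** * Local flows of vector fields on open sets *)

Section Picard.
Context {R : realType} {p q : nat}.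
Implicit Types (u w : R -> 'M[R]_(p, q)) (a b t : R).

Lemma real_primitive (h : R -> R) b : continuous h ->
  exists H : R -> R, forall t, b < t -> is_derive t 1 H (h t).
Proof.
move=> ch; exists (fun x => \int[lebesgue_measure]_(t in `[b, x]) h t)%R => t bt.
have hi : lebesgue_measure.-integrable `[b, t + 1] (EFin \o h).
  apply: continuous_compact_integrable; first exact: segment_compact.
  by apply: continuous_subspaceT => x; exact: ch.
have [dH HE] := @continuous_FTC1_closed R h b t (t + 1)
  (ltr_pwDr ltr01 (lexx t)) hi bt (ch t).
by split; [exact: dH|rewrite -derive1E].
Qed.

Lemma mx_primitive (h : R -> 'M[R]_(p, q)) b : continuous h ->
  exists H : R -> 'M[R]_(p, q), forall t, b < t -> has_deriv_within setT H t (h t).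
Proof.
move=> ch.
have /choice[H HP] (ij : 'I_p * 'I_q) : exists H : R -> R, forall t, b < t ->
    is_derive t 1 H (h t ij.1 ij.2).
  apply: (real_primitive (h := fun t => h t ij.1 ij.2)) => t.
  by apply: cvg_mx_entry; exact: ch.
exists (fun t => \matrix_(i, j) H (i, j) t) => t bt; apply: hdw_mx => i j.
by under eq_fun do rewrite mxE; apply/hdwTE; exact: HP (i, j) t bt.
Qed.

Context (f : R -> 'M[R]_(p, q) -> 'M[R]_(p, q)) (L a : R) (y0 : 'M[R]_(p, q)).
Context (L0 : 0 <= L) (a0 : 0 < a) (La : L * a <= 2^-1).
Context (f_lip : forall t x z, `|f t x - f t z| <= L * `|x - z|).
Context (f_cont : forall u, continuous u -> continuous (fun t => f t (u t))).

(** Time is clamped to [[-a, a]]: the iterates are then defined and continuous on the whole line,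
    with bounds uniform in [t]. *)
Let kap (t : R) : R := Num.max (- a) (Num.min a t).

Let kap_bound t : - a <= kap t <= a.
Proof.
rewrite /kap; apply/andP; split; first by rewrite le_max lexx.
by rewrite ge_max ge_min lexx andbT ge0_cp // ltW.
Qed.

Let kap_id t : `|t| < a -> kap t = t.
Proof.
by rewrite ltr_norml => /andP[h1 h2]; rewrite /kap (min_r (ltW h2)) (max_r (ltW h1)).
Qed.

Let kap_continuous : continuous kap.
Proof.
move=> t; apply: (@continuous_max R R (cst (- a)) (fun t => Num.min a t)).
  exact: cvg_cst.
by apply: (@continuous_min R R (cst a) id); [exact: cvg_cst|exact: cvg_id].
Qed.

(** The half line contains [[-a, a]] in its interior, so that derivatives are two-sided up to the
    end points. *)
Let prim_spec h (H : R -> 'M[R]_(p, q)) := H 0 = y0 /\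
  forall t, - a - 1 < t -> has_deriv_within setT H t (h t).

Let prim h := xget (fun=> 0) (prim_spec h).

Let primP h : continuous h -> prim_spec h (prim h).
Proof.
move=> ch; have [H HP] := mx_primitive (- a - 1) ch.
apply: (@xgetPex _ _ (prim_spec h)); exists (fun t => H t + (y0 - H 0)).
split; first by rewrite addrC subrK.
move=> t /HP H1; rewrite -[h t]addr0; apply: hdwD => //; exact: hdw_cst.
Qed.

Let step u t := prim (fun s => f s (u s)) (kap t).

Let kap_gt t : - a - 1 < kap t.
Proof. by have /andP[h _] := kap_bound t; lra. Qed.

Let step_continuous u : continuous u -> continuous (step u).
Proof.
move=> /f_cont/primP[_ P] t; apply: continuous_comp; first exact: kap_continuous.
exact: hdw_continuous (P _ (kap_gt t)).
Qed.

Let step_bound (H G h g : R -> 'M[R]_(p, q)) D :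
  0 <= D -> prim_spec h H -> prim_spec g G ->
  (forall t, - a <= t <= a -> `|h t - g t| <= D) ->
  forall t, `|H (kap t) - G (kap t)| <= D * a.
Proof.
move=> D0 [H0 HP] [G0 GP] hg t.
have /andP[k1 k2] := kap_bound t; set k := kap t in k1 k2 *.
pose d s := H s - G s.
have dd s : - a <= s -> has_deriv_within setT d s (h s - g s).
  by move=> ?; apply: hdwD; [apply: HP; lra|apply: hdwN; apply: GP; lra].
have P x z : - a <= x -> z <= a -> x <= z -> `|d z - d x| <= D * (z - x).
  move=> ax za xz; apply: (mvt_mx xz (df := fun s => h s - g s)).
  - by move=> s /andP[? ?]; apply: dd; lra.
  - by move=> s /andP[? ?]; apply: hg; lra.
  - apply: (hdw_within_continuous (df := fun s => h s - g s)) => s /=.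
    by rewrite in_itv /= => /andP[? ?]; apply: hdwT; apply: dd; lra.
have d0 : d 0 = 0 by rewrite /d H0 G0 subrr.
have [k0|/ltW k0] := leP 0 k.
  have := P 0 k _ _ k0; rewrite d0 !subr0 => h1; apply: (le_trans (h1 _ _)) => //; first lra.
  by rewrite ler_wpM2l.
have := P k 0 _ _ k0; rewrite d0 sub0r normrN sub0r => h1.
apply: (le_trans (h1 _ _)) => //; first lra.
by rewrite ler_wpM2l //; lra.
Qed.

(** The Picard operator contracts by [1 / 2] because [L * a <= 1 / 2]. *)
Let step_lip u w D : continuous u -> continuous w -> 0 <= D ->
  (forall t, `|u t - w t| <= D) -> forall t, `|step u t - step w t| <= D / 2.
Proof.
move=> cu cw D0 H t.
have LD : 0 <= L * D by rewrite mulr_ge0.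
have := step_bound LD (primP (f_cont cu)) (primP (f_cont cw)) _ t.
move=> /(_ _)/le_trans; apply => [s _|].
  by rewrite (le_trans (f_lip _ _ _)) // ler_wpM2l.
by rewrite mulrAC mulrC ler_wpM2l.
Qed.

Let it k := iter k step (cst y0).

Let it_continuous k : continuous (it k).
Proof. by elim: k => [|k IH] t; [exact: cvg_cst|exact: step_continuous]. Qed.

Let it_bound : exists2 B, 0 <= B & forall k t, `|it k.+1 t - it k t| <= B / 2 ^+ k.
Proof.
have c1 : continuous (fun s => f s y0) by apply: (f_cont (u := cst y0)) => t; exact: cvg_cst.
have [s _ smax] : exists2 c, c \in `[(- a), a] & forall t, t \in `[(- a), a] ->
    `|f t y0| <= `|f c y0|.
  apply: (@EVT_max _ (fun s => `|f s y0|)); first by rewrite ge0_cp // ltW.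
  by apply: continuous_subspaceT => t; apply: cvg_norm; exact: c1.
exists (`|f s y0| * a); first by rewrite mulr_ge0 // ltW.
elim=> [|k IH] t.
  have cst0 : prim_spec (cst 0) (cst y0) by split=> // *; exact: hdw_cst.
  rewrite expr0 divr1.
  apply: (step_bound (normr_ge0 _) (primP c1) cst0) => r rs.
  by rewrite subr0 smax // in_itv.
rewrite exprSr invfM mulrA.
apply: (step_lip (@it_continuous k.+1) (@it_continuous k) _ IH).
by rewrite divr_ge0 ?exprn_ge0 // mulr_ge0 // ltW.
Qed.

(** The iterates converge uniformly at a geometric rate and their limit is a fixed point of [step],
    which solves the equation where the clamping of time is the identity. The right-hand side is
    globally Lipschitz and matrix-valued, in order to serve both a clamped vector field and its
    variational equation. *)
Lemma picard_short : exists u, [/\ continuous u, u 0 = y0 &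
  forall t, `|t| < a -> has_deriv_within setT u t (f t (u t))].
Proof.
have [B B0 itB] := it_bound.
(* The exact value of the geometric sum, rather than its bound [2 * B / 2 ^+ k], lets the induction
   on [l] close. *)
have itB2 k l t : `|it (k + l) t - it k t| <= 2 * B / 2 ^+ k - 2 * B / 2 ^+ (k + l).
  elim: l => [|l IH]; first by rewrite addn0 !subrr normr0.
  rewrite addnS -(subrKA (it (k + l) t)) (le_trans (ler_normD _ _)) //.
  apply: le_trans (lerD (itB _ _) IH) _.
  rewrite exprS invfM.
  have : 0 <= B * (2 ^+ (k + l))^-1 by rewrite mulr_ge0 // invr_ge0 exprn_ge0.
  lra.
have itB3 k l t : (k <= l)%N -> `|it l t - it k t| <= 2 * B / 2 ^+ k.
  move=> kl; rewrite -(subnKC kl) (le_trans (itB2 _ _ _)) // lerBlDr lerDl.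
  by rewrite divr_ge0 // ?mulr_ge0 // exprn_ge0.
have small e : 0 < e -> \forall k \near \oo, 2 * B / 2 ^+ k <= e.
  move=> e0; have d0 : 0 < e / (2 * B + 1) by rewrite divr_gt0 // ltr_wpDl // mulr_ge0.
  apply: filterS (near_infty_natSinv_expn_lt (PosNum d0)) => k /= H.
  have : 0 <= (2 ^+ k)^-1 :> R by rewrite invr_ge0 exprn_ge0.
  move: H; rewrite div1r ltr_pdivlMr ?ltr_wpDl // ?mulr_ge0 //; nra.
have cv t : cvg (it k t @[k --> \oo]).
  apply: cauchy_cvg; apply: cauchy_exP => e e0.
  have [N _ NP] := small (e / 2) (divr_gt0 e0 (ltr0Sn _ _)).
  exists (it N t); exists N => // l /= Nl.
  rewrite -ball_normE /ball_ /= distrC (le_lt_trans (itB3 _ _ t Nl)) //.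
  by rewrite (le_lt_trans (NP N (leqnn N))) // ltr_pdivrMr // ltr_pMr // ltr1n.
pose g t := lim (it k t @[k --> \oo]).
have gB k t : `|g t - it k t| <= 2 * B / 2 ^+ k.
  apply/ler_addgt0Pl => e e0.
  have /cvgrPdist_le/(_ e e0)[N _ NP] := cv t.
  rewrite -(subrKA (it (maxn N k) t)) (le_trans (ler_normD _ _)) // lerD //.
    by apply: NP; exact: leq_maxl.
  by apply: itB3; exact: leq_maxr.
have gc : continuous g.
  move=> t; apply/cvgrPdist_le => e e0.
  have [N _ NP] := small (e / 3) (divr_gt0 e0 (ltr0Sn _ _)).
  have {}NP := NP N (leqnn N).
  have /cvgrPdist_le/(_ (e / 3) (divr_gt0 e0 (ltr0Sn _ _))) := @it_continuous N t.
  apply: filterS => s H.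
  rewrite -(subrKA (it N t)) -(subrKA (it N s) (it N t)).
  rewrite (le_trans (ler_normD _ _)) // (le_trans (lerD (gB N t) (ler_normD _ _))) //.
  have := gB N s; rewrite distrC => H2; lra.
have gE t : g t = step g t.
  apply/eqP; rewrite -subr_eq0 -normr_le0; apply/ler_addgt0Pl => e e0; rewrite addr0.
  have [N _ NP] := small (e / 2) (divr_gt0 e0 (ltr0Sn _ _)).
  have {}NP := NP N (leqnn N).
  rewrite -(subrKA (it N.+1 t)) (le_trans (ler_normD _ _)) // (splitr e) lerD //.
    apply: le_trans (gB _ _) _; apply: le_trans NP; rewrite ler_wpM2l ?mulr_ge0 //.
    by rewrite lef_pV2 ?posrE ?exprn_gt0 // ler_eXn2l ?ltr1n.
  have B20 : 0 <= 2 * B / 2 ^+ N by rewrite divr_ge0 ?mulr_ge0 // exprn_ge0.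
  have := step_lip (@it_continuous N) gc B20 _ t.
  move=> /(_ _)/le_trans; apply => [s|]; first by rewrite distrC.
  lra.
have gp : prim_spec (fun s => f s (g s)) (prim (fun s => f s (g s))).
  by apply: primP; exact: f_cont.
exists g; split=> // [|t ta].
  by rewrite gE /step kap_id ?normr0 //; exact: gp.1.
have /andP[t1 t2] : - a < t < a by rewrite -ltr_norml.
apply: (hdw_near (f := prim (fun s => f s (g s)))).
- have : \forall s \near t, `|s| < a.
    have := @near_dist_lt R R t 0 a; rewrite subr0 => /(_ ta).
    by apply: filterS => s; rewrite subr0.
  by apply: filterS => s sa _; rewrite gE /step kap_id.
- by rewrite [RHS]gE /step kap_id.
- by apply: gp.2; lra.
Qed.

End Picard.

Lemma unitmx_of_injective (K : fieldType) (n : nat) (A : 'M[K]_n) :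
  (forall v : 'rV[K]_n, v *m A = 0 -> v = 0) -> A \in unitmx.
Proof.
move=> H; rewrite -row_free_unit -kermx_eq0; apply/rowV0P => v /sub_kermxP.
exact: H.
Qed.

Lemma min_lip (R : realType) (u a b : R) : `|Num.min u a - Num.min u b| <= `|a - b|.
Proof.
wlog ab : a b / a <= b.
  by move=> H; have [/H//|/ltW/H] := leP a b; rewrite distrC (distrC b).
rewrite distrC (distrC a) (ger0_norm (_ : 0 <= b - a)) ?subr_ge0 // ler_norml.
by case: (leP u a) => ?; case: (leP u b) => ?; apply/andP; split; lra.
Qed.

Lemma max_lip (R : realType) (u a b : R) : `|Num.max u a - Num.max u b| <= `|a - b|.
Proof.
wlog ab : a b / a <= b.
  by move=> H; have [/H//|/ltW/H] := leP a b; rewrite distrC (distrC b).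
rewrite distrC (distrC a) (ger0_norm (_ : 0 <= b - a)) ?subr_ge0 // ler_norml.
by case: (leP u a) => ?; case: (leP u b) => ?; apply/andP; split; lra.
Qed.

Section Clamp.
Context {R : realType} {p q : nat}.
Context (x0 : 'M[R]_(p, q)) (r : R).
Context (r0 : 0 < r).

(** A retraction onto the closed ball of radius [r] around [x0] for the maximum norm. Being
    1-Lipschitz, it turns a field that is Lipschitz on the ball into a globally Lipschitz one. *)
Definition clamp_mx (x : 'M[R]_(p, q)) : 'M[R]_(p, q) :=
  \matrix_(i, j) Num.max (x0 i j - r) (Num.min (x0 i j + r) (x i j)).

Lemma clamp_mx_dist x : `|clamp_mx x - x0| <= r.
Proof.
apply: mx_norm_leP => [|i j]; first exact: ltW.
rewrite !mxE ler_norml; apply/andP; split.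
  by rewrite lerBrDr addrC le_max lexx.
rewrite lerBlDr ge_max ge_min (addrC r) lexx andbT lerD2l.
by rewrite ge0_cp // ltW.
Qed.

Lemma clamp_mx_id x : `|x - x0| <= r -> clamp_mx x = x.
Proof.
move=> H; apply/matrixP => i j; rewrite mxE.
have := le_trans (mx_entry_le (x - x0) i j) H.
rewrite !mxE ler_norml => /andP[h1 h2].
by rewrite min_r ?max_r //; lra.
Qed.

Lemma clamp_mx_lip x y : `|clamp_mx x - clamp_mx y| <= `|x - y|.
Proof.
apply: mx_norm_leP => // i j; apply: le_trans (mx_entry_le (x - y) i j).
rewrite !mxE; apply: le_trans (min_lip (x0 i j + r) _ _); exact: max_lip.
Qed.

End Clamp.

Section SymmetricIntervals.
Context {R : realType} {p q : nat}.
Context (f df : R -> 'M[R]_(p, q)) (a : R).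
Context (fd : forall t, `|t| < a -> has_deriv_within setT f t (df t)).

Lemma mvt_sym K s t : (forall t, `|t| < a -> `|df t| <= K) ->
  `|s| < a -> `|t| < a -> `|f t - f s| <= K * `|t - s|.
Proof.
move=> dK; wlog st : s t / s <= t.
  move=> H sa ta; have [st|/ltW ts] := leP s t; first exact: H.
  by rewrite distrC (distrC t); exact: H.
rewrite !ltr_norml (ger0_norm (_ : 0 <= t - s)) ?subr_ge0 // => /andP[s1 s2] /andP[t1 t2].
have I x : s <= x <= t -> `|x| < a by move=> /andP[? ?]; rewrite ltr_norml; lra.
apply: (mvt_mx st (df := df)).
- by move=> x /andP[/ltW ? /ltW ?]; apply/fd/I/andP.
- by move=> x /andP[/ltW ? /ltW ?]; apply/dK/I/andP.
- by apply: (hdw_within_continuous (df := df)) => x /=; rewrite in_itv /= => /I/fd/hdwT.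
Qed.

(** With [b] the larger of |s| and |t|, the interval [[-b, b]] has length at most [2 * a]; hence
    [4^-1] where [gronwall_short] has [2^-1]. *)
Lemma gronwall_sym L e s t : 0 <= L -> 0 <= e -> L * a <= 4^-1 ->
  (forall t, `|t| < a -> `|df t| <= L * `|f t| + e) ->
  `|s| < a -> `|t| < a -> `|f t| <= 2 * `|f s| + 4 * a * e.
Proof.
move=> L0 e0 La dL sa ta.
pose b := Num.max `|s| `|t|.
have ba : b < a by rewrite gt_max sa.
have sb : `|s| <= b by rewrite le_max lexx.
have tb : `|t| <= b by rewrite le_max lexx orbT.
have b0 : 0 <= b := le_trans (normr_ge0 s) sb.
have I x : - b <= x <= b -> `|x| < a by move=> /andP[? ?]; rewrite ltr_norml; lra.
apply: (@le_trans _ _ (2 * `|f s| + 2 * (b - - b) * e)); last first.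
  by rewrite lerD2l ler_wpM2r //; lra.
apply: (gronwall_short L0 e0 (df := df)).
- by rewrite opprK; nra.
- by move=> x /andP[/ltW ? /ltW ?]; apply/fd/I/andP.
- by move=> x /andP[/ltW ? /ltW ?]; apply/dL/I/andP.
- by apply: (hdw_within_continuous (df := df)) => x /=; rewrite in_itv /= => /I/fd/hdwT.
- by rewrite -ler_norml.
- by rewrite -ler_norml.
Qed.

End SymmetricIntervals.

Lemma mul_jacobian (R : realType) (k l : nat) (f : 'rV[R]_k -> 'rV[R]_l) x v :
  v *m jacobian f x = 'd f x v.
Proof. by rewrite /jacobian mul_rV_lin1. Qed.

(** * The local flow and its differential in the initial point *)

Section LocalFlow.
Context {R : realType} {n : nat}.
Context (F : 'rV[R]_n -> 'rV[R]_n) (U : set 'rV[R]_n).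
Context (oU : open U) (sF : smooth_on U F).

Lemma jacobian_continuous (u : R -> 'rV[R]_n) : continuous u -> (forall t, U (u t)) ->
  continuous (fun t => jacobian F (u t)).
Proof.
move=> cu Uu t; apply: cvg_mx => i j.
have E s : jacobian F (u s) i j = 'D_(delta_mx 0 i) F (u s) 0 j.
  have dF := smooth_differentiable sF (Uu s).
  have := congr1 (fun w : 'rV[R]_n => w 0 j)
    (etrans (mul_jacobian F (u s) (delta_mx 0 i)) (esym (deriveE (delta_mx 0 i) dF))).
  by rewrite -rowE mxE.
under eq_fun do rewrite E; rewrite E.
have c := differentiable_continuous
  (smooth_differentiable (smooth_derive (delta_mx 0 i) sF) (Uu t)).
exact: (@cvg_mx_entry R R (nbhs t) _ 1 n _ _ 0 j (cvg_comp _ _ (cu t) c)).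
Qed.

Lemma mulmx_jacobian_norm (p : nat) (X : 'M[R]_(p, n)) x K : 0 <= K ->
  (forall v, `|'d F x v| <= K * `|v|) -> `|X *m jacobian F x| <= K * `|X|.
Proof.
move=> K0 H; apply: mx_norm_leP => [|i j]; first by rewrite mulr_ge0.
have -> : (X *m jacobian F x) i j = (row i X *m jacobian F x) 0 j.
  by rewrite -row_mul [RHS]mxE.
rewrite (le_trans (mx_entry_le _ _ _)) // mul_jacobian (le_trans (H _)) // ler_wpM2l //.
apply: mx_norm_leP => // k l; rewrite mxE; exact: mx_entry_le.
Qed.

(** [Psi] solves the variational equation along each trajectory. It is the differential of the flow
    because [phi (h + y) - phi y - h *m Psi] satisfies the same linear equation up to a term
    quadratic in [h], so that Gronwall bounds it by a multiple of [|h| ^+ 2]. Vectors are rows: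
    differentials act by multiplication on the right. *)
Lemma local_flow y0 : U y0 -> exists a r (phi : R -> 'rV[R]_n -> 'rV[R]_n)
    (Psi : R -> 'rV[R]_n -> 'M[R]_n), [/\ 0 < a, 0 < r & forall y, `|y - y0| < r ->
  [/\ phi 0 y = y, Psi 0 y = 1%:M & forall s, `|s| < a ->
    [/\ U (phi s y), has_deriv_within setT (phi^~ y) s (F (phi s y)),
        has_deriv_within setT (Psi^~ y) s (Psi s y *m jacobian F (phi s y)),
        Psi s y \in unitmx &
        differentiable (phi s) y /\ forall v, 'd (phi s) y v = v *m Psi s y]]].
Proof.
move=> Uy0.
have [r0 [K [r00 K0 H0]]] := smooth_local_lipschitz oU sF Uy0.
pose rho := r0 / 2; have rho0 : 0 < rho by rewrite divr_gt0.
have rhor x : `|x - y0| <= rho -> `|x - y0| < r0.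
  by move=> /le_lt_trans; apply; rewrite ltr_pdivrMr // ltr_pMr // ltr1n.
pose F' x := F (clamp_mx y0 rho x).
have cl x : `|clamp_mx y0 rho x - y0| < r0 by apply: rhor; exact: clamp_mx_dist.
have F'lip x z : `|F' x - F' z| <= K * `|x - z|.
  have [_ _ /(_ _ (cl x))[h _]] := H0 _ (cl z).
  by rewrite (le_trans h) // ler_wpM2l // clamp_mx_lip.
pose Mb := `|F y0| + K * rho.
have Mb0 : 0 <= Mb by rewrite addr_ge0 // mulr_ge0 // ltW.
have F'b x : `|F' x| <= Mb.
  have y0r : `|y0 - y0| < r0 by rewrite subrr normr0.
  have [_ _ /(_ _ (cl x))[h _]] := H0 _ y0r.
  rewrite -(subrK (F y0) (F' x)) (le_trans (ler_normD _ _)) // addrC lerD2l.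
  by rewrite (le_trans h) // ler_wpM2l // clamp_mx_dist.
(* The first bound gives [K * a <= 1 / 4], as Gronwall requires; the second gives
   [Mb * a <= rho / 2], so that trajectories from the ball of radius [rho / 2] stay where the
   clamping is the identity. *)
pose a := Num.min (4 * (K + 1))^-1 (rho / (2 * (Mb + 1))).
have a0 : 0 < a.
  by rewrite lt_min invr_gt0 divr_gt0 // ?mulr_gt0 // ltr_wpDl.
have Ka : K * a <= 4^-1.
  have : a <= (4 * (K + 1))^-1 by rewrite ge_min lexx.
  rewrite -[X in _ <= X -> _]mul1r ler_pdivlMr ?mulr_gt0 ?ltr_wpDl //; nra.
have Ma : Mb * a <= rho / 2.
  have : a <= rho / (2 * (Mb + 1)) by rewrite ge_min lexx orbT.
  rewrite ler_pdivlMr ?mulr_gt0 ?ltr_wpDl //; nra.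
have Ka2 : K * a <= 2^-1 by lra.
have F'c u : continuous u -> continuous (fun t : R => F' (u t : 'rV[R]_n)).
  move=> cu t; apply/cvgrPdist_le => e e0.
  have e1 : 0 < e / (K + 1) by rewrite divr_gt0 // ltr_wpDl.
  have /cvgrPdist_le/(_ _ e1) := cu t; apply: filterS => s h.
  rewrite (le_trans (F'lip _ _)) //.
  move: h; rewrite ler_pdivlMr ?ltr_wpDl //; have := normr_ge0 (u t - u s); nra.
have /choice[ph phP] y := picard_short y K0 a0 Ka2 (fun=> F'lip) F'c.
have phd y t : `|t| < a -> has_deriv_within setT (ph y) t (F' (ph y t)).
  by have [_ _] := phP y; exact.
have near_y y t : `|y - y0| < rho / 2 -> `|t| < a -> `|ph y t - y0| < rho.
  move=> yr ta.
  have z0 : `|0 : R| < a by rewrite normr0.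
  have := mvt_sym (phd y) (fun t _ => F'b (ph y t)) z0 ta.
  have [_ -> _] := phP y; rewrite subr0 => h.
  rewrite -(subrK y (ph y t)) -addrA (le_lt_trans (ler_normD _ _)) //.
  have : Mb * `|t| <= Mb * a by rewrite ler_wpM2l // ltW.
  lra.
have F'E x : `|x - y0| < rho -> F' x = F x.
  by move=> /ltW h; rewrite /F' clamp_mx_id.
pose J y t := jacobian F (clamp_mx y0 rho (ph y t)).
have Jn (p : nat) y t (X : 'M[R]_(p, n)) : `|X *m J y t| <= K * `|X|.
  by apply: mulmx_jacobian_norm => //; have [_ h _] := H0 _ (cl (ph y t)).
have Jc y : continuous (J y).
  apply: jacobian_continuous => [t|t]; last by have [] := H0 _ (cl (ph y t)).
  have [cph _ _] := phP y.
  apply/cvgrPdist_le => e e0.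
  have /cvgrPdist_le/(_ e e0) := cph t; apply: filterS => s.
  by apply: le_trans; exact: clamp_mx_lip.
have Jlip (p : nat) y t (X Y : 'M[R]_(p, n)) : `|X *m J y t - Y *m J y t| <= K * `|X - Y|.
  by rewrite -mulmxBl.
have Jcont (p : nat) y (u : R -> 'M[R]_(p, n)) :
    continuous u -> continuous (fun t => u t *m J y t).
  by move=> cu t; apply: cvg_mulmx; [exact: cu|exact: Jc].
have /choice[ps psP] y := picard_short 1%:M K0 a0 Ka2 (Jlip n y) (Jcont n y).
have psd y t : `|t| < a -> has_deriv_within setT (ps y) t (ps y t *m J y t).
  by have [_ _] := psP y; exact.
exists a, (rho / 2), (fun s y => ph y s), (fun s y => ps y s).
split=> //; first by rewrite divr_gt0.
move=> y yr; split; [by have [] := phP y|by have [] := psP y|].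
move=> s sa.
have nr t : `|t| < a -> `|ph y t - y0| < rho by exact: near_y.
have JE t : `|t| < a -> J y t = jacobian F (ph y t).
  by move=> ta; rewrite /J clamp_mx_id // ltW // nr.
have a0' : `|0 : R| < a by rewrite normr0.
split.
- by have [] := H0 _ (rhor _ (ltW (nr s sa))).
- by rewrite -F'E ?nr //; exact: phd.
- by rewrite -JE //; exact: psd.
(* If [v *m Psi s = 0], then [v *m Psi] solves a linear equation and vanishes at [s], hence also at
   0, where it is [v]. *)
- apply: unitmx_of_injective => v v0.
  have vd t : `|t| < a ->
      has_deriv_within setT (fun t => v *m ps y t) t (v *m ps y t *m J y t).
    move=> ta; have := hdw_mulmx (hdw_cst setT v t) (psd y t ta).
    by rewrite mul0mx add0r mulmxA.
  have vK t : `|t| < a -> `|v *m ps y t *m J y t| <= K * `|v *m ps y t| + 0.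
    by rewrite addr0.
  have := gronwall_sym vd K0 (lexx 0) Ka vK sa a0'.
  rewrite v0 normr0 !mulr0 addr0; have [_ -> _] := psP y; rewrite mulmx1.
  by rewrite normr_le0 => /eqP.
have phlip z t : `|z - y0| < rho / 2 -> `|t| < a -> `|ph z t - ph y t| <= 2 * `|z - y|.
  move=> zr ta.
  have dd t' : `|t'| < a -> has_deriv_within setT (fun t => ph z t - ph y t) t'
      (F' (ph z t') - F' (ph y t')).
    by move=> ta'; exact: hdwD (phd z t' ta') (hdwN (phd y t' ta')).
  have dK t' : `|t'| < a -> `|F' (ph z t') - F' (ph y t')| <=
      K * `|ph z t' - ph y t'| + 0 by rewrite addr0.
  have := gronwall_sym dd K0 (lexx 0) Ka dK a0' ta.
  by rewrite mulr0 addr0; have [_ -> _] := phP y; have [_ -> _] := phP z.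
(* [16 * a * K] is [4 * a] from Gronwall times [4 * K], where 4 is the square of the Lipschitz
   constant 2 of the flow. *)
have rem h : `|h + y - y0| < rho / 2 ->
    `|ph (h + y) s - ph y s - h *m ps y s| <= 16 * a * K * `|h| ^+ 2.
  move=> hr; pose f t := ph (h + y) t - ph y t - h *m ps y t.
  pose df t := F' (ph (h + y) t) - F' (ph y t) - h *m ps y t *m J y t.
  have fd t : `|t| < a -> has_deriv_within setT f t (df t).
    move=> ta; apply: hdwD; first exact: hdwD (phd _ t ta) (hdwN (phd y t ta)).
    apply: hdwN; have := hdw_mulmx (hdw_cst setT h t) (psd y t ta).
    by rewrite mul0mx add0r mulmxA.
  have dfK t : `|t| < a -> `|df t| <= K * `|f t| + 4 * K * `|h| ^+ 2.
    move=> ta.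
    have -> : df t = f t *m J y t + (F (ph (h + y) t) - F (ph y t) -
        'd F (ph y t) (ph (h + y) t - ph y t)).
      rewrite /df !F'E; [|exact: near_y|exact: near_y].
      by rewrite -(mul_jacobian F) -(JE t ta) /f mulmxBl [RHS]addrC subrKA.
    rewrite (le_trans (ler_normD _ _)) // lerD //.
    have [_ _ /(_ (ph (h + y) t))[]] := H0 _ (rhor _ (ltW (nr t ta))).
      by apply: rhor; apply: ltW; exact: near_y.
    move=> _ /le_trans; apply.
    have := phlip _ t hr ta; rewrite addrK => h2.
    move: h2 (normr_ge0 (ph (h + y) t - ph y t)).
    move: `|ph (h + y) t - ph y t| `|h| => b c bc b0.
    have b2 : b ^+ 2 <= 4 * c ^+ 2 by rewrite !expr2; nra.
    by rewrite (mulrC 4) -mulrA ler_wpM2l.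
  have e0 : 0 <= 4 * K * `|h| ^+ 2 by rewrite !mulr_ge0 // exprn_ge0.
  have := gronwall_sym fd K0 e0 Ka dfK a0' sa.
  rewrite {2}/f; have [_ -> _] := phP y; have [_ -> _] := phP (h + y).
  have [_ -> _] := psP y; rewrite mulmx1 addrK subrr normr0 mulr0 add0r.
  by move=> /le_trans; apply; rewrite le_eqVlt; apply/orP; left; apply/eqP; ring.
pose L : {linear 'rV[R]_n -> 'rV[R]_n} := mulmxr (ps y s).
have cL : continuous L.
  move=> x; apply: (@cvg_mulmx _ _ (nbhs x) _ 1 n n id (cst (ps y s)) x (ps y s)).
    exact: cvg_id.
  exact: cvg_cst.
suff [dp dpE] : differentiable (ph^~ s) y /\ 'd (ph^~ s) y = L :> (_ -> _).
  by split=> // v; rewrite dpE.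
apply: (differentiable_of_remainder cL) => e e0.
have C0 : 0 <= 16 * a * K by rewrite !mulr_ge0 // ltW.
have n1 : \forall h \near (0 : 'rV[R]_n), `|h + y - y0| < rho / 2.
  by have := near_dist_lt yr; rewrite (near_shift 0 y) subr0.
have n2 : \forall h \near (0 : 'rV[R]_n), `|h - 0| < e / (16 * a * K + 1).
  by apply: near_dist_lt; rewrite subrr normr0 divr_gt0 // ltr_wpDl.
apply: filterS2 n1 n2 => h h1; rewrite subr0 ltr_pdivlMr ?ltr_wpDl // => h2.
apply: le_trans (rem h h1) _.
rewrite expr2 mulrA ler_wpM2r //.
have := normr_ge0 h; nra.
Qed.

End LocalFlow.

(** * Charts and Lie brackets *)

Lemma smooth_on_eq (R : realType) (E F : normedModType R) (U : set E) (f g : E -> F) :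
  open U -> (forall x, U x -> f x = g x) -> smooth_on U f -> smooth_on U g.
Proof.
by move=> oU fg /smooth_onP H; apply/smooth_onP => k; exact: Ck_eq oU fg (H k).
Qed.

Lemma jacobian_unique (R : realType) (k l : nat) (f : 'rV[R]_k -> 'rV[R]_l) x A :
  (forall v, 'd f x v = v *m A) -> jacobian f x = A.
Proof. by move=> H; apply/row_matrixP => i; rewrite !rowE mul_jacobian. Qed.

(** The shape of a bracket under a change of charts: [C] and [D] are the terms containing second
    derivatives of the transition map. *)
Lemma sub_mulmx_eq (R : pzRingType) (p q r : nat) (A B C D : 'M[R]_(p, r))
    (a b : 'M[R]_(p, q)) (T : 'M[R]_(q, r)) :
  A = a *m T + C -> B = b *m T + D -> C = D -> A - B = (a - b) *m T.
Proof. by move=> -> -> ->; rewrite mulmxBl opprD addrACA subrr addr0. Qed.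

Section Charts.
Context {R : realType} {n : nat} {M : manifold R n}.
Implicit Types (e : chart R n M) (p : M) (U : set M) (X Y : M -> 'rV[R]_n).

Lemma cimage_ccoord e U p : cdom e p -> U p -> cimage e U (ccoord e p).
Proof. by move=> ep Up; exists p. Qed.

Lemma cimage_param e U y : atlas e -> cimage e U y ->
  [/\ cdom e (param e y), U (param e y) & ccoord e (param e y) = y].
Proof.
by move=> /atlas_chart[_ _ pK _ _] [p [ep Up] <-]; rewrite pK.
Qed.

Lemma paramK e p : atlas e -> cdom e p -> param e (ccoord e p) = p.
Proof. by move=> /atlas_chart[_ _ pK _ _]; exact: pK. Qed.

Lemma cdom_near e p : atlas e -> cdom e p -> \forall q \near p, cdom e q.
Proof. by move=> /atlas_chart[oe _ _ _ _] ep; exact: open_nbhs_nbhs. Qed.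

Lemma ccoord_continuous e p : atlas e -> cdom e p -> {for p, continuous (ccoord e)}.
Proof. by move=> /atlas_chart[_ _ _ c _]; exact: c. Qed.

Lemma param_continuous e y : atlas e -> cimage e setT y -> {for y, continuous (param e)}.
Proof. by move=> /atlas_chart[_ _ _ _ c]; exact: c. Qed.

Lemma cimage_near e p : atlas e -> cdom e p -> \forall y \near ccoord e p, cimage e setT y.
Proof.
move=> /atlas_chart[_ oi _ _ _] ep; apply: open_nbhs_nbhs; split=> //.
exact: cimage_ccoord.
Qed.

Lemma param_near e p (P : set M) : atlas e -> cdom e p -> nbhs p P ->
  \forall y \near ccoord e p, P (param e y).
Proof.
move=> ae ep Pp; have c := param_continuous ae (cimage_ccoord ep (I : setT p)).
by apply: c; rewrite paramK.
Qed.

Lemma open_cimage e U : atlas e -> open U -> open (cimage e U).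
Proof.
move=> ae oU; rewrite openE => y yU.
have [ep Up yE] := cimage_param ae yU.
rewrite /interior -yE.
have n1 := cimage_near ae ep.
have n2 := param_near ae ep (open_nbhs_nbhs (conj oU Up)).
apply: filterS2 n1 n2 => z z1 z2; have [ez _ zE] := cimage_param ae z1.
by exists (param e z).
Qed.

Lemma transition_smooth e e' : atlas e -> atlas e' ->
  smooth_on (cimage e (cdom e')) (ccoord e' \o param e).
Proof. exact: atlas_compatible. Qed.

Lemma open_cdom_image e e' : atlas e -> atlas e' -> open (cimage e (cdom e')).
Proof. by move=> ae ae'; apply: open_cimage => //; have [] := atlas_chart ae'. Qed.

Lemma transition_differentiable e e' p : atlas e -> atlas e' -> cdom e p -> cdom e' p ->
  differentiable (ccoord e' \o param e) (ccoord e p).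
Proof.
move=> ae ae' ep e'p; apply: smooth_differentiable (transition_smooth ae ae') _.
exact: cimage_ccoord.
Qed.

Definition trans_mx e e' p : 'M[R]_n := jacobian (ccoord e' \o param e) (ccoord e p).

Lemma trans_mxE e e' p v : v *m trans_mx e e' p = 'd (ccoord e' \o param e) (ccoord e p) v.
Proof. by rewrite /trans_mx /jacobian mul_rV_lin1. Qed.

Lemma jacobian_near (k l : nat) (f g : 'rV[R]_k -> 'rV[R]_l) x :
  (\forall y \near x, f y = g y) -> differentiable g x -> jacobian f x = jacobian g x.
Proof.
move=> fg dg; have [_ E] := near_eq_differentiable fg dg.
apply: jacobian_unique => v; exact: etrans (congr1 (@^~ v) E) (esym (mul_jacobian _ _ _)).
Qed.

Lemma jacobian_comp (k l m : nat) (f : 'rV[R]_k -> 'rV[R]_l) (g : 'rV[R]_l -> 'rV[R]_m) x y :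
  f x = y -> differentiable f x -> differentiable g y ->
  differentiable (g \o f) x /\ jacobian (g \o f) x = jacobian f x *m jacobian g y.
Proof.
move=> <- df dg; split; first exact: differentiable_comp df dg.
apply: jacobian_unique => v; rewrite mulmxA !mul_jacobian.
exact: (congr1 (@^~ v) (diff_comp df dg)).
Qed.

Lemma trans_mx_comp e e' e'' p : atlas e -> atlas e' -> atlas e'' ->
  cdom e p -> cdom e' p -> cdom e'' p ->
  trans_mx e e'' p = trans_mx e e' p *m trans_mx e' e'' p.
Proof.
move=> ae ae' ae'' ep e'p e''p.
have d1 := transition_differentiable ae ae' ep e'p.
have d2 := transition_differentiable ae' ae'' e'p e''p.
have E : (ccoord e' \o param e) (ccoord e p) = ccoord e' p by rewrite /= paramK.
have [d3 <-] := jacobian_comp E d1 d2.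
apply: jacobian_near d3.
apply: filterS (param_near ae ep (cdom_near ae' e'p)) => y /= ey.
by rewrite paramK.
Qed.

Lemma trans_mx_id e p : atlas e -> cdom e p -> trans_mx e e p = 1%:M.
Proof.
move=> ae ep; rewrite /trans_mx (jacobian_near (g := id)) //.
  by apply: jacobian_unique => v; rewrite mulmx1 diff_idE.
apply: filterS (cimage_near ae ep) => y /(cimage_param ae)[_ _].
exact.
Qed.

Lemma trans_mx_jacobian e e' p :
  trans_mx e e' p = jacobian (ccoord e' \o param e) (ccoord e p).
Proof. by []. Qed.

(* Otherwise unification unfolds the differentials hidden in [trans_mx]. *)
Opaque trans_mx.

Lemma trans_mx_unit e e' p : atlas e -> atlas e' -> cdom e p -> cdom e' p ->
  trans_mx e e' p \in unitmx.
Proof.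
move=> ae ae' ep e'p; apply: unitmx_of_injective => v v0.
rewrite -[v]mulmx1 -(trans_mx_id ae ep) (trans_mx_comp ae ae' ae ep e'p ep) mulmxA v0.
exact: mul0mx.
Qed.

Lemma tcoordE e p v : tcoord e p v = v *m trans_mx (chart_at p) e p.
Proof. by rewrite trans_mxE. Qed.

Lemma field_repE e Y p : atlas e -> cdom e p ->
  field_rep e Y (ccoord e p) = Y p *m trans_mx (chart_at p) e p.
Proof. by move=> ae ep; rewrite /field_rep paramK // tcoordE. Qed.

Lemma field_rep_chart_at Y p : field_rep (chart_at p) Y (ccoord (chart_at p) p) = Y p.
Proof.
have a := chart_at_atlas p; have d := chart_at_dom p.
by rewrite field_repE // trans_mx_id // mulmx1.
Qed.

Lemma field_rep_change e e' Y p : atlas e -> atlas e' -> cdom e p -> cdom e' p ->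
  field_rep e' Y (ccoord e' p) = field_rep e Y (ccoord e p) *m trans_mx e e' p.
Proof.
move=> ae ae' ep e'p; rewrite (field_repE Y ae' e'p) (field_repE Y ae ep) -mulmxA.
by rewrite (trans_mx_comp (chart_at_atlas p) ae ae' (chart_at_dom p) ep e'p).
Qed.

(** The bracket read in one fixed chart, which can be differentiated again; [bracket] uses at each
    point the preferred chart, which varies with the point. *)
Definition lie e X Y (y : 'rV[R]_n) : 'rV[R]_n :=
  'd (field_rep e Y) y (field_rep e X y) - 'd (field_rep e X) y (field_rep e Y y).

Lemma bracketE X Y p : bracket X Y p = lie (chart_at p) X Y (ccoord (chart_at p) p).
Proof. by rewrite /lie !field_rep_chart_at. Qed.

Lemma differentiable_jacobian (k l : nat) (V : set 'rV[R]_k) (f : 'rV[R]_k -> 'rV[R]_l) x :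
  open V -> smooth_on V f -> V x -> differentiable (jacobian f) x.
Proof.
move=> oV sf Vx; apply: differentiable_mx => i j.
have nV : \forall y \near x, V y by exact: open_nbhs_nbhs.
have D1 := smooth_differentiable (smooth_derive (delta_mx 0 i) sf) Vx.
apply: (near_eq_differentiable _ (differentiable_entry 0 j D1)).1.
apply: filterS nV => y Vy.
have := etrans (mul_jacobian f y (delta_mx 0 i))
  (esym (deriveE (delta_mx 0 i) (smooth_differentiable sf Vy))).
by move=> /(congr1 (fun w : 'rV[R]_l => w 0 j)) <-; rewrite -rowE [RHS]mxE.
Qed.

Lemma mul_diff_jacobian (k l : nat) (f : 'rV[R]_k -> 'rV[R]_l) x w u :
  differentiable (jacobian f) x ->
  differentiable (fun y => 'd f y w) x /\
  w *m 'd (jacobian f) x u = 'd (fun y => 'd f y w) x u.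
Proof.
move=> dJ; have [d1 d2] := mulmx_diff (differentiable_cst w x) dJ.
have E : (fun y => cst w y *m jacobian f y) = (fun y => 'd f y w).
  by apply/funext => y; exact: mul_jacobian.
rewrite E in d1 d2; split; first exact: d1.
by rewrite (d2 u _ _ (diff_cstE w x u) erefl) mul0mx add0r.
Qed.

Lemma field_rep_smooth e U Y : atlas e -> smooth_field U Y ->
  smooth_on (cimage e U) (field_rep e Y).
Proof. by move=> ae; exact. Qed.

Lemma field_rep_differentiable e U Y p : atlas e -> smooth_field U Y -> cdom e p -> U p ->
  differentiable (field_rep e Y) (ccoord e p).
Proof.
move=> ae sY ep Up.
exact: smooth_differentiable (field_rep_smooth ae sY) (cimage_ccoord ep Up).
Qed.

(** Differentiates the identity between the two representations of [Y]. The last term, with the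
    second derivative of the transition map, is why neither half of a bracket is invariant by
    itself. *)
Lemma diff_field_rep_change e e' U Y p u : atlas e -> atlas e' -> cdom e p -> cdom e' p ->
  open U -> U p -> smooth_field U Y ->
  'd (field_rep e' Y) (ccoord e' p) (u *m trans_mx e e' p) =
    'd (field_rep e Y) (ccoord e p) u *m trans_mx e e' p +
    field_rep e Y (ccoord e p) *m 'd (jacobian (ccoord e' \o param e)) (ccoord e p) u.
Proof.
move=> ae ae' ep e'p oU Up sY.
pose phi := ccoord e' \o param e; pose x := ccoord e p.
have phx : phi x = ccoord e' p by rewrite /phi /x /= paramK.
have dphi : differentiable phi x := transition_differentiable ae ae' ep e'p.
have dY' := field_rep_differentiable ae' sY e'p Up.
have dY := field_rep_differentiable ae sY ep Up.
have dJ : differentiable (jacobian phi) x.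
  apply: differentiable_jacobian (transition_smooth ae ae') _.
    exact: open_cdom_image.
  exact: cimage_ccoord.
have [dc cE] := jacobian_comp phx dphi dY'.
have [dm mE] := mulmx_diff dY dJ.
have eqn : \forall y \near x, (field_rep e' Y \o phi) y = field_rep e Y y *m jacobian phi y.
  have n1 := cimage_near ae ep.
  have n2 := param_near ae ep (cdom_near ae' e'p).
  apply: filterS2 n1 n2 => y /(cimage_param ae)[eq _ qE] e'q.
  have := field_rep_change Y ae ae' eq e'q.
  by rewrite trans_mx_jacobian qE.
have [_ E] := near_eq_differentiable eqn dm.
have L0 : u *m jacobian phi x *m jacobian (field_rep e' Y) (ccoord e' p) =
    u *m jacobian (field_rep e' Y \o phi) x by rewrite cE mulmxA.
have L := etrans (esym (mul_jacobian _ _ _)) (etrans L0 (mul_jacobian _ _ _)).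
rewrite !trans_mx_jacobian.
exact: (etrans L (etrans (congr1 (@^~ u) E) (mE u _ _ erefl erefl))).
Qed.

(** The second order terms of the two halves are exchanged by the symmetry of second derivatives,
    and cancel. *)
Lemma lie_change e e' U X Y p : atlas e -> atlas e' -> cdom e p -> cdom e' p ->
  open U -> U p -> smooth_field U X -> smooth_field U Y ->
  lie e' X Y (ccoord e' p) = lie e X Y (ccoord e p) *m trans_mx e e' p.
Proof.
move=> ae ae' ep e'p oU Up sX sY; rewrite /lie.
rewrite (field_rep_change X ae ae' ep e'p) (field_rep_change Y ae ae' ep e'p).
have dJ : differentiable (jacobian (ccoord e' \o param e)) (ccoord e p).
  apply: differentiable_jacobian (transition_smooth ae ae') _.
    exact: open_cdom_image.
  exact: cimage_ccoord.
have [dX EX] := mul_diff_jacobian (field_rep e X (ccoord e p)) (field_rep e Y (ccoord e p)) dJ.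
have [dY EY] := mul_diff_jacobian (field_rep e Y (ccoord e p)) (field_rep e X (ccoord e p)) dJ.
have nd : \forall y \near ccoord e p, differentiable (ccoord e' \o param e) y.
  have : \forall y \near ccoord e p, cimage e (cdom e') y.
    by apply: open_nbhs_nbhs; split; [exact: open_cdom_image|exact: cimage_ccoord].
  by apply: filterS => y; exact: smooth_differentiable (transition_smooth ae ae').
have S := schwarz nd dX dY.
apply: (sub_mulmx_eq (diff_field_rep_change _ ae ae' ep e'p oU Up sY)
  (diff_field_rep_change _ ae ae' ep e'p oU Up sX)).
exact: (etrans EY (etrans (esym S) (esym EX))).
Qed.

Lemma field_rep_bracket e U X Y p : atlas e -> cdom e p -> open U -> U p ->
  smooth_field U X -> smooth_field U Y ->
  field_rep e (bracket X Y) (ccoord e p) = lie e X Y (ccoord e p).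
Proof.
move=> ae ep oU Up sX sY; rewrite (field_repE _ ae ep) bracketE.
exact/esym/(lie_change (chart_at_atlas p) ae (chart_at_dom p) ep oU Up sX sY).
Qed.

Lemma smooth_bracket U X Y : open U -> smooth_field U X -> smooth_field U Y ->
  smooth_field U (bracket X Y).
Proof.
move=> oU sX sY e ae; have oi := open_cimage ae oU.
have sX' := field_rep_smooth ae sX; have sY' := field_rep_smooth ae sY.
have := smoothB oi (smooth_diff_apply oi sY' sX') (smooth_diff_apply oi sX' sY').
apply: smooth_on_eq => // y yU; have [ep Up yE] := cimage_param ae yU.
by rewrite -yE (field_rep_bracket ae ep oU Up sX sY).
Qed.

End Charts.

(** By the supremum of the times reached. The step compares two times near [tau] without assuming
    [P tau], so a chart or a frame chosen at [tau] serves for all times on both sides of it. *)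
Lemma interval_step_induction (R : realType) (P : R -> Prop) (b : R) : 0 <= b -> P 0 ->
  (forall tau, 0 <= tau <= b -> exists2 d, 0 < d & forall s t, 0 <= s -> s <= t -> t <= b ->
     `|s - tau| < d -> `|t - tau| < d -> P s -> P t) -> P b.
Proof.
move=> b0 P0 step.
pose A := [set t | 0 <= t <= b /\ P t].
have A0 : A 0 by split; rewrite ?lexx.
have supA : has_sup A.
  by split; [exists 0|exists b => t [/andP[]]].
have tau0 : 0 <= sup A by apply: sup_upper_bound.
have taub : sup A <= b by apply: ge_sup => [|t [/andP[]]]; first by exists 0.
have [d d0 dP] := step (sup A) (introT andP (conj tau0 taub)).
have [s [/andP[s0 sb] Ps] sd] := sup_adherent d0 supA.
have stau : s <= sup A by apply: sup_upper_bound => //; split => //; apply/andP.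
have sdist : `|s - sup A| < d by rewrite ltr_norml; lra.
pose t := Num.min b (sup A + d / 2).
have Pt : P t.
  apply: (dP s) => //.
  - by rewrite le_min sb /=; lra.
  - by rewrite ge_min lexx.
  - by rewrite ltr_norml /t; case: (leP b (sup A + d / 2)) => ?; lra.
have tA : A t.
  by split=> //; rewrite /t le_min ge_min lexx b0 /= andbT; lra.
have := sup_upper_bound supA tA; rewrite /t.
have [bt _|tb] := leP b (sup A + d / 2); last by lra.
by move: Pt; rewrite /t (min_l bt).
Qed.

Section CurveCalculus.
Context {R : realType} {E : normedModType R}.

Lemma hdw_union (A B C : set R) (f : R -> E) t l :
  (\forall s \near t, C s -> A s \/ B s) ->
  has_deriv_within A f t l -> has_deriv_within B f t l -> has_deriv_within C f t l.
Proof.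
move=> CAB fA fB P Pl.
have HA : nbhs t (fun s => s != t -> A s -> P ((s - t)^-1 *: (f s - f t))) := fA P Pl.
have HB : nbhs t (fun s => s != t -> B s -> P ((s - t)^-1 *: (f s - f t))) := fB P Pl.
suff : nbhs t (fun s => s != t -> C s -> P ((s - t)^-1 *: (f s - f t))) by [].
by apply: filterS3 CAB HA HB => s h hA hB st /h[/(hA st)|/(hB st)].
Qed.

Lemma hdw_shift (A B : set R) (f : R -> E) t c l :
  (\forall s \near t, B s -> A (s - c)) ->
  has_deriv_within A f (t - c) l -> has_deriv_within B (fun s => f (s - c)) t l.
Proof.
move=> BA fA P Pl.
have HA : nbhs (t - c) (fun s => s != t - c -> A s ->
    P ((s - (t - c))^-1 *: (f s - f (t - c)))) := fA P Pl.
suff : nbhs t (fun s => s != t -> B s -> P ((s - t)^-1 *: (f (s - c) - f (t - c)))) by [].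
have cc : (fun s : R => s - c) @ t --> t - c.
  by apply: cvgB; [exact: cvg_id|exact: cvg_cst].
have HA' : nbhs t (fun s => s - c != t - c -> A (s - c) ->
    P ((s - c - (t - c))^-1 *: (f (s - c) - f (t - c)))) := cc _ HA.
apply: filterS2 BA HA' => s h hA st Bs.
have := hA _ (h Bs); rewrite opprB addrA subrK; apply.
by apply: contra st => /eqP /addIr ->.
Qed.

Lemma within_cvg_near (T : topologicalType) (A : set R) (f g : R -> T) t :
  (\forall s \near t, A s -> f s = g s) -> f t = g t ->
  f @ within A (nbhs t) --> f t -> g @ within A (nbhs t) --> g t.
Proof.
move=> fg ft H; rewrite -ft; apply: cvg_trans H => P fP.
suff : nbhs t (fun s => A s -> P (g s)) by [].
have : nbhs t (fun s => A s -> P (f s)) := fP.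
by apply: filterS2 fg => s h + As => /(_ As); rewrite h.
Qed.

End CurveCalculus.

Lemma diff_rows (R : realType) (E : normedModType R) (k l : nat) (f : 'I_k -> E -> 'rV[R]_l) x :
  (forall i, differentiable (f i) x) ->
  differentiable (fun y => \matrix_i f i y) x /\
  forall v, 'd (fun y => \matrix_i f i y) x v = \matrix_i 'd (f i) x v.
Proof.
move=> df; set G := (fun y : E => \matrix_i f i y).
have dG : differentiable G x.
  apply: differentiable_mx => i j.
  have -> : (fun y => G y i j : R) = fun y => f i y 0 j by apply/funext => y; rewrite mxE.
  exact: differentiable_entry.
split=> // v; apply/row_matrixP => i; rewrite rowK.
have [_ /(_ v 0 _ _ erefl) H] := mulmx_diff (differentiable_cst (delta_mx 0 i : 'rV[R]_k) x) dG.
have E1 : (fun y => cst (delta_mx 0 i : 'rV[R]_k) y *m G y) = f i.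
  by apply/funext => y /=; rewrite -rowE rowK.
rewrite rowE -E1 H; last by rewrite diff_cstE.
by rewrite mul0mx add0r.
Qed.

Section LinearSpan.
Context {R : realType} {n : nat}.

Lemma lspan_submx (k : nat) (S : set 'rV[R]_n) (G : 'M[R]_(k, n)) u :
  (forall v, S v -> (v <= G)%MS) -> lspan S u -> (u <= G)%MS.
Proof.
move=> SG [vs vsS uS]; rewrite (coord_span (X := in_tuple vs) uS).
apply: summx_sub => i _; apply: scalemx_sub.
by apply/SG/vsS/mem_nth.
Qed.

Lemma lspan_sub (S : set 'rV[R]_n) v : S v -> lspan S v.
Proof.
by move=> Sv; exists [:: v] => [u|]; rewrite ?inE ?memv_span ?inE // => /eqP ->.
Qed.

Lemma row_free_of_free (k : nat) (X : k.-tuple 'rV[R]_n) :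
  free X -> row_free (\matrix_(i < k) X`_i).
Proof.
move=> /freeP fX; apply: inj_row_free => v v0; apply/rowP => i; rewrite mxE.
apply: (fX (fun i => v 0 i)); move: v0; rewrite mulmx_sum_row.
by under eq_bigr do rewrite rowK.
Qed.

(** Turns the rank condition of a regular pair into the linear independence of a frame together with
    its brackets. *)
Lemma has_rank_row_free (k : nat) (S : set 'rV[R]_n) (G : 'M[R]_(k, n)) :
  has_rank S k -> (forall u, S u -> (u <= G)%MS) -> row_free G.
Proof.
case=> E kE ->; case: _ / kE G => G EG.
rewrite /row_free eqn_leq rank_leq_row andTb.
pose B := \matrix_(i < \dim E) (vbasis E)`_i.
have /eqP Bk : row_free B by apply/row_free_of_free/basis_free/vbasisP.
apply: (leq_trans (n := \rank B)); first by rewrite Bk.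
apply: mxrankS; apply/row_subP => i; rewrite rowK; apply: EG.
by apply: vbasis_mem; apply: mem_nth; rewrite size_tuple.
Qed.

End LinearSpan.

Lemma bracket_algebra (R : pzRingType) (k l n : nat) (A B : 'M[R]_(k, n)) (a b : 'M[R]_(k, l))
    (G D Z : 'M[R]_(l, n)) (J : 'M[R]_n) :
  A = a *m G + b *m D -> B = b *m G *m J -> Z = D - G *m J -> A - B = a *m G + b *m Z.
Proof. by move=> -> -> ->; rewrite mulmxBr mulmxA addrA. Qed.

(** * Frames of a dynamic pair *)

Section Frames.
Context {R : realType} {n m : nat} {M : manifold R n}.
Implicit Types (e : chart R n M) (W : 'I_m -> M -> 'rV[R]_n).

Definition frame_mx W q : 'M[R]_(m, n) := \matrix_i W i q.

Definition frame_rep e W y : 'M[R]_(m, n) := \matrix_i field_rep e (W i) y.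

Lemma frame_repE e W q : atlas e -> cdom e q ->
  frame_rep e W (ccoord e q) = frame_mx W q *m trans_mx (chart_at q) e q.
Proof.
move=> ae eq; apply/row_matrixP => i.
by rewrite row_mul !rowK field_repE.
Qed.

Lemma frame_rep_chart_at W q :
  frame_rep (chart_at q) W (ccoord (chart_at q) q) = frame_mx W q.
Proof. by apply/row_matrixP => i; rewrite !rowK field_rep_chart_at. Qed.

Lemma frame_rep_differentiable e U W q : atlas e -> cdom e q -> U q ->
  (forall i, smooth_field U (W i)) ->
  differentiable (frame_rep e W) (ccoord e q) /\
  forall v, 'd (frame_rep e W) (ccoord e q) v =
    \matrix_i 'd (field_rep e (W i)) (ccoord e q) v.
Proof.
move=> ae eq Uq sW; apply: diff_rows => i.
exact: field_rep_differentiable ae (sW i) eq Uq.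
Qed.

(** The Leibniz rule [[X, f W] = X(f) W + f [X, W]], the coefficients [f] being given in the chart
    at [q]. *)
Lemma bracket_combination U X W Y (f : 'rV[R]_n -> 'rV[R]_m) q (e := chart_at q) :
  U q -> (forall i, smooth_field U (W i)) ->
  differentiable f (ccoord e q) ->
  (\forall y \near ccoord e q, field_rep e Y y = f y *m frame_rep e W y) ->
  bracket X Y q = 'd f (ccoord e q) (X q) *m frame_mx W q +
    f (ccoord e q) *m frame_mx (fun i => bracket X (W i)) q.
Proof.
move=> Uq sW df fE; have ae : atlas e := chart_at_atlas q; have eq : cdom e q := chart_at_dom q.
have [dW dWE] := frame_rep_differentiable ae eq Uq sW.
have [dfW /(_ (X q) _ _ erefl erefl) dfWE] := mulmx_diff df dW.
have [_ dY] := near_eq_differentiable fE dfW.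
have GE : frame_rep e W (ccoord e q) = frame_mx W q := frame_rep_chart_at W q.
have YE : Y q = f (ccoord e q) *m frame_mx W q.
  by rewrite -(field_rep_chart_at Y) (nbhs_singleton fE) GE.
have XY : 'd (field_rep e X) (ccoord e q) (Y q) =
    f (ccoord e q) *m frame_mx W q *m jacobian (field_rep e X) (ccoord e q).
  by rewrite YE mul_jacobian.
rewrite GE in dfWE.
apply: (bracket_algebra (etrans (congr1 (@^~ (X q)) dY) dfWE) XY).
rewrite dWE; apply/row_matrixP => i; rewrite linearB /= row_mul !rowK.
by rewrite mul_jacobian.
Qed.

Lemma local_frameP N V U W q : local_frame N V U W -> U q ->
  row_free (frame_mx W q) /\ forall v, v \in V q <-> exists a : 'rV[R]_m, v = a *m frame_mx W q.
Proof.
move=> [oU UN sW bW] Uq; have b := bW q Uq.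
have E : frame_mx W q = \matrix_(i < m) [tuple W i q | i < m]`_i.
  by apply/row_matrixP => i; rewrite !rowK -tnth_nth tnth_mktuple.
split; first by rewrite E; apply: row_free_of_free; exact: basis_free b.
move=> v; split=> [vV|[a ->]].
  exists (\row_i coord [tuple W i q | i < m] i v).
  rewrite {1}(coord_basis b vV) E mulmx_sum_row; apply: eq_bigr => i _.
  by rewrite mxE rowK.
rewrite mulmx_sum_row; apply: memv_suml => i _; apply: memvZ; rewrite rowK.
have := basis_mem b; apply; apply/tnthP; exists i.
by rewrite tnth_mktuple.
Qed.

Lemma smooth_field_sub U U' (Y : M -> 'rV[R]_n) : U' `<=` U ->
  smooth_field U Y -> smooth_field U' Y.
Proof.
move=> UU sY e ae; apply: smooth_on_sub (sY e ae).
by apply: image_subset => p [ep /UU].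
Qed.

(** A local section [Y] of [V] has differentiable coefficients in the frame, by
    [differentiable_coef], so the Leibniz rule expresses its bracket through the frame and the
    brackets of the frame. *)
Lemma derived_sub N X V U W q u : local_frame N V U W -> U q -> derived N X V q u ->
  (u <= col_mx (frame_mx W q) (frame_mx (fun i => bracket X (W i)) q))%MS.
Proof.
move=> lW Uq; have [oU UN sW bW] := lW.
apply: lspan_submx => v [U' [Y [oU' [_ U'q] sY YV [->|->]]]].
  have [_ /(_ (Y q))[/(_ (YV q U'q))[a ->] _]] := local_frameP lW Uq.
  by rewrite -addsmxE; apply: submx_trans (submxMl _ _) (addsmxSl _ _).
pose e := chart_at q; pose f y := field_rep e Y y *m pinvmx (frame_rep e W y).
have ae : atlas e := chart_at_atlas q; have eq : cdom e q := chart_at_dom q.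
have nE : \forall y \near ccoord e q, field_rep e Y y = f y *m frame_rep e W y.
  have n1 := cimage_near ae eq.
  have n2 := param_near ae eq (open_nbhs_nbhs (conj oU Uq)).
  have n3 := param_near ae eq (open_nbhs_nbhs (conj oU' U'q)).
  apply: filterS3 n1 n2 n3 => y yi Uy U'y.
  have [ep _ yE] := cimage_param ae yi; rewrite -yE in Uy U'y *.
  rewrite paramK // in Uy U'y; set p := param e y in ep Uy U'y *.
  rewrite /f mulmxKpV // frame_repE // field_repE //.
  apply: submxMr; have [_ /(_ (Y p))[/(_ (YV p U'y))[a ->] _]] := local_frameP lW Uy.
  exact: submxMl.
have [dW _] := frame_rep_differentiable ae eq Uq sW.
have dY := field_rep_differentiable ae sY eq U'q.
have fr : row_free (frame_rep e W (ccoord e q)).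
  by rewrite frame_rep_chart_at; have [] := local_frameP lW Uq.
have df := differentiable_coef dW dY fr nE.
rewrite (bracket_combination X Uq sW df nE) -mul_row_col.
exact: submxMl.
Qed.

Lemma derived_frame N X V U W q : local_frame N V U W -> U q -> forall i,
  derived N X V q (W i q) /\ derived N X V q (bracket X (W i) q).
Proof.
move=> [oU UN sW bW] Uq i.
have WV p : U p -> W i p \in V p.
  move=> Up; apply: (basis_mem (bW p Up)); apply/tnthP; exists i.
  by rewrite tnth_mktuple.
have UNq : U `<=` N /\ U q by [].
by split; apply: lspan_sub; exists U, (W i); split=> //; [left|right].
Qed.

Lemma regular_row_free N X V U W q : regular_dynamic_pair m N X V ->
  local_frame N V U W -> U q ->
  row_free (col_mx (frame_mx W q) (frame_mx (fun i => bracket X (W i)) q)).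
Proof.
move=> [_ _ _ rk _] lW Uq; have [_ UN _ _] := lW.
have := rk q (UN q Uq); rewrite mulSn mul1n => rkq.
by apply: (has_rank_row_free rkq) => u du; exact: (derived_sub lW Uq du).
Qed.

Lemma structure_matricesP X U W H0 H1 : structure_matrices X U W H0 H1 <->
  forall q, U q -> frame_mx (fun i => bracket X (bracket X (W i))) q =
    (H0 q)^T *m frame_mx W q + (H1 q)^T *m frame_mx (fun i => bracket X (W i)) q.
Proof.
have E q i : row i ((H0 q)^T *m frame_mx W q + (H1 q)^T *m frame_mx (fun i => bracket X (W i)) q)
   = \sum_j H0 q j i *: W j q + \sum_j H1 q j i *: bracket X (W j) q.
  rewrite linearD /= !row_mul !mulmx_sum_row.
  by congr (_ + _); apply: eq_bigr => j _; rewrite rowK !mxE.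
split=> [H q Uq|H q Uq i].
  by apply/row_matrixP => i; rewrite E rowK H.
by rewrite -E -H // rowK.
Qed.

(** The invariance of the derived distribution is applied to its sections [bracket X (W i)]; a
    pseudo-inverse then reads the coefficients off point by point. *)
Lemma structure_matrices_exist N X V U W : regular_dynamic_pair m N X V ->
  local_frame N V U W -> exists H0 H1, structure_matrices X U W H0 H1.
Proof.
move=> reg lW; have [sX _ _ _ inv] := reg; have [oU UN sW bW] := lW.
pose G q := col_mx (frame_mx W q) (frame_mx (fun i => bracket X (W i)) q).
pose C q := frame_mx (fun i => bracket X (bracket X (W i))) q *m pinvmx (G q).
exists (fun q => (lsubmx (C q))^T), (fun q => (rsubmx (C q))^T).
apply/structure_matricesP => q Uq; rewrite !trmxK -mul_row_col hsubmxK /C mulmxKpV //.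
apply/row_subP => i; rewrite rowK; apply: (derived_sub lW Uq).
have sXU := smooth_field_sub UN sX.
apply: (inv U) Uq => //; first by apply: smooth_bracket.
by move=> p Up; have [_] := derived_frame X lW Up i.
Qed.

(** [structure_matrices] imposes no regularity, but it determines [H0] and [H1] as the coefficients
    of one smooth family in another one that is free. *)
Lemma structure_mx_differentiable N X V U W H0 H1 q :
  regular_dynamic_pair m N X V -> local_frame N V U W -> structure_matrices X U W H0 H1 ->
  U q -> differentiable (H0 \o param (chart_at q)) (ccoord (chart_at q) q) /\
    differentiable (H1 \o param (chart_at q)) (ccoord (chart_at q) q).
Proof.
move=> reg lW /structure_matricesP sm Uq; have [sX _ _ _ inv] := reg; have [oU UN sW bW] := lW.
pose e := chart_at q.
have ae : atlas e := chart_at_atlas q; have eq : cdom e q := chart_at_dom q.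
have sXU := smooth_field_sub UN sX.
have sZ i : smooth_field U (bracket X (W i)) by exact: smooth_bracket.
have sB i : smooth_field U (bracket X (bracket X (W i))) by exact: smooth_bracket.
have [dW _] := frame_rep_differentiable ae eq Uq sW.
have [dZ _] := frame_rep_differentiable ae eq Uq sZ.
have [dB _] := frame_rep_differentiable ae eq Uq sB.
pose G y := col_mx (frame_rep e W y) (frame_rep e (fun i => bracket X (W i)) y).
have dG : differentiable G (ccoord e q).
  apply: differentiable_mx => i j; rewrite /G.
  case: (split_ordP i) => k ->.
    have -> : (fun y => col_mx (frame_rep e W y) (frame_rep e (fun i => bracket X (W i)) y)
       (lshift m k) j : R) = fun y => frame_rep e W y k j.
      by apply/funext => y; rewrite col_mxEu.
    exact: differentiable_entry.
  have -> : (fun y => col_mx (frame_rep e W y) (frame_rep e (fun i => bracket X (W i)) y)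
       (rshift m k) j : R) = fun y => frame_rep e (fun i => bracket X (W i)) y k j.
    by apply/funext => y; rewrite col_mxEd.
  exact: differentiable_entry.
have Gfree : row_free (G (ccoord e q)).
  by rewrite /G !frame_rep_chart_at; exact: (regular_row_free reg lW Uq).
pose C y := row_mx (H0 (param e y))^T (H1 (param e y))^T.
have nE : \forall y \near ccoord e q,
    frame_rep e (fun i => bracket X (bracket X (W i))) y = C y *m G y.
  have n1 := cimage_near ae eq.
  have n2 := param_near ae eq (open_nbhs_nbhs (conj oU Uq)).
  apply: filterS2 n1 n2 => y yi; have [ep _ yE] := cimage_param ae yi; rewrite -yE paramK //.
  set p := param e y in ep * => Up.
  rewrite /G /C paramK // !frame_repE // mul_row_col sm //.
  by rewrite !mulmxDl !mulmxA.
have dC := differentiable_coef dG dB Gfree nE.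
split; apply: differentiable_mx => i j.
  have -> : (fun y => (H0 \o param e) y i j : R) = fun y => C y j (lshift m i).
    by apply/funext => y; rewrite /C row_mxEl mxE.
  exact: differentiable_entry.
have -> : (fun y => (H1 \o param e) y i j : R) = fun y => C y j (rshift m i).
  by apply/funext => y; rewrite /C row_mxEr mxE.
exact: differentiable_entry.
Qed.

End Frames.

Lemma hdw_rows (R : realType) (k l : nat) (A : set R) (f : R -> 'M[R]_(k, l)) t
    (df : 'M[R]_(k, l)) (g : 'I_k -> R -> 'rV[R]_l) (dg : 'I_k -> 'rV[R]_l) :
  (forall i, has_deriv_within A (g i) t (dg i)) ->
  (forall i s, row i (f s) = g i s) -> (forall i, row i df = dg i) ->
  has_deriv_within A f t df.
Proof.
move=> H fE dfE; apply: hdw_mx => i j.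
have E (B : 'M[R]_(k, l)) : B i j = row i B 0 j by rewrite mxE.
rewrite E dfE; apply: hdw_near (hdw_entry (H i)); last by rewrite E fE.
by apply: (@filterE _ (nbhs t)) => s _; rewrite E fE.
Qed.

Lemma hdw_unique_within (R : realType) (E : normedModType R) (A : set R) (f : R -> E) t l k :
  ProperFilter (within A t^') ->
  has_deriv_within A f t l -> has_deriv_within A f t k -> l = k.
Proof. by move=> PF; exact: cvg_unique. Qed.

Lemma hdw_coef_within (R : realType) (p q r : nat) (A : set R) (C : R -> 'M[R]_(p, q))
    (f : R -> 'M[R]_(q, r)) (g : R -> 'M[R]_(p, r)) t df dg :
  has_deriv_within A f t df -> has_deriv_within A g t dg -> row_free (f t) ->
  (\forall s \near t, A s -> g s = C s *m f s) -> g t = C t *m f t ->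
  exists dC, has_deriv_within A C t dC.
Proof.
move=> df' dg' ff gE gt; pose B := pinvmx (f t).
have dfB := hdw_mulmx df' (hdw_cst A B t); have dgB := hdw_mulmx dg' (hdw_cst A B t).
have u1 : f t *m B = 1%:M by rewrite mulmxVp.
have u : f t *m B \in unitmx by rewrite u1 unitmx1.
have D := hdw_mulmx dgB (hdw_invmx u dfB).
eexists; apply: hdw_near D; last by rewrite gt -(mulmxA (C t)) mulmxK.
have cu : f s *m B @[s --> within A (nbhs t)] --> f t *m B := hdw_within_cvg dfB.
have un : nbhs t (fun s => A s -> f s *m B \in unitmx) := cu _ (unitmx_near u).
by apply: filterS2 gE un => s sE su As; rewrite sE // -(mulmxA (C s)) mulmxK //; exact: su.
Qed.

(** * Jacobi curves and the Riccati equation *)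

Section JacobiFrames.
Context {R : realType} {m n : nat}.
Implicit Types (t : R) (w z : R -> 'M[R]_(m, n)) (p l dl C D : R -> 'M[R]_m).

(* [w] and [z] are a frame and its bracket with [X], pulled back by the flow;
   frames are matrices of rows, hence [p] and [l] are the transposes of [H0] and
   [H1], [dl] is the derivative of [l], and [frame_curv] is the transpose of the
   matrix of the curvature operator. *)
Definition jacobi_frame w z p l dl t :=
  [/\ row_free (col_mx (w t) (z t)), has_deriv_within setT w t (z t),
      has_deriv_within setT z t (p t *m w t + l t *m z t) &
      has_deriv_within setT l t (dl t)].

Definition frame_curv p l dl t := - p t + 2^-1 *: dl t - 4^-1 *: (l t *m l t).

Lemma row_free_col_mx_inj (k : nat) (a b a1 b1 : 'M[R]_(k, m)) (w z : 'M[R]_(m, n)) :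
  row_free (col_mx w z) -> a *m w + b *m z = a1 *m w + b1 *m z -> a = a1 /\ b = b1.
Proof. by move=> wz; rewrite -!mul_row_col => /(row_free_inj wz) /eq_row_mx. Qed.

Lemma row_free_usubmx (w z : 'M[R]_(m, n)) : row_free (col_mx w z) -> row_free w.
Proof.
move=> wz; apply: inj_row_free => v vw.
have [|->//] := row_free_col_mx_inj (a := v) (b := 0) (a1 := 0) (b1 := 0) wz.
by rewrite vw !mul0mx !addr0.
Qed.

(** [D] and [E] stand for the first and second derivatives of the transition matrix [C]; the formula
    for [E] is the derivative of the one for [D]. Eliminating both leaves the conjugacy of the
    curvature matrices. *)
Lemma frame_change_algebra (p l dl p1 l1 dl1 C D E : 'M[R]_m) :
  p *m C + l *m D = E + C *m p1 -> D = 2^-1 *: (l *m C - C *m l1) ->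
  E = 2^-1 *: (dl *m C + l *m D - (D *m l1 + C *m dl1)) ->
  (- p + 2^-1 *: dl - 4^-1 *: (l *m l)) *m C =
  C *m (- p1 + 2^-1 *: dl1 - 4^-1 *: (l1 *m l1)).
Proof.
move=> H1 HD HE.
have lD : l *m D = 2^-1 *: (l *m l *m C - l *m C *m l1).
  by rewrite HD -scalemxAr mulmxBr !mulmxA.
have Dl : D *m l1 = 2^-1 *: (l *m C *m l1 - C *m l1 *m l1).
  by rewrite HD -scalemxAl mulmxBl.
rewrite !(mulmxBl, mulmxBr, mulmxDl, mulmxDr, mulNmx, mulmxN) -!(scalemxAl, scalemxAr) !mulmxA.
have -> : C *m p1 = p *m C + l *m D - E by rewrite H1 [E + _]addrC addrK.
rewrite HE Dl lD.
move: (p *m C) (dl *m C) (l *m l *m C) (l *m C *m l1) (C *m l1 *m l1) (C *m dl1).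
by move=> *; apply/matrixP => i j; rewrite !mxE; lra.
Qed.

(* If [w = C *m w1], then differentiating twice and comparing coefficients in the
   free family [(w1, z1)] determines [C'] and the transformation rule of the
   curvature matrix. *)
Lemma transition_deriv_exists w z p l dl w1 z1 p1 l1 dl1 C t :
  (\forall s \near t, [/\ jacobi_frame w z p l dl s, jacobi_frame w1 z1 p1 l1 dl1 s &
     w s = C s *m w1 s]) ->
  exists D : R -> 'M[R]_m, \forall s \near t, has_deriv_within setT C s (D s).
Proof.
move=> H; exists (fun s => 'D_1 C s).
apply: filterS (near_join H) => s Hs.
have [[wz dw _ _] [wz1 dw1 _ _] wC] := nbhs_singleton Hs.
have [D0 dC] : exists D0 : 'M[R]_m, has_deriv_within setT C s D0.
  apply: (hdw_coef_within dw1 dw (row_free_usubmx wz1) _ wC).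
  by apply: filterS Hs => u [].
have /hdwTE[_ E] := dC; rewrite E; exact: dC.
Qed.

Lemma transition_deriv w z p l dl w1 z1 p1 l1 dl1 C D t :
  (\forall s \near t, [/\ jacobi_frame w z p l dl s, jacobi_frame w1 z1 p1 l1 dl1 s &
     w s = C s *m w1 s]) ->
  (\forall s \near t, has_deriv_within setT C s (D s)) ->
  exists E, [/\ z t = D t *m w1 t + C t *m z1 t, has_deriv_within setT D t E,
   p t *m C t + l t *m D t = E + C t *m p1 t & D t = 2^-1 *: (l t *m C t - C t *m l1 t)].
Proof.
move=> H HD.
have zD : \forall s \near t, z s = D s *m w1 s + C s *m z1 s.
  apply: filterS2 (near_join H) HD => s Hs dC.
  have [[wz dw dz _] [wz1 dw1 dz1 _] wC] := nbhs_singleton Hs.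
  apply: (hdw_unique dw); apply: hdw_near (hdw_mulmx dC dw1); last by rewrite wC.
  by apply: filterS Hs => u [_ _ ->].
have [[wz dw dz _] [wz1 dw1 dz1 _] wC] := nbhs_singleton H.
have dC := nbhs_singleton HD; have zDt := nbhs_singleton zD.
(* [D] is differentiable because [(D, C)] is the matrix of coefficients of [z] in the free family
   [(w1, z1)]. *)
have [B dB] : exists B, has_deriv_within setT (fun s => row_mx (D s) (C s)) t B.
  apply: (hdw_coef_within (hdw_col_mx dw1 dz1) dz wz1); last by rewrite mul_row_col.
  by apply: filterS zD => s; rewrite mul_row_col.
have dD : has_deriv_within setT D t (lsubmx B).
  apply: hdw_mx => i j; rewrite mxE.
  have := hdw_entry dB (i := i) (j := lshift m j); apply: hdw_near; last by rewrite row_mxEl.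
  by apply: (@filterE _ (nbhs t)) => s _; rewrite row_mxEl.
exists (lsubmx B); set E := lsubmx B in dD *.
have zE : p t *m w t + l t *m z t = (E *m w1 t + D t *m z1 t) + (D t *m z1 t +
    C t *m (p1 t *m w1 t + l1 t *m z1 t)).
  apply: (hdw_unique dz); apply: hdw_near (hdwD (hdw_mulmx dD dw1) (hdw_mulmx dC dz1)).
    by apply: filterS zD => s -> _.
  by rewrite zDt.
have : (p t *m C t + l t *m D t) *m w1 t + (l t *m C t) *m z1 t =
       (E + C t *m p1 t) *m w1 t + (D t + D t + C t *m l1 t) *m z1 t.
  move: zE; rewrite wC zDt !(mulmxDl, mulmxDr) !mulmxA => zE.
  rewrite -addrA zE; move: (E *m _) (D t *m _) (C t *m p1 t *m _) (C t *m l1 t *m _).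
  by move=> *; apply/matrixP => i j; rewrite !mxE; ring.
case/(row_free_col_mx_inj wz1) => -> ->; split=> //.
rewrite addrK; move: (D t) => D0.
by apply/matrixP => i j; rewrite !mxE; lra.
Qed.

(** The three conclusions express the independence from the frame of the covariant derivative, of
    the horizontal space and of the curvature operator. *)
Lemma frame_change w z p l dl w1 z1 p1 l1 dl1 C t :
  (\forall s \near t, [/\ jacobi_frame w z p l dl s, jacobi_frame w1 z1 p1 l1 dl1 s &
     w s = C s *m w1 s]) ->
  [/\ has_deriv_within setT C t (2^-1 *: (l t *m C t - C t *m l1 t)),
      z t - 2^-1 *: (l t *m w t) = C t *m (z1 t - 2^-1 *: (l1 t *m w1 t)) &
      frame_curv p l dl t *m C t = C t *m frame_curv p1 l1 dl1 t].
Proof.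
move=> H; have [D HD] := transition_deriv_exists H.
have Dnear : \forall s \near t, D s = 2^-1 *: (l s *m C s - C s *m l1 s).
  by apply: filterS2 (near_join H) (near_join HD) => s Hs HDs;
    have [E []] := transition_deriv Hs HDs.
have [E [zD dD rel1 DE]] := transition_deriv H HD.
have dC := nbhs_singleton HD.
have [[wz dw dz dl'] [wz1 dw1 dz1 dl1'] wC] := nbhs_singleton H.
have EE : E = 2^-1 *: (dl t *m C t + l t *m D t - (D t *m l1 t + C t *m dl1 t)).
  apply: (hdw_unique dD).
  have dd := hdwZ (c := 2^-1) (hdwD (hdw_mulmx dl' dC) (hdwN (hdw_mulmx dC dl1'))).
  apply: hdw_near dd; last by rewrite DE.
  by apply: filterS Dnear => s -> _.
split; first by rewrite -DE.
  rewrite wC zD DE mulmxBr -scalemxAr -scalemxAl !mulmxBl !mulmxA.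
  move: (l t *m _ *m _) (C t *m l1 t *m _) (C t *m z1 t) => *.
  by apply/matrixP => i j; rewrite !mxE; lra.
exact: frame_change_algebra rel1 DE EE.
Qed.

End JacobiFrames.

Lemma nbhs_dist (R : realType) (E : normedModType R) (x : E) (P : set E) :
  nbhs x P -> exists2 d : R, 0 < d & forall y, `|y - x| < d -> P y.
Proof.
move=> /nbhs_ballP[d d0 H]; exists d => // y yd; apply: H.
by rewrite -ball_normE /ball_ /= distrC.
Qed.

(** * Traces of squares of self-adjoint matrices *)

Section TraceSquare.
Context {R : realType}.

(** Cholesky factorisation, by induction on the size. The Schur complement [D1] is again positive
    definite: its form at [v] is that of [G] at the row [(- a^-1 v b^T, v)]. *)
Lemma posdef_factor (k : nat) (G : 'M[R]_k) : G^T = G ->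
  (forall v : 'rV[R]_k, v != 0 -> 0 < (v *m G *m v^T) 0 0) ->
  exists2 P : 'M[R]_k, P \in unitmx & G = P *m P^T.
Proof.
elim: k G => [|k IH] G Gsym Gpos.
  by exists 1%:M; [exact: unitmx1|rewrite [LHS]flatmx0 [RHS]flatmx0].
pose G' : 'M[R]_(1 + k) := G; have Gs' : G'^T = G' := Gsym.
pose a := ulsubmx G' 0 0; pose b := ursubmx G'; pose D := drsubmx G'.
have GE : G' = block_mx a%:M b b^T D.
  rewrite -[LHS]submxK -/b -/D; congr block_mx; first exact: mx11_scalar.
  by rewrite /b trmx_ursub Gs'.
have Dsym : D^T = D by rewrite /D trmx_drsub Gs'.
have formE (x : 'rV[R]_1) (v : 'rV[R]_k) : row_mx x v *m G' *m (row_mx x v)^T =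
    x *m a%:M *m x^T + v *m b^T *m x^T + (x *m b *m v^T + v *m D *m v^T).
  by rewrite GE mul_row_block tr_row_mx mul_row_col !mulmxDl.
have a0 : 0 < a.
  have e0 : row_mx (1%:M : 'rV[R]_1) (0 : 'rV[R]_k) != 0.
    apply/eqP => /(congr1 lsubmx); rewrite row_mxKl linear0 => /matrixP/(_ 0 0).
    by rewrite !mxE => /eqP; rewrite oner_eq0.
  have := Gpos _ e0; rewrite -[G]/G' formE !mul0mx trmx0 !mulmx0 !addr0.
  by rewrite trmx1 mulmx1 mul1mx mxE eqxx mulr1n.
pose D1 := D - a^-1 *: (b^T *m b).
have [||P uP PE] := IH D1.
- by rewrite /D1 linearB linearZ /= trmx_mul trmxK Dsym.
- move=> v v0.
  have e0 : row_mx (- a^-1 *: (v *m b^T)) v != 0.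
    apply/eqP => /(congr1 rsubmx); rewrite row_mxKr linear0 => /eqP.
    by rewrite (negPf v0).
  have := Gpos _ e0; rewrite -[G]/G' formE.
  congr (0 < _); congr (fun_of_matrix _ 0 0).
  have vb : (v *m b^T)^T = b *m v^T by rewrite trmx_mul trmxK.
  rewrite linearZ /= vb mul_mx_scalar -!scalemxAl -!scalemxAr !scalerA /D1 mulmxBr mulmxBl.
  rewrite -!scalemxAr -!scalemxAl !mulmxA.
  move: (v *m b^T *m b *m v^T) (v *m D *m v^T) => x y.
  by apply/matrixP => i j; rewrite !mxE; field; rewrite gt_eqF.
- pose s := Num.sqrt a; have s0 : 0 < s by rewrite sqrtr_gt0.
  have ss : s * s = a by rewrite -expr2 sqr_sqrtr // ltW.
  pose Q : 'M[R]_(1 + k) := block_mx (s%:M : 'M[R]_1) 0 (s^-1 *: b^T) P.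
  have uQ : Q \in unitmx.
    move: uP; rewrite /Q !unitmxE det_lblock unitrM => ->.
    by rewrite andbT det_scalar1 unitfE gt_eqF.
  suff QE : G' = Q *m Q^T by exists Q; [exact: uQ|exact: QE].
  rewrite GE /Q tr_block_mx mulmx_block linearZ /= trmxK trmx0 tr_scalar_mx.
  rewrite !mul0mx !mulmx0 !addr0 -PE -scalar_mxM ss; congr block_mx.
  - by rewrite mul_scalar_mx scalerA divff ?scale1r // gt_eqF.
  - by rewrite mul_mx_scalar scalerA divff ?scale1r // gt_eqF.
  - rewrite -scalemxAl -scalemxAr scalerA /D1 -invfM ss.
    by rewrite addrC subrK.
Qed.

(* [S] is conjugate to a symmetric matrix by a square root of [G]. *)
Lemma trace_sqr_ge0 (k : nat) (G S : 'M[R]_k) : G^T = G ->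
  (forall v : 'rV[R]_k, v != 0 -> 0 < (v *m G *m v^T) 0 0) ->
  S *m G = G *m S^T -> 0 <= \tr (S *m S).
Proof.
move=> Gsym Gpos SG; have [P uP GE] := posdef_factor Gsym Gpos.
pose B := invmx P *m S *m P.
have SB : S = P *m B *m invmx P by rewrite /B !mulmxA mulmxV // mul1mx mulmxK.
have Bsym : B^T = B.
  have uPT : P^T \in unitmx by rewrite unitmx_tr.
  apply: (can_inj (mulKmx uP)); apply: (can_inj (mulmxK uPT)).
  rewrite /B !trmx_mul !mulmxA mulmxV // mul1mx.
  rewrite -(mulmxA S) -GE SG GE -!mulmxA; congr (_ *m (_ *m _)).
  by rewrite trmx_inv mulVmx // mulmx1.
have -> : \tr (S *m S) = \tr (B *m B^T).
  by rewrite Bsym SB !mulmxA mulmxKV // -!mulmxA mxtrace_mulC !mulmxA mulmxKV //.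
rewrite /mxtrace sumr_ge0 // => i _; rewrite mxE sumr_ge0 // => j _.
by rewrite [B^T j i]mxE -expr2 sqr_ge0.
Qed.

(** The positivity of the trace of a square is applied to the trace-free part [S - r%:M], where [r]
    is the mean of the eigenvalues. *)
Lemma trace_sqr_ge (k : nat) (G S : 'M[R]_k) : (0 < k)%N -> G^T = G ->
  (forall v : 'rV[R]_k, v != 0 -> 0 < (v *m G *m v^T) 0 0) ->
  S *m G = G *m S^T -> (\tr S) ^+ 2 / k%:R <= \tr (S *m S).
Proof.
move=> k0 Gsym Gpos SG; have k1 : k%:R != 0 :> R by rewrite pnatr_eq0 -lt0n.
pose r := \tr S / k%:R.
have H : (S - r%:M) *m G = G *m (S - r%:M)^T.
  by rewrite linearB /= tr_scalar_mx mulmxBl mulmxBr SG mul_scalar_mx mul_mx_scalar.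
have := trace_sqr_ge0 Gsym Gpos H.
rewrite mulmxBl !mulmxBr mul_scalar_mx mul_mx_scalar -scalar_mxM !linearB /= !linearZ /=.
rewrite mxtrace_scalar -[_ *+ k]mulr_natr /GRing.scale /=.
have -> : \tr S = r * k%:R by rewrite /r mulfVK.
have -> : (r * k%:R) ^+ 2 / k%:R = r * r * k%:R by field.
lra.
Qed.

End TraceSquare.

(** * The scalar Riccati inequality *)

Section RiccatiComparison.
Context {R : realType}.

Lemma is_derive_sin_scale (om t : R) :
  is_derive t 1 (fun x : R => sin (om * x)) (om * cos (om * t)) /\
  is_derive t 1 (fun x : R => cos (om * x)) (- (om * sin (om * t))).
Proof.
have dl : is_derive t (1 : R) (fun x : R => om * x) om.
  by have := is_deriveZ om (is_derive_id t (1 : R)); rewrite /GRing.scale /= mulr1.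
split.
  by have := is_derive1_comp (is_derive_sin (om * t)) dl; rewrite mulrC.
by have := is_derive1_comp (is_derive_cos (om * t)) dl; rewrite mulNr mulrC.
Qed.

Lemma norm_sin_le (x : R) : 0 <= x -> `|sin x| <= x.
Proof.
move=> x0; have [y _] := @MVT_segment R sin cos 0 x x0 (fun y _ => is_derive_sin y)
  (continuous_subspaceT (@continuous_sin R)).
rewrite sin0 !subr0 => ->; rewrite normrM (ger0_norm x0) ler_piMl //; exact: cos_max.
Qed.

(* With [om := sqrt (kappa / k)], the function
   [u sin^2 (om t) - k om sin (om t) cos (om t)] is nonincreasing on ]0, Tst], tends
   to 0 at 0 and vanishes at [Tst]; so it is 0, and [u sin (om t) = k om cos (om t)]
   fails at [Tst]. *)
Lemma riccati_blowup (k : nat) (kappa : R) (u : R -> R) (Tst := pi * Num.sqrt (k%:R / kappa)) :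
  (0 < k)%N -> 0 < kappa ->
  (forall t, 0 < t <= Tst -> exists2 du : R, is_derive t 1 u du &
     du <= - kappa - (u t) ^+ 2 / k%:R) ->
  (exists K d, 0 < d /\ forall t, 0 < t < d -> `|t * u t| <= K) -> False.
Proof.
move=> k0 kp du_le [K [d [d0 ub]]].
have k0' : 0 < k%:R :> R by rewrite ltr0n.
pose r := Num.sqrt (k%:R / kappa); have r0 : 0 < r by rewrite sqrtr_gt0 divr_gt0.
have rr : r * r * kappa = k%:R by rewrite -expr2 sqr_sqrtr ?ltW ?divr_gt0 // divfK // gt_eqF.
pose om := r^-1; have om0 : 0 < om by rewrite invr_gt0.
have omk : k%:R * om * om = kappa.
  by rewrite -rr /om; field; rewrite gt_eqF.
have T0 : 0 < Tst by rewrite mulr_gt0 // pi_gt0.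
have omT : om * Tst = pi by rewrite /Tst -/r /om; field; rewrite gt_eqF.
pose S t : R := sin (om * t); pose C t : R := cos (om * t).
pose q : R -> R := fun t => u t * (S t * S t) - k%:R * om * (S t * C t).
have dq t : 0 < t <= Tst -> exists2 l : R, is_derive t (1 : R) q l & l <= 0.
  move=> /du_le[du dU duE]; have [dS dC] := is_derive_sin_scale om t.
  pose l := u t * (S t * (om * C t) + S t * (om * C t)) + (S t * S t) * du -
    (k%:R * om) * (S t * - (om * S t) + C t * (om * C t)).
  have dql : is_derive t (1 : R) q l :=
    is_deriveB (is_deriveM dU (is_deriveM dS dS)) (is_deriveZ (k%:R * om) (is_deriveM dS dC)).
  exists l; first exact: dql.
  have -> : l = du * (S t * S t) + u t * (2 * om * (S t * C t)) -
     kappa * (C t * C t - S t * S t).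
    by rewrite /l -omk; ring.
  have SS : 0 <= S t * S t by rewrite -expr2 sqr_ge0.
  have H := ler_wpM2r SS duE.
  (* With [kappa = k om^2] the bound on the derivative of [q] is minus a perfect square, which gives
     its sign. *)
  have E : kappa * (C t * C t) + u t ^+ 2 / k%:R * (S t * S t) - u t * (2 * om * (S t * C t)) =
      (u t * S t - k%:R * om * C t) ^+ 2 / k%:R.
    by rewrite -omk; field; rewrite gt_eqF.
  have : 0 <= (u t * S t - k%:R * om * C t) ^+ 2 / k%:R by rewrite divr_ge0 ?sqr_ge0 ?ltW.
  rewrite -E; move: H; rewrite mulrBl; move: (u t ^+ 2 / k%:R * (S t * S t)) => y; lra.
have qmono s t : 0 < s -> s <= t -> t <= Tst -> q t <= q s.
  move=> s0 st tT.
  have dqs x : s <= x <= t -> exists2 l : R, is_derive x (1 : R) q l & l <= 0.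
    move=> /andP[sx xt]; apply: dq; rewrite (lt_le_trans s0 sx) (le_trans xt tT) //.
  apply: (@ler0_derive1_nincr R q s t) => //.
  - move=> x; rewrite in_itv /= => /andP[/ltW sx /ltW xt].
    by have [|l [+ _] _] := dqs x; first by rewrite sx.
  - move=> x; rewrite in_itv /= => /andP[/ltW sx /ltW xt].
    have [|l [dx <-]] := dqs x; first by rewrite sx.
    by rewrite derive1E.
  - apply: derivable_within_continuous => x; rewrite in_itv /= => sxt.
    by have [l []] := dqs x sxt.
have qT : q Tst = 0 by rewrite /q /S omT sinpi; ring.
have K0 : 0 <= K.
  by apply: le_trans (normr_ge0 _) (ub (d / 2) _); lra.
have qsmall t : 0 < t < d -> `|q t| <= (K * om * om + k%:R * om * om) * t.
  move=> /andP[t0 td]; have omt : 0 <= om * t by rewrite mulr_ge0 // ltW.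
  have St := norm_sin_le omt; rewrite -/(S t) in St.
  (* One factor [sin (om t) / t], bounded by [om], compensates the possible blow-up of [u] at 0; the
     other makes [q] of order [t]. *)
  have E : q t = (t * u t) * (S t / t) * S t - k%:R * om * (S t * C t).
    by rewrite /q; field; rewrite gt_eqF.
  have C1 : `|C t| <= 1 := cos_max _.
  have tu : `|t * u t| <= K by apply: ub; rewrite t0.
  have Stt : `|S t / t| <= om.
    by rewrite normrM normfV (gtr0_norm t0) ler_pdivrMr.
  rewrite E (le_trans (ler_normB _ _)) // mulrDl lerD //.
    rewrite normrM (normrM (t * u t)) -[_ * om * t]mulrA.
    by apply: ler_pM => //; apply: ler_pM.
  rewrite normrM (ger0_norm (_ : 0 <= k%:R * om)); last by rewrite mulr_ge0 // ltW.
  rewrite -[_ * om * t]mulrA ler_wpM2l //; first by rewrite mulr_ge0 // ltW.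
  by rewrite normrM -[om * t]mulr1 ler_pM.
have q0 t : 0 < t <= Tst -> q t = 0.
  move=> /andP[t0 tT]; apply/eqP; rewrite eq_le; apply/andP; split; last first.
    by rewrite -qT; exact: qmono.
  rewrite leNgt; apply/negP => qt0.
  set L := K * om * om + k%:R * om * om in qsmall.
  have L0 : 0 < L by rewrite ltr_wpDl // ?mulr_gt0 // ?mulr_ge0 // ltW.
  pose s := Num.min t (Num.min (d / 2) (q t / (2 * L))).
  have s0 : 0 < s by rewrite !lt_min t0 divr_gt0 // divr_gt0 // mulr_gt0.
  have sd : 0 < s < d.
    by rewrite s0 /s !gt_min; apply/orP; right; apply/orP; left; lra.
  have st : s <= t by rewrite ge_min lexx.
  have := qmono s t s0 st tT; have := qsmall s sd; rewrite ler_norml => /andP[_ h1] h2.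
  have : L * s <= q t / 2.
    have : s <= q t / (2 * L) by rewrite !ge_min lexx !orbT.
    rewrite ler_pdivlMr ?mulr_gt0 //; lra.
  lra.
have cont : {for Tst, continuous (fun t => u t * S t - k%:R * om * C t)}.
  have [du dU _] : exists2 du : R, is_derive Tst 1 u du & du <= - kappa - (u Tst) ^+ 2 / k%:R.
    by apply: du_le; rewrite T0 lexx.
  have [dS dC] := is_derive_sin_scale om Tst.
  have := is_deriveB (is_deriveM dU dS) (is_deriveZ (k%:R * om) dC).
  by move=> [/derivable1_diffP/differentiable_continuous].
have zero t : 0 < t < Tst -> u t * S t - k%:R * om * C t = 0.
  move=> /andP[t0 tT].
  have S0 : 0 < S t.
    by apply: sin_gt0_pi; rewrite mulr_gt0 //= -omT ltr_pM2l.
  apply: (mulfI (lt0r_neq0 S0)); rewrite mulr0 -(q0 t); last by rewrite t0 ltW.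
  by rewrite /q; ring.
have v0 : 0 < k%:R * om by rewrite mulr_gt0.
have fT : u Tst * S Tst - k%:R * om * C Tst = k%:R * om.
  by rewrite /S /C omT sinpi cospi; ring.
move: cont => /cvgrPdist_lt/(_ _ v0)/nbhs_dist[e e0 He].
pose y := Tst - Num.min (e / 2) (Tst / 2).
have m0 : 0 < Num.min (e / 2) (Tst / 2) by rewrite lt_min !divr_gt0.
have [m1 m2] : Num.min (e / 2) (Tst / 2) <= e / 2 /\ Num.min (e / 2) (Tst / 2) <= Tst / 2.
  by rewrite !ge_min !lexx orbT.
have ye : `|y - Tst| < e by rewrite /y ltr_norml; lra.
have yT : 0 < y < Tst by rewrite /y; lra.
by have := He y ye; rewrite fT zero // subr0 gtr0_norm // ltxx.
Qed.

End RiccatiComparison.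

Lemma hdw_lsubmx (R : realType) (k p q : nat) (A : set R) (f : R -> 'M[R]_(k, p + q)) t df :
  has_deriv_within A f t df -> has_deriv_within A (fun s => lsubmx (f s)) t (lsubmx df).
Proof.
move=> H; apply: hdw_mx => i j; rewrite mxE; apply: hdw_near (hdw_entry H); last by rewrite mxE.
by apply: (@filterE _ (nbhs t)) => s _; rewrite mxE.
Qed.

Lemma hdw_rsubmx (R : realType) (k p q : nat) (A : set R) (f : R -> 'M[R]_(k, p + q)) t df :
  has_deriv_within A f t df -> has_deriv_within A (fun s => rsubmx (f s)) t (rsubmx df).
Proof.
move=> H; apply: hdw_mx => i j; rewrite mxE; apply: hdw_near (hdw_entry H); last by rewrite mxE.
by apply: (@filterE _ (nbhs t)) => s _; rewrite mxE.
Qed.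

(** * Coordinates of a fixed family of vectors in a moving frame *)

Section JacobiCoordinates.
Context {R : realType} {m n k : nat}.
Implicit Types (t : R) (w z : R -> 'M[R]_(m, n)) (p l dl : R -> 'M[R]_m).

(* [w0 = jalpha *m w + jbeta *m h], where [h := z - 2^-1 *: (l *m w)] spans the
   horizontal space. *)
Definition coord_mx (w0 : 'M[R]_(k, n)) w z (s : R) : 'M[R]_(k, m + m) :=
  w0 *m pinvmx (col_mx (w s) (z s)).
Definition jbeta (w0 : 'M[R]_(k, n)) w z s : 'M[R]_(k, m) := rsubmx (coord_mx w0 w z s).
Definition jalpha (w0 : 'M[R]_(k, n)) w z l s : 'M[R]_(k, m) :=
  lsubmx (coord_mx w0 w z s) + 2^-1 *: (jbeta w0 w z s *m l s).

Lemma coord_mxE (w0 : 'M[R]_(k, n)) w z l s : (w0 <= col_mx (w s) (z s))%MS ->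
  w0 = jalpha w0 w z l s *m w s + jbeta w0 w z s *m (z s - 2^-1 *: (l s *m w s)).
Proof.
move=> /mulmxKpV {1}<-; rewrite -/(coord_mx w0 w z s) -[coord_mx _ _ _ _ in LHS]hsubmxK.
rewrite mul_row_col /jalpha /jbeta mulmxDl mulmxBr -scalemxAl -scalemxAr !mulmxA.
by rewrite addrACA subrr addr0.
Qed.

Lemma coord_mx_unique (w0 : 'M[R]_(k, n)) w z (l : R -> 'M[R]_m) s (a b : 'M[R]_(k, m)) :
  row_free (col_mx (w s) (z s)) ->
  w0 = a *m w s + b *m (z s - 2^-1 *: (l s *m w s)) ->
  jalpha w0 w z l s = a /\ jbeta w0 w z s = b.
Proof.
move=> fr E.
have E' : w0 = row_mx (a - 2^-1 *: (b *m l s)) b *m col_mx (w s) (z s).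
  rewrite mul_row_col E mulmxBl mulmxBr -scalemxAl -scalemxAr !mulmxA.
  by rewrite addrAC -!addrA.
have -> : jbeta w0 w z s = b by rewrite /jbeta /coord_mx E' mulmxKp // row_mxKr.
split=> //; rewrite /jalpha /jbeta /coord_mx E' mulmxKp // row_mxKl row_mxKr subrK //.
Qed.

(** The coordinates times the moving frame is the constant [w0], so the derivative of this product
    vanishes, and freeness identifies the derivatives of the coordinates. The set [A] allows the use
    at the end point 0. *)
Lemma coord_mx_deriv (A : set R) (w0 : 'M[R]_(k, n)) w z p l t : ProperFilter (within A t^') ->
  row_free (col_mx (w t) (z t)) -> has_deriv_within A w t (z t) ->
  has_deriv_within A z t (p t *m w t + l t *m z t) ->
  (\forall s \near t, A s -> (w0 <= col_mx (w s) (z s))%MS) -> (w0 <= col_mx (w t) (z t))%MS ->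
  has_deriv_within A (fun s => lsubmx (coord_mx w0 w z s)) t (- (jbeta w0 w z t *m p t)) /\
  has_deriv_within A (jbeta w0 w z) t
    (- lsubmx (coord_mx w0 w z t) - jbeta w0 w z t *m l t).
Proof.
move=> PF fr dw dz sub subt.
have dG := hdw_col_mx dw dz.
have nE : \forall s \near t, A s -> w0 = coord_mx w0 w z s *m col_mx (w s) (z s).
  by apply: filterS sub => s h /h /mulmxKpV.
have tE : w0 = coord_mx w0 w z t *m col_mx (w t) (z t) by rewrite mulmxKpV.
have [dC HdC] := hdw_coef_within dG (hdw_cst A w0 t) fr nE tE.
have dl : has_deriv_within A (fun s => lsubmx (coord_mx w0 w z s)) t (lsubmx dC).
  exact: hdw_lsubmx HdC.
have dr : has_deriv_within A (jbeta w0 w z) t (rsubmx dC) := hdw_rsubmx HdC.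
have D := hdw_mulmx HdC dG; have {}D : 0 = dC *m col_mx (w t) (z t) +
    coord_mx w0 w z t *m col_mx (z t) (p t *m w t + l t *m z t).
  apply: (hdw_unique_within PF (hdw_cst A w0 t)); apply: hdw_near D => //.
  by apply: filterS nE => s h As; rewrite -h.
rewrite -[dC]hsubmxK -[coord_mx _ _ _ _]hsubmxK !mul_row_col -/(jbeta w0 w z t) in D.
set a := lsubmx (coord_mx w0 w z t) in D *; set b := jbeta w0 w z t in D *.
have : lsubmx dC *m w t + rsubmx dC *m z t =
    (- (b *m p t)) *m w t + (- a - b *m l t) *m z t.
  move/esym/eqP: D; rewrite addr_eq0 => /eqP ->; rewrite mulmxBl !mulNmx mulmxDr !mulmxA.
  move: (a *m _) (b *m p t *m _) (b *m l t *m _) => *.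
  by apply/matrixP => i j; rewrite !mxE; ring.
by case/(row_free_col_mx_inj fr) => <- <-.
Qed.

Lemma proper_withinT (t : R) : ProperFilter (within setT t^').
Proof.
have -> : within setT t^' = t^'.
  by rewrite predeqE => P; rewrite /within /=; split; apply: filterS => s; auto.
exact: (Proper_dnbhs_numFieldType t).
Qed.

(** Passing from [z] to its horizontal part replaces [p] by the curvature and leaves [l] only in the
    same right multiplication by [- l / 2] in both equations. *)
Lemma jacobi_deriv (w0 : 'M[R]_(k, n)) w z p l dl t :
  (\forall s \near t, (w0 <= col_mx (w s) (z s))%MS) -> jacobi_frame w z p l dl t ->
  has_deriv_within setT (jalpha w0 w z l) t
    (jbeta w0 w z t *m frame_curv p l dl t - 2^-1 *: (jalpha w0 w z l t *m l t)) /\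
  has_deriv_within setT (jbeta w0 w z) t
    (- jalpha w0 w z l t - 2^-1 *: (jbeta w0 w z t *m l t)).
Proof.
move=> sub [fr dw dz dl'].
have sub' : \forall s \near t, setT s -> (w0 <= col_mx (w s) (z s))%MS.
  by apply: filterS sub.
have [da db] := coord_mx_deriv (proper_withinT t) fr dw dz sub' (nbhs_singleton sub).
have dA := hdwD da (hdwZ (c := 2^-1) (hdw_mulmx db dl')).
rewrite /frame_curv /jalpha.
set a := lsubmx (coord_mx w0 w z t) in da db dA *; set b := jbeta w0 w z t in da db dA *.
split.
  suff <- : - (b *m p t) + 2^-1 *: ((- a - b *m l t) *m l t + b *m dl t) =
     b *m (- p t + 2^-1 *: dl t - 4^-1 *: (l t *m l t)) -
     2^-1 *: ((a + 2^-1 *: (b *m l t)) *m l t) by exact: dA.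
  rewrite !(mulmxBl, mulmxBr, mulmxDl, mulmxDr, mulNmx, mulmxN) -!(scalemxAl, scalemxAr) !mulmxA.
  move: (b *m p t) (b *m l t *m l t) (b *m dl t) (a *m l t) => *.
  by apply/matrixP => i j; rewrite !mxE; lra.
suff <- : - a - b *m l t = - (a + 2^-1 *: (b *m l t)) - 2^-1 *: (b *m l t) by exact: db.
move: (b *m l t) => x; by apply/matrixP => i j; rewrite !mxE; lra.
Qed.

End JacobiCoordinates.

Section JacobiIdentities.
Context {R : realType} {m k : nat}.

(** [dG] is the derivative of the Gram matrix of a parallel metric: it cancels the terms in [l]. The
    terms in [K] cancel because [K] is self-adjoint, and the two terms [a G a^T] cancel each
    other. *)
Lemma wronskian_algebra (a b : 'M[R]_(k, m)) (G l K : 'M[R]_m) : K *m G = G *m K^T ->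
  let da := b *m K - 2^-1 *: (a *m l) in let db := - a - 2^-1 *: (b *m l) in
  let dG := 2^-1 *: (l *m G + G *m l^T) in
  (db *m G + b *m dG) *m a^T + b *m G *m da^T - ((da *m G + a *m dG) *m b^T + a *m G *m db^T)
  = 0.
Proof.
move=> KG da db dG.
have da' : da^T = K^T *m b^T - 2^-1 *: (l^T *m a^T).
  by rewrite /da raddfB /= linearZ /= !trmx_mul.
have db' : db^T = - a^T - 2^-1 *: (l^T *m b^T).
  by rewrite /db raddfB raddfN /= linearZ /= trmx_mul.
have KG' : b *m K *m G *m b^T = b *m G *m K^T *m b^T by rewrite -(mulmxA b K) KG mulmxA.
rewrite da' db' /da /db /dG.
rewrite !(mulmxBl, mulmxBr, mulmxDl, mulmxDr, mulNmx, mulmxN) -!(scalemxAl, scalemxAr).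
rewrite !(mulmxDl, mulmxDr) !mulmxA KG'.
by apply/matrixP => i j; rewrite !mxE; lra.
Qed.

(** The left side is the trace of the derivative of [S]. The terms in [l] form a commutator and
    disappear under the trace. *)
Lemma riccati_algebra (a b l K : 'M[R]_m) : b \in unitmx ->
  let da := b *m K - 2^-1 *: (a *m l) in let db := - a - 2^-1 *: (b *m l) in
  let S := - (invmx b *m a) in
  \tr (- (- (invmx b *m db *m invmx b) *m a + invmx b *m da)) = - \tr K - \tr (S *m S).
Proof.
move=> ub da db S.
have -> : - (invmx b *m db *m invmx b) *m a =
    invmx b *m a *m invmx b *m a + 2^-1 *: (l *m invmx b *m a).
  rewrite /db mulmxBr mulmxN -scalemxAr mulKmx // !(mulmxBl, mulNmx) -!scalemxAl.
  by rewrite opprB opprK addrC.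
have -> : invmx b *m da = K - 2^-1 *: (invmx b *m a *m l).
  by rewrite /da mulmxBr mulKmx // -scalemxAr mulmxA.
have -> : S *m S = invmx b *m a *m invmx b *m a by rewrite /S mulNmx mulmxN opprK !mulmxA.
rewrite raddfN /= !raddfD /= raddfN /= !mxtraceZ -(mulmxA l) (mxtrace_mulC l).
lra.
Qed.

Lemma wronskian_deriv (a b : R -> 'M[R]_(k, m)) (G l : R -> 'M[R]_m) (K : 'M[R]_m) t :
  has_deriv_within setT a t (b t *m K - 2^-1 *: (a t *m l t)) ->
  has_deriv_within setT b t (- a t - 2^-1 *: (b t *m l t)) ->
  has_deriv_within setT G t (2^-1 *: (l t *m G t + G t *m (l t)^T)) ->
  K *m G t = G t *m K^T ->
  has_deriv_within setT (fun s => b s *m G s *m (a s)^T - a s *m G s *m (b s)^T) t 0.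
Proof.
move=> da db dG KG; rewrite -(wronskian_algebra (a t) (b t) (l t) KG).
exact: (hdwD (hdw_mulmx (hdw_mulmx db dG) (hdw_tr da))
  (hdwN (hdw_mulmx (hdw_mulmx da dG) (hdw_tr db)))).
Qed.

Lemma riccati_deriv (a b : R -> 'M[R]_m) (l : R -> 'M[R]_m) (K : 'M[R]_m) t
    (S := fun s => - (invmx (b s) *m a s)) : b t \in unitmx ->
  has_deriv_within setT a t (b t *m K - 2^-1 *: (a t *m l t)) ->
  has_deriv_within setT b t (- a t - 2^-1 *: (b t *m l t)) ->
  has_deriv_within setT (fun s => \tr (S s) : R^o) t (- \tr K - \tr (S t *m S t) : R^o).
Proof.
move=> ub da db; rewrite -(riccati_algebra (a t) (l t) K ub).
exact: (hdw_trace (hdwN (hdw_mulmx (hdw_invmx ub db) da))).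
Qed.

Lemma wronskian_symmetric (a b G : 'M[R]_m) (S := - (invmx b *m a)) : b \in unitmx ->
  b *m G *m a^T = a *m G *m b^T -> S *m G = G *m S^T.
Proof.
move=> ub H; have ubT : b^T \in unitmx by rewrite unitmx_tr.
rewrite /S mulNmx linearN /= mulmxN trmx_mul trmx_inv; congr (- _).
apply: (can_inj (mulKmx ub)); apply: (can_inj (mulmxK ubT)).
by rewrite !mulmxA mulmxV // mul1mx mulmxKV.
Qed.

End JacobiIdentities.

Lemma hdw_mulmx_cst (R : realType) (k l q : nat) (A : set R) (G : R -> 'M[R]_(k, l))
    (B : 'M[R]_k) (C : 'M[R]_(l, q)) t :
  has_deriv_within A G t (B *m G t) ->
  has_deriv_within A (fun s => G s *m C) t (B *m (G t *m C)).
Proof. by move=> dG; have := hdw_mulmx dG (hdw_cst A C t); rewrite mulmx0 addr0 mulmxA. Qed.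

(* Gronwall's inequality for [G *m cokermx (G s)], which vanishes at [s]. *)
Lemma linear_ode_submx (R : realType) (k l : nat) (G : R -> 'M[R]_(k, l)) (A : R -> 'M[R]_k)
    (K s t : R) : 0 <= K -> s <= t -> k%:R * K * (t - s) <= 2^-1 ->
  (forall u, s <= u <= t ->
     has_deriv_within [set v | s <= v <= t] G u (A u *m G u) /\ `|A u| <= K) ->
  (G t <= G s)%MS.
Proof.
move=> K0 st Kst H; pose C := cokermx (G s); pose f u := G u *m C.
have df u : s <= u <= t -> has_deriv_within [set v | s <= v <= t] f u (A u *m f u).
  by move=> /H[dG _]; exact: hdw_mulmx_cst.
have tt : s <= t <= t by rewrite st lexx.
have ss : s <= s <= t by rewrite lexx.
have : `|f t| <= 2 * `|f s| + 2 * (t - s) * 0.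
  apply: (gronwall_short (mulr_ge0 (ler0n _ k) K0) (lexx 0) Kst (df := fun u => A u *m f u)) => //.
  - move=> u sut; have /df dfu : s <= u <= t by case/andP: sut => *; rewrite !ltW.
    apply: hdw_interior dfu.
    have := @near_in_itvoo R s t u; rewrite in_itv /= sut => /(_ isT).
    by apply: filterS => v; rewrite in_itv /= => /andP[? ?]; rewrite /= !ltW.
  - move=> u sut; have /H[_ AK] : s <= u <= t by case/andP: sut => *; rewrite !ltW.
    by rewrite addr0 (le_trans (mx_norm_mul _ _)) // ler_wpM2r // ler_wpM2l.
  - apply: (hdw_within_continuous (df := fun u => A u *m f u)) => u /=.
    rewrite in_itv /= => /df dfu; by apply: hdw_sub dfu; apply: (@filterE _ (nbhs u)) => v /=; rewrite in_itv.
have -> : f s = 0 by rewrite /f /C mulmx_coker.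
by rewrite normr0 !mulr0 addr0 normr_le0 submxE.
Qed.

Lemma near_norm_bounded (R : realType) (E : normedModType R) (A : set R) (f : R -> E) t l :
  has_deriv_within A f t l -> \forall s \near t, A s -> `|f s| <= `|f t| + 1.
Proof.
move=> /hdw_within_cvg/cvgrPdist_le/(_ 1 ltr01) H.
have {}H : nbhs t (fun s => A s -> `|f t - f s| <= 1) := H.
apply: filterS H => s h /h H1; rewrite addrC -lerBlDr.
by rewrite (le_trans (ler_norm _)) // (le_trans (ler_dist_dist _ _)) // distrC.
Qed.

Lemma norm_block_le (R : realType) (m : nat) (p l : 'M[R]_m) (K : R) :
  1 <= K -> `|p| <= K -> `|l| <= K ->
  `|block_mx 0 1%:M p l : 'M[R]_(m + m)| <= K.
Proof.
move=> K1 pK lK; have K0 : 0 <= K by exact: le_trans K1.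
apply: mx_norm_leP => // i j.
case: (split_ordP i) => i' ->; case: (split_ordP j) => j' ->.
- by rewrite block_mxEul mxE normr0.
- rewrite block_mxEur mxE; case: (_ == _); rewrite ?normr1 //.
  by rewrite normr0.
- by rewrite block_mxEdl (le_trans (mx_entry_le _ _ _)).
- by rewrite block_mxEdr (le_trans (mx_entry_le _ _ _)).
Qed.

Lemma submx_rank_eq (F : fieldType) (p q r : nat) (A : 'M[F]_(p, r)) (B : 'M[F]_(q, r)) :
  (A <= B)%MS -> \rank A = \rank B -> (B <= A)%MS.
Proof. by move=> AB rAB; have [_ <-] := mxrank_leqif_sup AB; rewrite rAB. Qed.

Lemma row_mul_entry (R : comPzRingType) (p q r : nat) (A : 'M[R]_(p, q)) (C : 'M[R]_(r, q)) i j :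
  (row i A *m (row j C)^T) 0 0 = (A *m C^T) i j.
Proof. by rewrite !mxE; apply: eq_bigr => k _; rewrite !mxE. Qed.

Lemma form_entryl (R : comPzRingType) (p q : nat) (A : 'M[R]_(p, q)) (G : 'M[R]_q) i j :
  (row i A *m G *m (delta_mx 0 j : 'rV[R]_q)^T) 0 0 = (A *m G) i j.
Proof. by rewrite -row_mul -[delta_mx 0 j]mulmx1 -rowE row_mul_entry trmx1 mulmx1. Qed.

Lemma form_entryr (R : comPzRingType) (p q : nat) (A : 'M[R]_(p, q)) (G : 'M[R]_q) i j :
  ((delta_mx 0 i : 'rV[R]_q) *m G *m (row j A)^T) 0 0 = (G *m A^T) i j.
Proof. by rewrite -rowE row_mul_entry. Qed.

Lemma combination_change (R : pzRingType) (k m n : nat) (A : 'M[R]_(k, n)) (a b : 'M[R]_(k, m))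
    (w h w' h' : 'M[R]_(m, n)) (C : 'M[R]_m) :
  A = a *m w + b *m h -> w = C *m w' -> h = C *m h' ->
  A = (a *m C) *m w' + (b *m C) *m h'.
Proof. by move=> -> -> ->; rewrite !mulmxA. Qed.

Lemma cvg_mxtrace (R : realType) (T : Type) (F : set_system T) {FF : Filter F} (k : nat)
    (f : T -> 'M[R]_k) (A : 'M[R]_k) :
  f @ F --> A -> (\tr (f x) : R^o) @[x --> F] --> (\tr A : R^o).
Proof.
move=> fA; rewrite /mxtrace; apply: cvg_big => [|i _]; first exact: add_continuous.
exact: cvg_mx_entry.
Qed.

Lemma short_interval (R : realType) (K tau s t : R) : 0 <= K ->
  `|s - tau| < (4 * (K + 1))^-1 -> `|t - tau| < (4 * (K + 1))^-1 -> K * (t - s) <= 2^-1.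
Proof.
move=> K0; have K1 : 0 < 4 * (K + 1) by rewrite mulr_gt0 // ltr_wpDl.
rewrite !ltr_norml => /andP[s1 _] /andP[_ t1].
have : t - s <= 2 * (4 * (K + 1))^-1 by lra.
by rewrite ler_pdivlMr //; nra.
Qed.

(** * The flow along an integral curve *)

Section Curves.
Context {R : realType} {n : nat} {M : manifold R n}.
Implicit Types (e : chart R n M) (p : M) (X : M -> 'rV[R]_n) (A B C : set R) (c : R -> M).

(** The pointwise form of [integral_curve], which can be restricted, shifted and glued time by
    time. *)
Definition integral_curve_at X A c t :=
  c @ within A (nbhs t) --> c t /\
  has_deriv_within A (ccoord (chart_at (c t)) \o c) t (X (c t)).

Lemma integral_curveP X A c :
  integral_curve X A c <-> forall t, A t -> integral_curve_at X A c t.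
Proof.
split=> [[/subspace_continuousP cc dc] t At|H].
  by split; [exact: cc|exact: dc].
by split; [apply/subspace_continuousP => t /H[]|move=> t /H[]].
Qed.

Lemma integral_curve_at_near X A c c' t :
  (\forall s \near t, A s -> c s = c' s) -> c t = c' t ->
  integral_curve_at X A c t -> integral_curve_at X A c' t.
Proof.
move=> cc' ct [cc dc]; split; first exact: within_cvg_near cc.
rewrite -ct; apply: hdw_near dc; last by rewrite /= ct.
by apply: filterS cc' => s h /h /= ->.
Qed.

Lemma integral_curve_at_union X A B C c t :
  (\forall s \near t, C s -> A s \/ B s) ->
  integral_curve_at X A c t -> integral_curve_at X B c t -> integral_curve_at X C c t.
Proof.
move=> CAB [cA dA] [cB dB]; split; last exact: hdw_union CAB dA dB.
move=> P Pt.
have HA : nbhs t (fun s => A s -> P (c s)) := cA P Pt.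
have HB : nbhs t (fun s => B s -> P (c s)) := cB P Pt.
suff : nbhs t (fun s => C s -> P (c s)) by [].
by apply: filterS3 CAB HA HB => s h hA hB /h[/hA|/hB].
Qed.

Lemma integral_curve_at_sub X A B c t : (\forall s \near t, B s -> A s) ->
  integral_curve_at X A c t -> integral_curve_at X B c t.
Proof.
move=> BA H; apply: (integral_curve_at_union _ H H).
by apply: filterS BA => s h /h; left.
Qed.

Lemma integral_curve_at_shift X A B c t k :
  (\forall s \near t, B s -> A (s - k)) ->
  integral_curve_at X A c (t - k) -> integral_curve_at X B (fun s => c (s - k)) t.
Proof.
move=> BA [cA dA]; split; last first.
  exact: (hdw_shift (f := ccoord (chart_at (c (t - k))) \o c) BA dA).
move=> P Pt.
have HA : nbhs (t - k) (fun s => A s -> P (c s)) := cA P Pt.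
suff : nbhs t (fun s => B s -> P (c (s - k))) by [].
have cc : (fun s : R => s - k) @ t --> t - k.
  by apply: cvgB; [exact: cvg_id|exact: cvg_cst].
have HA' : nbhs t (fun s => A (s - k) -> P (c (s - k))) := cc _ HA.
by apply: filterS2 BA HA' => s h hA /h/hA.
Qed.

Lemma integral_curve_at_chart X A c t e : integral_curve_at X A c t ->
  atlas e -> cdom e (c t) ->
  has_deriv_within A (ccoord e \o c) t (field_rep e X (ccoord e (c t))).
Proof.
move=> [cc dc] ae ect; set e0 := chart_at (c t) in dc *.
have ae0 : atlas e0 := chart_at_atlas (c t); have e0c : cdom e0 (c t) := chart_at_dom (c t).
have dphi := transition_differentiable ae0 ae e0c ect.
have H := hdw_comp dc dphi.
have HE : 'd (ccoord e \o param e0) (ccoord e0 (c t)) (X (c t)) =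
    field_rep e X (ccoord e (c t)).
  by rewrite (field_repE X ae ect) -tcoordE.
move: H; rewrite /comp /= HE; apply: hdw_near; last by rewrite paramK.
have : nbhs t (fun s => A s -> cdom e0 (c s)) := cc _ (cdom_near ae0 e0c).
by apply: filterS => s h As; rewrite paramK //; exact: h.
Qed.

Lemma integral_curve_at_param X A (y : R -> 'rV[R]_n) t e : atlas e ->
  cimage e setT (y t) -> has_deriv_within A y t (field_rep e X (y t)) ->
  integral_curve_at X A (param e \o y) t.
Proof.
move=> ae yt dy; have [ep _ yE] := cimage_param ae yt; set p := param e (y t) in ep yE.
split.
  exact: (cvg_comp _ _ (hdw_within_cvg dy) (param_continuous ae yt)).
set e0 := chart_at _.
have ae0 : atlas e0 := chart_at_atlas p; have e0c : cdom e0 p := chart_at_dom p.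
have dphi := transition_differentiable ae ae0 ep e0c; rewrite yE in dphi.
have := hdw_comp dy dphi.
suff -> : 'd (ccoord e0 \o param e) (y t) (field_rep e X (y t)) = X (param e (y t)) by [].
have := field_rep_change X ae ae0 ep e0c.
by rewrite trans_mxE yE field_rep_chart_at => ->.
Qed.

Lemma chart_curve_near A c t e r : c @ within A (nbhs t) --> c t ->
  atlas e -> cdom e (c t) -> 0 < r ->
  exists2 d, 0 < d & forall s, A s -> `|s - t| < d ->
    cdom e (c s) /\ `|ccoord e (c s) - ccoord e (c t)| < r.
Proof.
move=> cc ae ect r0.
have n2 : \forall p \near c t, `|ccoord e p - ccoord e (c t)| < r.
  have := ccoord_continuous ae ect => /cvgrPdistC_lt; exact.
have : nbhs t (fun s => A s -> cdom e (c s) /\ `|ccoord e (c s) - ccoord e (c t)| < r).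
  exact: (cc _ (filterI (cdom_near ae ect) n2)).
by move=> /nbhs_dist[d d0 H]; exists d => // s As sd; exact: H.
Qed.

Lemma integral_curve_unique X a c1 c2 : smooth_field setT X ->
  integral_curve X [set s | 0 <= s <= a] c1 ->
  integral_curve X [set s | 0 <= s <= a] c2 -> c1 0 = c2 0 ->
  forall t, 0 <= t <= a -> c1 t = c2 t.
Proof.
move=> sX /integral_curveP h1 /integral_curveP h2 c0 b /andP[b0 ba].
set A := [set s | 0 <= s <= a] in h1 h2.
apply: (@interval_step_induction _ (fun t => c1 t = c2 t) b b0 c0).
move=> tau /andP[tau0 taub].
have Atau : A tau by rewrite /A /= tau0 (le_trans taub ba).
have [cc1 _] := h1 tau Atau; have [cc2 _] := h2 tau Atau.
(* If the curves differ at [tau], they remain in disjoint open sets nearby, so the premise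
   [c1 s = c2 s] is never met. If they agree there, both stay in one chart and Gronwall applies. *)
have [E|/eqP ne] := pselect (c1 tau = c2 tau); last first.
  have := @points_hausdorff _ _ M; rewrite open_hausdorff => /(_ _ _ ne).
  move=> [[B1 B2] /= [/set_mem B1t /set_mem B2t] [oB1 oB2 B12]].
  have H1 : nbhs tau (fun s => A s -> B1 (c1 s)) := cc1 _ (open_nbhs_nbhs (conj oB1 B1t)).
  have H2 : nbhs tau (fun s => A s -> B2 (c2 s)) := cc2 _ (open_nbhs_nbhs (conj oB2 B2t)).
  have [d d0 H] := nbhs_dist (filterI H1 H2).
  exists d => // s t s0 st tb sd td cs.
  have [P1 P2] := H s sd.
  have As : A s by rewrite /A /= s0 (le_trans st) // (le_trans tb).
  have : (B1 `&` B2) (c1 s) by split; [exact: P1|rewrite cs; exact: P2].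
  by move/eqP: B12 => ->.
set q := c1 tau in cc1 E *; pose e := chart_at q.
have ae : atlas e := chart_at_atlas q; have eq : cdom e q := chart_at_dom q.
have oi : open (cimage e setT) by apply: open_cimage => //; exact: openT.
have [r [K [r0 K0 lip]]] := smooth_local_lipschitz oi (field_rep_smooth ae sX)
  (cimage_ccoord eq (I : setT q)).
have [d1 d10 D1] := chart_curve_near cc1 ae eq r0.
have [d2 d20 D2] : exists2 d, 0 < d & forall s, A s -> `|s - tau| < d ->
    cdom e (c2 s) /\ `|ccoord e (c2 s) - ccoord e q| < r.
  have e2t : cdom e (c2 tau) by rewrite -E.
  by have := chart_curve_near cc2 ae e2t r0; rewrite -E.
pose d := Num.min (Num.min d1 d2) (4 * (K + 1))^-1.
have K1 : 0 < 4 * (K + 1) by rewrite mulr_gt0 // ltr_wpDl.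
exists d; first by rewrite !lt_min d10 d20 invr_gt0.
move=> s t s0 st tb; rewrite !lt_min => /andP[/andP[s1 s2] sK] /andP[/andP[t1 t2] tK] cs.
have IA u : s <= u <= t -> A u.
  by move=> /andP[su ut]; rewrite /A /= (le_trans s0 su) (le_trans ut) // (le_trans tb).
have ID u k : s <= u <= t -> `|s - tau| < k -> `|t - tau| < k -> `|u - tau| < k.
  by move=> /andP[su ut]; rewrite !ltr_norml; lra.
pose f u := ccoord e (c1 u) - ccoord e (c2 u).
pose df u := field_rep e X (ccoord e (c1 u)) - field_rep e X (ccoord e (c2 u)).
have fd u : s <= u <= t -> has_deriv_within A f u (df u).
  move=> ust; have Au := IA u ust.
  have [e1 _] := D1 u Au (ID u _ ust s1 t1); have [e2 _] := D2 u Au (ID u _ ust s2 t2).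
  apply: hdwD; first exact: (integral_curve_at_chart (h1 u Au) ae e1).
  exact: hdwN (integral_curve_at_chart (h2 u Au) ae e2).
have fK u : s <= u <= t -> `|df u| <= K * `|f u| + 0.
  move=> ust; have Au := IA u ust; rewrite addr0.
  have [_ b1] := D1 u Au (ID u _ ust s1 t1); have [_ b2] := D2 u Au (ID u _ ust s2 t2).
  by have [_ _ /(_ _ b1)[]] := lip _ b2.
have Kst : K * (t - s) <= 2^-1 by exact: short_interval K0 sK tK.
have ss : s <= s <= t by rewrite lexx.
have tt : s <= t <= t by rewrite st lexx.
have [e1 _] := D1 t (IA t tt) t1; have [e2 _] := D2 t (IA t tt) t2.
have : `|f t| <= 2 * `|f s| + 2 * (t - s) * 0.
  apply: (gronwall_short K0 (lexx 0) Kst (df := df)) => //.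
  - move=> u /andP[su ut].
    have ust : s <= u <= t by rewrite !ltW.
    apply: hdw_interior (fd u ust).
    have := @near_in_itvoo R s t u; rewrite in_itv /= su ut => /(_ isT).
    by apply: filterS => v; rewrite in_itv /= => /andP[? ?]; apply: IA; rewrite !ltW.
  - by move=> u /andP[/ltW su /ltW ut]; apply: fK; rewrite su.
  - apply: (hdw_within_continuous (df := df)) => u /=; rewrite in_itv /= => ust.
    apply: hdw_sub (fd u ust); apply: (@filterE _ (nbhs u)) => v /=; rewrite in_itv /=; exact: IA.
rewrite /f cs subrr normr0 !mulr0 addr0 normr_le0 subr_eq0 => /eqP /(congr1 (param e)).
by rewrite !paramK.
Qed.

Lemma integral_curve_cat X s t c1 c2 : 0 <= s <= t ->
  integral_curve X [set u | 0 <= u <= s] c1 ->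
  integral_curve X [set u | 0 <= u <= t - s] c2 -> c1 s = c2 0 ->
  integral_curve X [set u | 0 <= u <= t] (fun u => if u <= s then c1 u else c2 (u - s)).
Proof.
move=> /andP[s0 st] /integral_curveP h1 /integral_curveP h2 c12.
set h := (X in integral_curve _ _ X).
have hL u : 0 <= u <= s -> integral_curve_at X [set u | 0 <= u <= s] h u.
  move=> us; apply: integral_curve_at_near (h1 u us); last first.
    by rewrite /h; case/andP: us => _ ->.
  by apply: (@filterE _ (nbhs u)) => v /= /andP[_ vs]; rewrite /h vs.
have hR u : s <= u <= t -> integral_curve_at X [set u | s <= u <= t] h u.
  move=> ut.
  have hE v : s <= v -> c2 (v - s) = h v.
    rewrite /h; case: (ltgtP v s) => // -> _; by rewrite subrr.
  have us : 0 <= u - s <= t - s by lra.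
  have H : integral_curve_at X [set u | s <= u <= t] (fun v => c2 (v - s)) u.
    apply: integral_curve_at_shift (h2 _ us).
    by apply: (@filterE _ (nbhs u)) => v /=; lra.
  apply: integral_curve_at_near H; last by apply: hE; case/andP: ut.
  by apply: (@filterE _ (nbhs u)) => v /= /andP[sv _]; exact: hE.
apply/integral_curveP => u /= /andP[u0 ut].
case: (ltgtP u s) => us.
- have us' : 0 <= u <= s by rewrite u0 ltW.
  apply: integral_curve_at_sub (hL u us').
  have := lt_nbhsl us; apply: filterS => v /= vs /andP[-> _].
  by rewrite ltW.
- have us' : s <= u <= t by rewrite ut ltW.
  apply: integral_curve_at_sub (hR u us').
  have := lt_nbhsr us; apply: filterS => v /= vs /andP[_ ->].
  by rewrite ltW.
- have u1 : 0 <= u <= s by rewrite u0 us lexx.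
  have u2 : s <= u <= t by rewrite us lexx.
  apply: integral_curve_at_union (hL u u1) (hR u u2).
  apply: (@filterE _ (nbhs u)) => v /= /andP[-> ->].
  by case: (leP v s) => [_|/ltW ->]; [left|right].
Qed.

(** By uniqueness of integral curves, the choice made in [flow] has no effect. *)
Lemma flow_eq X t c : smooth_field setT X -> 0 <= t ->
  integral_curve X [set s | 0 <= s <= t] c -> flow X t (c 0) = c t.
Proof.
move=> sX t0 cc; rewrite /flow; set S := [set q | _].
have : S (xget (c 0) S) by apply: xgetI; exists c.
move=> [c' [cc' c'0 c't]]; rewrite -c't.
by apply: (integral_curve_unique sX cc' cc c'0); rewrite t0 lexx.
Qed.

(** Membership in the domain of the flow at time [t], recorded separately because [flow] is
    total. *)
Definition reaches X t p := exists2 c, integral_curve X [set s | 0 <= s <= t] c & c 0 = p.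

Lemma reaches_cat X s t p : smooth_field setT X -> 0 <= s <= t -> reaches X s p ->
  reaches X (t - s) (flow X s p) -> reaches X t p /\ flow X t p = flow X (t - s) (flow X s p).
Proof.
move=> sX st [c1 h1 <-]; have /andP[s0 st'] := st.
rewrite (flow_eq sX s0 h1) => -[c2 h2 c20].
have h := integral_curve_cat st h1 h2 (esym c20).
have ts0 : 0 <= t - s by rewrite subr_ge0.
have h0 : (if 0 <= s then c1 0 else c2 (0 - s)) = c1 0 by rewrite s0.
split; first by exists (fun u => if u <= s then c1 u else c2 (u - s)).
have := flow_eq sX (le_trans s0 st') h; rewrite h0 => ->.
rewrite -c20 (flow_eq sX ts0 h2).
case: (ltgtP t s) st' => // -> _; by rewrite subrr c20.
Qed.

Lemma reaches_local X q0 e : smooth_field setT X -> atlas e -> cdom e q0 ->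
  exists a r (phi : R -> 'rV[R]_n -> 'rV[R]_n) (Psi : R -> 'rV[R]_n -> 'M[R]_n),
  [/\ 0 < a, 0 < r & forall p, cdom e p -> `|ccoord e p - ccoord e q0| < r ->
    Psi 0 (ccoord e p) = 1%:M /\ forall s, 0 <= s -> s < a ->
   [/\ [/\ reaches X s p, cdom e (flow X s p), phi s (ccoord e p) = ccoord e (flow X s p) &
        cimage e setT (phi s (ccoord e p))],
     has_deriv_within setT (Psi^~ (ccoord e p)) s
       (Psi s (ccoord e p) *m jacobian (field_rep e X) (ccoord e (flow X s p))),
     Psi s (ccoord e p) \in unitmx, differentiable (phi s) (ccoord e p) &
     jacobian (phi s) (ccoord e p) = Psi s (ccoord e p)]].
Proof.
move=> sX ae eq0.
have oi : open (cimage e setT) by apply: open_cimage => //; exact: openT.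
have [a [r [phi [Psi [a0 r0 H]]]]] := local_flow oi (field_rep_smooth ae sX)
  (cimage_ccoord eq0 (I : setT q0)).
exists a, r, phi, Psi; split => // p ep pr; have [phi0 Psi0 {}H] := H _ pr.
split=> // s s0 sa.
have C : integral_curve X [set u | 0 <= u <= s] (param e \o phi^~ (ccoord e p)).
  apply/integral_curveP => u /= /andP[u0 us].
  have ua : `|u| < a by rewrite ger0_norm // (le_lt_trans us).
  have [Uu du _ _ _] := H u ua.
  apply: (@integral_curve_at_param X _ (phi^~ (ccoord e p)) u e ae Uu); exact: hdwT du.
have C0 : (param e \o phi^~ (ccoord e p)) 0 = p by rewrite /= phi0 paramK.
have fE : flow X s p = param e (phi s (ccoord e p)).
  by have := flow_eq sX s0 C; rewrite C0.
have sa' : `|s| < a by rewrite ger0_norm.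
have [Us _ dPsi uPsi [dphi jphi]] := H s sa'.
have [es _ esE] := cimage_param ae Us.
rewrite fE esE; split => //; last exact: jacobian_unique.
by split=> //; exists (param e \o phi^~ (ccoord e p)).
Qed.

End Curves.

(** The features of [[0, T[] used below, stated so that finite and infinite [T] are treated
    alike. *)
Definition half_open_interval (R : realType) (J : set R) :=
  [/\ J 0, forall t, J t -> 0 <= t, forall s t, 0 <= s -> s <= t -> J t -> J s &
      forall t, J t -> exists2 b, t < b & J b].

Lemma hdw_propagate (R : realType) (k l : nat) (A : set R) (f : R -> 'M[R]_(k, l))
    (P : R -> 'M[R]_l) (B : 'M[R]_(k, l)) (D : 'M[R]_l) t :
  (\forall s \near t, A s -> f s = B *m P s) -> f t = B *m P t ->
  has_deriv_within A P t (P t *m D) -> has_deriv_within A f t (f t *m D).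
Proof.
move=> fE ftE dP; have := hdw_mulmx (hdw_cst A B t) dP.
rewrite mul0mx add0r mulmxA -ftE; apply: hdw_near; last by rewrite -ftE.
by apply: filterS fE => s h /h ->.
Qed.

Lemma mulmx_invmxM (F : comUnitRingType) (k l : nat) (Y : 'M[F]_(k, l)) (P Q : 'M[F]_l) :
  P \in unitmx -> Q \in unitmx -> Y *m Q *m invmx (P *m Q) = Y *m invmx P.
Proof.
move=> uP uQ; have uPQ : P *m Q \in unitmx by rewrite unitmx_mul uP.
by apply: (can_inj (mulmxK uPQ)); rewrite mulmxKV // mulmxA mulmxKV.
Qed.

(** * The differential of the flow along the given curve *)

Section FlowAlongCurve.
Context {R : realType} {n : nat} {M : manifold R n}.
Context {X : M -> 'rV[R]_n} {J : set R} {c : R -> M}.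

(** The target chart is a parameter: differentiating in [t] requires one chart for all nearby times,
    whereas tangent spaces are represented in preferred charts that may jump along the curve. *)
Definition flow_chart (e : chart R n M) t : 'rV[R]_n -> 'rV[R]_n :=
  ccoord e \o flow X t \o param (chart_at (c 0)).

Definition flow_mx (e : chart R n M) t : 'M[R]_n :=
  jacobian (flow_chart e t) (ccoord (chart_at (c 0)) (c 0)).

(** Quantified over all charts at [c t], so that it can be propagated along the curve while the
    charts change. *)
Definition flow_regular t :=
  [/\ \forall p \near c 0, reaches X t p, flow X t p @[p --> c 0] --> c t &
   forall e, atlas e -> cdom e (c t) ->
     differentiable (flow_chart e t) (ccoord (chart_at (c 0)) (c 0)) /\
     flow_mx e t \in unitmx].

Lemma half_open_near t : half_open_interval J -> J t -> \forall s \near t, 0 <= s -> J s.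
Proof.
move=> [_ _ J2 J3] /J3[b tb Jb]; have := lt_nbhsl tb; apply: filterS => s sb s0.
exact: (J2 _ _ s0 (ltW sb)).
Qed.

Lemma flow_curve s t : smooth_field setT X -> half_open_interval J -> integral_curve X J c ->
  0 <= s -> 0 <= t -> J (t + s) -> flow X t (c s) = c (t + s).
Proof.
move=> sX [_ J1 J2 J3] /integral_curveP cc s0 t0 Jts.
have H : integral_curve X [set u | 0 <= u <= t] (fun u => c (u - - s)).
  apply/integral_curveP => u /= /andP[u0 ut].
  have JS v : 0 <= v -> v <= t -> J (v - - s).
    by move=> v0 vt; apply: J2 Jts; rewrite opprK ?addr_ge0 // lerD2r.
  apply: (integral_curve_at_shift _ (cc _ (JS u u0 ut))).
  by apply: (@filterE _ (nbhs u)) => v /= /andP[]; exact: JS.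
by have := flow_eq sX t0 H; rewrite add0r opprK.
Qed.

Lemma near_param0 (P : set M) : (\forall p \near c 0, P p) ->
  \forall y \near ccoord (chart_at (c 0)) (c 0), P (param (chart_at (c 0)) y).
Proof. exact: (param_near (chart_at_atlas _) (chart_at_dom _)). Qed.

Lemma flow_regular0 : smooth_field setT X -> half_open_interval J -> integral_curve X J c ->
  flow_regular 0 /\ flow_mx (chart_at (c 0)) 0 = 1%:M.
Proof.
move=> sX hJ cc; have [J0 J1 J2 J3] := hJ.
(* On an interval reduced to a point the condition on the derivative is void, hence the constant
   curve is an integral curve. *)
have cst p : integral_curve X [set s | 0 <= s <= 0] (fun=> p).
  apply/integral_curveP => t /= t0; split; first exact: cvg_cst.
  have : has_deriv_within set0 (ccoord (chart_at p) \o fun=> p) t (X p).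
    move=> P _; suff : nbhs t (fun s => s != t -> set0 s ->
      P ((s - t)^-1 *: (ccoord (chart_at p) p - ccoord (chart_at p) p))) by [].
    by apply: (@filterE _ (nbhs t)).
  move=> H P /H HP.
  suff : nbhs t (fun s => s != t -> 0 <= s <= 0 ->
      P ((s - t)^-1 *: (ccoord (chart_at p) p - ccoord (chart_at p) p))) by [].
  apply: (@filterE _ (nbhs t)) => s st s0; exfalso; move/eqP: st; apply.
  apply/eqP; rewrite eq_le; move: s0 t0; lra.
have r0 p : reaches X 0 p by exists (fun=> p).
have f0 p : flow X 0 p = p by have := flow_eq sX (lexx 0) (cst p).
have ae0 := chart_at_atlas (c 0); have e0c := chart_at_dom (c 0).
have Ef e : flow_chart e 0 = ccoord e \o param (chart_at (c 0)).
  by apply/funext => y; rewrite /flow_chart /= f0.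
have Em e : flow_mx e 0 = trans_mx (chart_at (c 0)) e (c 0).
  by rewrite /flow_mx Ef trans_mx_jacobian.
split; last by rewrite Em trans_mx_id.
split.
- exact: filterE.
- rewrite (_ : flow X 0 = id); first exact: cvg_id.
  by apply/funext => p; rewrite f0.
- move=> e ae ec; rewrite Em Ef; split; first exact: transition_differentiable.
  exact: trans_mx_unit.
Qed.

Lemma flow_mx_change e e' t : atlas e -> atlas e' -> cdom e (c t) -> cdom e' (c t) ->
  flow_chart e t (ccoord (chart_at (c 0)) (c 0)) = ccoord e (c t) ->
  (\forall p \near c 0, cdom e (flow X t p)) ->
  differentiable (flow_chart e t) (ccoord (chart_at (c 0)) (c 0)) ->
  differentiable (flow_chart e' t) (ccoord (chart_at (c 0)) (c 0)) /\
  flow_mx e' t = flow_mx e t *m trans_mx e e' (c t).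
Proof.
move=> ae ae' ec e'c fE nE dE.
have [dc jc] := jacobian_comp fE dE (transition_differentiable ae ae' ec e'c).
have E : \forall y \near ccoord (chart_at (c 0)) (c 0),
   flow_chart e' t y = (ccoord e' \o param e \o flow_chart e t) y.
  by apply: filterS (near_param0 nE) => y ey; rewrite /flow_chart /= paramK.
split; first exact: (near_eq_differentiable E dc).1.
by rewrite /flow_mx (jacobian_near E dc) jc trans_mx_jacobian.
Qed.

(** Near [tau] the flow to time [t] is the flow to time [s] followed by a local flow of duration
    [t - s] in the single chart [e]. The chain rule then propagates regularity and multiplies the
    matrices. *)
Lemma flow_step tau e : smooth_field setT X -> half_open_interval J -> integral_curve X J c ->
  J tau -> atlas e -> cdom e (c tau) ->
  exists d (Psi : R -> 'rV[R]_n -> 'M[R]_n), 0 < d /\ forall s, J s -> `|s - tau| < d ->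
  [/\ cdom e (c s), Psi 0 (ccoord e (c s)) = 1%:M &
   forall t, J t -> s <= t -> `|t - tau| < d ->
   [/\ cdom e (c t),
      has_deriv_within setT (Psi^~ (ccoord e (c s))) (t - s)
       (Psi (t - s) (ccoord e (c s)) *m jacobian (field_rep e X) (ccoord e (c t))) &
      flow_regular s -> flow_regular t /\
        flow_mx e t = flow_mx e s *m Psi (t - s) (ccoord e (c s))]].
Proof.
move=> sX hJ cc Jtau ae etau; have [J0 J1 J2 J3] := hJ.
have [a [r [phi [Psi [a0 r0 H]]]]] := reaches_local sX ae etau.
have /integral_curveP/(_ tau Jtau)[cct _] := cc.
have [d1 d10 D1] := chart_curve_near cct ae etau r0.
(* Two times within [a / 2] of [tau] differ by less than [a], the duration of the local flow. *)
exists (Num.min d1 (a / 2)), Psi; split; first by rewrite lt_min d10 divr_gt0.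
move=> s Js; rewrite lt_min => /andP[sd1 sa].
have [es rs] := D1 s Js sd1; have [Psi0 Hs] := H _ es rs.
split=> // t Jt st; rewrite lt_min => /andP[td1 ta].
have [et rt] := D1 t Jt td1.
have ts0 : 0 <= t - s by rewrite subr_ge0.
have tsa : t - s < a by move: sa ta; rewrite !ltr_norml; lra.
have s0 := J1 _ Js; have t0 := J1 _ Jt.
have fct : flow X (t - s) (c s) = c t by rewrite flow_curve ?subrK.
have [[_ _ phis _] dPsi uPsi dphi jphi] := Hs _ ts0 tsa; rewrite fct in dPsi phis.
split=> // -[rea cont dif].
have near_s : \forall p \near c 0, cdom e (flow X s p) /\
    `|ccoord e (flow X s p) - ccoord e (c tau)| < r.
  suff HP : nbhs (c s) (fun q => cdom e q /\ `|ccoord e q - ccoord e (c tau)| < r).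
    exact: (cont _ HP).
  apply: filterI; first exact: cdom_near.
  have /cvgrPdistC_lt/(_ (r - `|ccoord e (c s) - ccoord e (c tau)|)) :=
    ccoord_continuous ae es.
  rewrite subr_gt0 => /(_ rs); apply: filterS => p pE.
  rewrite -(subrKA (ccoord e (c s))) (le_lt_trans (ler_normD _ _)) // -ltrBrDr.
  exact: pE.
have near_t : \forall p \near c 0, [/\ reaches X t p, cdom e (flow X t p) &
    phi (t - s) (ccoord e (flow X s p)) = ccoord e (flow X t p)].
  apply: filterS2 rea near_s => p rp [ep rep].
  have [_ /(_ _ ts0 tsa)[[re ee phiE _] _ _ _ _]] := H _ ep rep.
  have st' : 0 <= s <= t by rewrite s0.
  by have [rt' ->] := reaches_cat sX st' rp re.
have cont_t : flow X t p @[p --> c 0] --> c t.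
  have ep : (fun p => param e (phi (t - s) (ccoord e (flow X s p)))) @ c 0 --> c t.
    have c1 := cvg_comp _ _ cont (ccoord_continuous ae es).
    have c2 := cvg_comp _ _ c1 (differentiable_continuous dphi).
    have it : cimage e setT (phi (t - s) (ccoord e (c s))).
      by rewrite phis; exact: cimage_ccoord.
    have := cvg_comp _ _ c2 (param_continuous ae it).
    by rewrite phis paramK.
  apply: cvg_trans ep; apply: near_eq_cvg.
  by apply: filterS near_t => p [_ ep pE]; rewrite pE paramK.
have ae0 := chart_at_atlas (c 0); have e0c := chart_at_dom (c 0).
have fE0 u : J u -> flow X u (c 0) = c u.
  by move=> Ju; rewrite flow_curve ?addr0 //; exact: J1.
have fE u : J u -> flow_chart e u (ccoord (chart_at (c 0)) (c 0)) = ccoord e (c u).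
  by move=> Ju; rewrite /flow_chart /= paramK // fE0.
have [dif_s u_s] := dif e ae es.
have [d1' j1] := jacobian_comp (fE s Js) dif_s dphi.
have E : \forall y \near ccoord (chart_at (c 0)) (c 0),
    flow_chart e t y = (phi (t - s) \o flow_chart e s) y.
  by apply: filterS (near_param0 near_t) => y [_ _ yE]; rewrite /flow_chart /= yE.
have dt := (near_eq_differentiable E d1').1.
have jt : flow_mx e t = flow_mx e s *m Psi (t - s) (ccoord e (c s)).
  by rewrite /flow_mx (jacobian_near E d1') j1 jphi.
have ut : flow_mx e t \in unitmx by rewrite jt unitmx_mul u_s.
split; last exact: jt.
split; [by apply: filterS near_t => p []|exact: cont_t|].
move=> e' ae' e't.
have nt : \forall p \near c 0, cdom e (flow X t p) by apply: filterS near_t => p [].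
have [d2 ->] := flow_mx_change ae ae' et e't (fE t Jt) nt dt.
split; first exact: d2.
rewrite unitmx_mul; apply/andP; split; [exact: ut|exact: trans_mx_unit ae ae' et e't].
Qed.

Lemma flow_regular_along t : smooth_field setT X -> half_open_interval J ->
  integral_curve X J c -> J t -> flow_regular t.
Proof.
move=> sX hJ cc Jt; have [J0 J1 J2 J3] := hJ.
apply: (@interval_step_induction _ flow_regular t (J1 t Jt)).
  exact: (flow_regular0 sX hJ cc).1.
move=> tau /andP[tau0 taut]; have Jtau := J2 _ _ tau0 taut Jt.
have [d [Psi [d0 H]]] := flow_step sX hJ cc Jtau (chart_at_atlas _) (chart_at_dom _).
exists d => // s u s0 su ut sd ud.
have Ju : J u := J2 _ _ (le_trans s0 su) ut Jt.
have [_ _ /(_ u Ju su ud)[_ _ Q]] := H s (J2 _ _ s0 su Ju) sd.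
by move=> /Q[].
Qed.

Lemma flow_mx_deriv tau e : smooth_field setT X -> half_open_interval J ->
  integral_curve X J c -> J tau -> atlas e -> cdom e (c tau) ->
  has_deriv_within J (flow_mx e) tau
    (flow_mx e tau *m jacobian (field_rep e X) (ccoord e (c tau))).
Proof.
move=> sX hJ cc Jtau ae etau; have [J0 J1 J2 J3] := hJ.
have [d [Psi [d0 H]]] := flow_step sX hJ cc Jtau ae etau.
have tau0 := J1 _ Jtau.
(* A base time that precedes all times of [J] near [tau]; for these [flow_mx e t] is the constant
   [flow_mx e s] times [Psi (t - s)], so only [Psi] has to be differentiated. *)
pose s := Num.max 0 (tau - d / 2).
have s0 : 0 <= s by rewrite le_max lexx.
have stau : s <= tau by rewrite ge_max tau0 /=; lra.
have Js : J s := J2 _ _ s0 stau Jtau.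
have sd : `|s - tau| < d.
  rewrite ltr_norml; apply/andP; split; last by lra.
  by apply: (@lt_le_trans _ _ (tau - d / 2 - tau)); [lra|rewrite lerD2r le_max lexx orbT].
have [_ _ Hs] := H s Js sd.
have tautau : `|tau - tau| < d by rewrite subrr normr0.
have rs := flow_regular_along sX hJ cc Js.
have [_ dPsi /(_ rs)[_ E]] := Hs _ Jtau stau tautau.
have D : has_deriv_within J (fun t => Psi (t - s) (ccoord e (c s))) tau
   (Psi (tau - s) (ccoord e (c s)) *m jacobian (field_rep e X) (ccoord e (c tau))).
  apply: (hdw_shift (f := fun t => Psi t (ccoord e (c s))) _ dPsi).
  exact: (@filterE _ (nbhs tau)).
apply: (hdw_propagate _ E D).
have n1 : \forall t \near tau, `|t - tau| < d by exact: near_dist_lt.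
have n2 : \forall t \near tau, 0 <= t -> s <= t.
  rewrite /s; case: (leP tau (d / 2)) => td.
    apply: (@filterE _ (nbhs tau)) => t t0.
    by rewrite ge_max t0 /=; lra.
  have := @lt_nbhsr R (tau - d / 2) tau; rewrite ltrBlDr ltrDl divr_gt0 // => /(_ isT).
  by apply: filterS => t tt t0; rewrite ge_max t0 ltW.
apply: filterS2 n1 n2 => t td t0 Jt.
by have [_ _ /(_ rs)[_ ->]] := Hs t Jt (t0 (J1 _ Jt)) td.
Qed.

(** Its target chart changes with [t], so it need not be continuous. Derivatives are taken through
    [flow_mx e], and the products in [pull] do not depend on the chart. *)
Definition curve_flow_mx t : 'M[R]_n := flow_mx (chart_at (c t)) t.

Context (sX : smooth_field setT X) (hJ : half_open_interval J) (cc : integral_curve X J c).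

Lemma flow_curve0 t : J t -> flow X t (c 0) = c t.
Proof.
by move=> Jt; rewrite flow_curve ?addr0 //; have [_ + _ _] := hJ; apply.
Qed.

Lemma flow_mxE e t : J t -> atlas e -> cdom e (c t) ->
  flow_mx e t = curve_flow_mx t *m trans_mx (chart_at (c t)) e (c t).
Proof.
move=> Jt ae et; have [_ rc rd] := flow_regular_along sX hJ cc Jt.
have a := chart_at_atlas (c t); have d := chart_at_dom (c t).
have [d1 _] := rd _ a d.
have n1 : \forall p \near c 0, cdom (chart_at (c t)) (flow X t p) := rc _ (cdom_near a d).
apply: (flow_mx_change a ae d et _ n1 d1).2.
by rewrite /flow_chart /= (paramK (chart_at_atlas _) (chart_at_dom _)) flow_curve0.
Qed.

Lemma flow_mx_unit e t : J t -> atlas e -> cdom e (c t) -> flow_mx e t \in unitmx.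
Proof.
by move=> Jt ae et; have [_ _ /(_ _ ae et)[]] := flow_regular_along sX hJ cc Jt.
Qed.

Lemma curve_flow_mx_unit t : J t -> curve_flow_mx t \in unitmx.
Proof. by move=> Jt; exact: (flow_mx_unit Jt (chart_at_atlas _) (chart_at_dom _)). Qed.

Lemma curve_flow_mx0 : curve_flow_mx 0 = 1%:M.
Proof. exact: (flow_regular0 sX hJ cc).2. Qed.

Lemma mdiff_flow t v : J t -> mdiff (flow X t) (c 0) v = v *m curve_flow_mx t.
Proof.
move=> Jt; rewrite /mdiff (flow_curve0 Jt).
exact: (esym (mul_jacobian (flow_chart (chart_at (c t)) t) _ v)).
Qed.

Definition pull (Y : M -> 'rV[R]_n) t := Y (c t) *m invmx (curve_flow_mx t).

Lemma pullE e Y t : J t -> atlas e -> cdom e (c t) ->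
  pull Y t = field_rep e Y (ccoord e (c t)) *m invmx (flow_mx e t).
Proof.
move=> Jt ae et; rewrite /pull (flow_mxE Jt ae et) (field_repE Y ae et).
rewrite mulmx_invmxM //; first exact: curve_flow_mx_unit.
exact: trans_mx_unit (chart_at_atlas _) ae (chart_at_dom _) et.
Qed.

Lemma curve_cdom_near t : J t -> \forall s \near t, J s -> cdom (chart_at (c t)) (c s).
Proof.
move=> Jt; have /integral_curveP/(_ t Jt)[cct _] := cc.
exact: (cct _ (cdom_near (chart_at_atlas (c t)) (chart_at_dom _))).
Qed.

Lemma curve_near t (U : set M) : J t -> open U -> U (c t) ->
  \forall s \near t, J s -> U (c s).
Proof.
move=> Jt oU Uc; have /integral_curveP/(_ t Jt)[cct _] := cc.
exact: (cct _ (open_nbhs_nbhs (conj oU Uc))).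
Qed.

(** The Lie derivative formula along the flow: one half of the bracket comes from the motion of the
    point in [Y], the other from the derivative of the inverse differential of the flow. *)
Lemma pull_deriv U Y t : J t -> open U -> U (c t) -> smooth_field U Y ->
  has_deriv_within J (pull Y) t (pull (bracket X Y) t).
Proof.
move=> Jt oU Uc sY; pose e := chart_at (c t).
have ae : atlas e := chart_at_atlas _; have ec : cdom e (c t) := chart_at_dom _.
have /integral_curveP/(_ t Jt)/(@integral_curve_at_chart _ _ _ _ _ _ _ e)/(_ ae ec) dc := cc.
have dY := hdw_comp dc (field_rep_differentiable ae sY ec Uc).
have dQ := hdw_invmx (flow_mx_unit Jt ae ec) (flow_mx_deriv sX hJ cc Jt ae ec).
have := hdw_mulmx dY dQ.
have -> : 'd (field_rep e Y) (ccoord e (c t)) (field_rep e X (ccoord e (c t))) *m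
     invmx (flow_mx e t) + field_rep e Y (ccoord e (c t)) *m
   - (invmx (flow_mx e t) *m (flow_mx e t *m jacobian (field_rep e X) (ccoord e (c t)))
     *m invmx (flow_mx e t)) = pull (bracket X Y) t.
  have sXU : smooth_field U X by apply: smooth_field_sub sX.
  rewrite (pullE _ Jt ae ec) (field_rep_bracket ae ec oU Uc sXU sY) /lie mulmxBl.
  congr (_ + _); rewrite mulmxN mulKmx; last exact: flow_mx_unit.
  by rewrite mulmxA mul_jacobian.
apply: hdw_near; last by rewrite (pullE _ Jt ae ec).
have n1 := curve_cdom_near Jt.
by apply: filterS n1 => s es Js; rewrite (pullE _ Js ae (es Js)).
Qed.

Lemma field_deriv_along (F : normedModType R) (f : M -> F) t : J t ->
  differentiable (f \o param (chart_at (c t))) (ccoord (chart_at (c t)) (c t)) ->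
  has_deriv_within J (f \o c) t (field_deriv X f (c t)).
Proof.
move=> Jt df; have /integral_curveP/(_ t Jt)[_ dc] := cc.
have := hdw_comp dc df; apply: hdw_near; last first.
  by rewrite /= (paramK (chart_at_atlas _) (chart_at_dom _)).
have n1 := curve_cdom_near Jt.
by apply: filterS n1 => s es Js; rewrite /= (paramK (chart_at_atlas _)) //; exact: es.
Qed.

(** * Frames of the pair pulled back along the curve *)

Context {m : nat} {N : set M} {V : M -> {vspace 'rV[R]_n}} (reg : regular_dynamic_pair m N X V).
Implicit Types (W : 'I_m -> M -> 'rV[R]_n) (H : M -> 'M[R]_m).

Definition pull_frame W t : 'M[R]_(m, n) := frame_mx W (c t) *m invmx (curve_flow_mx t).

Lemma pull_frame_row W t i : row i (pull_frame W t) = pull (W i) t.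
Proof. by rewrite row_mul rowK. Qed.

Lemma pull_frame_deriv U W t : J t -> open U -> U (c t) -> (forall i, smooth_field U (W i)) ->
  has_deriv_within J (pull_frame W) t (pull_frame (fun i => bracket X (W i)) t).
Proof.
move=> Jt oU Uc sW.
exact: (hdw_rows (fun i => pull_deriv Jt oU Uc (sW i)) (fun i s => pull_frame_row W s i)
  (pull_frame_row _ t)).
Qed.

Lemma J_interior t : J t -> 0 < t -> nbhs t J.
Proof.
move=> Jt t0; have n1 := half_open_near hJ Jt; have n2 := lt_nbhsr t0.
by apply: filterS2 n1 n2 => s h /ltW/h.
Qed.

Definition adapted_frame U W H0 H1 := local_frame N V U W /\ structure_matrices X U W H0 H1.

Lemma adapted_frame_exists t : J t -> N (c t) ->
  exists U W H0 H1, U (c t) /\ adapted_frame U W H0 H1.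
Proof.
move=> Jt Nc; have [_ sd _ _ _] := reg; have [U [W [Uc lW]]] := sd _ Nc.
have [H0 [H1 sm]] := structure_matrices_exist reg lW.
by exists U, W, H0, H1.
Qed.

(** [frame_lin] will be applied to [H1] and [frame_pot] to [H0]; the two names record the role of
    the transposed matrix in the second order equation. *)
Definition frame_lin H t := (H (c t))^T.
Definition frame_dlin H t := (field_deriv X H (c t))^T.
Definition frame_pot H t := (H (c t))^T.

Lemma adapted_row_free U W H0 H1 t : J t -> U (c t) -> adapted_frame U W H0 H1 ->
  row_free (col_mx (pull_frame W t) (pull_frame (fun i => bracket X (W i)) t)).
Proof.
move=> Jt Uc [lW sm]; rewrite -mul_col_mx /row_free mxrankMfree.
  exact: regular_row_free reg lW Uc.
by rewrite row_free_unit unitmx_inv; exact: curve_flow_mx_unit.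
Qed.

Lemma adapted_bracket_deriv U W H0 H1 t : J t -> U (c t) -> adapted_frame U W H0 H1 ->
  has_deriv_within J (pull_frame (fun i => bracket X (W i))) t
    (frame_pot H0 t *m pull_frame W t +
     frame_lin H1 t *m pull_frame (fun i => bracket X (W i)) t).
Proof.
move=> Jt Uc [lW sm]; have [oU UN sW _] := lW; have [sXN _ _ _ _] := reg.
have sZ i : smooth_field U (bracket X (W i)).
  by apply: smooth_bracket => //; exact: smooth_field_sub UN sXN.
have := pull_frame_deriv Jt oU Uc sZ.
suff -> : pull_frame (fun i => bracket X (bracket X (W i))) t =
   frame_pot H0 t *m pull_frame W t +
   frame_lin H1 t *m pull_frame (fun i => bracket X (W i)) t by [].
rewrite /pull_frame.
by have /structure_matricesP -> := sm; rewrite // mulmxDl !mulmxA.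
Qed.

(** The derivatives in [jacobi_frame] are two-sided, hence the condition [0 < t]. *)
Lemma adapted_jacobi_frame U W H0 H1 t : J t -> 0 < t -> U (c t) -> adapted_frame U W H0 H1 ->
  jacobi_frame (pull_frame W) (pull_frame (fun i => bracket X (W i)))
    (frame_pot H0) (frame_lin H1) (frame_dlin H1) t.
Proof.
move=> Jt t0 Uc aW; have [lW sm] := aW; have [oU UN sW _] := lW.
have nJ := J_interior Jt t0; split.
- exact: adapted_row_free Jt Uc aW.
- exact: hdw_interior nJ (pull_frame_deriv Jt oU Uc sW).
- exact: hdw_interior nJ (adapted_bracket_deriv Jt Uc aW).
- apply: hdw_interior nJ _; apply: hdw_tr.
  exact: field_deriv_along Jt (structure_mx_differentiable reg lW sm Uc).2.
Qed.

Lemma frame_curvE H0 H1 t :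
  frame_curv (frame_pot H0) (frame_lin H1) (frame_dlin H1) t = (curvature_mx X H0 H1 (c t))^T.
Proof.
rewrite /frame_curv /curvature_mx /frame_pot /frame_lin /frame_dlin -trmx_mul.
by apply/matrixP => i j; rewrite !mxE.
Qed.

Lemma adapted_near U W H0 H1 t : J t -> 0 < t -> U (c t) -> adapted_frame U W H0 H1 ->
  \forall s \near t, [/\ J s, 0 < s & U (c s)].
Proof.
move=> Jt t0 Uc [[oU _ _ _] _]; have n1 := J_interior Jt t0.
have n2 := curve_near Jt oU Uc; have n3 := lt_nbhsr t0.
by apply: filterS3 n1 n2 n3 => s Js /(_ Js) Us s0.
Qed.

Lemma adapted_frame_change U W H0 H1 U' W' H0' H1' t : J t -> 0 < t -> U (c t) -> U' (c t) ->
  adapted_frame U W H0 H1 -> adapted_frame U' W' H0' H1' ->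
  \forall s \near t, [/\
   jacobi_frame (pull_frame W) (pull_frame (fun i => bracket X (W i)))
    (frame_pot H0) (frame_lin H1) (frame_dlin H1) s,
   jacobi_frame (pull_frame W') (pull_frame (fun i => bracket X (W' i)))
    (frame_pot H0') (frame_lin H1') (frame_dlin H1') s &
   pull_frame W s = frame_mx W (c s) *m pinvmx (frame_mx W' (c s)) *m pull_frame W' s].
Proof.
move=> Jt t0 Uc Uc' aW aW'.
have n1 := adapted_near Jt t0 Uc aW; have n2 := adapted_near Jt t0 Uc' aW'.
apply: filterS2 n1 n2 => s [Js s0 Us] [_ _ Us'].
split; [exact: adapted_jacobi_frame aW|exact: adapted_jacobi_frame aW'|].
rewrite /pull_frame mulmxA mulmxKpV //.
have [lW _] := aW; have [lW' _] := aW'.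
have [_ VE] := local_frameP lW Us; have [_ VE'] := local_frameP lW' Us'.
apply/row_subP => i; have /VE' [a ->] : row i (frame_mx W (c s)) \in V (c s).
  by apply/VE; exists (delta_mx 0 i); rewrite rowE.
exact: submxMl.
Qed.

Lemma sum_frame_mx W q (a : 'cV[R]_m) : \sum_i a i 0 *: W i q = a^T *m frame_mx W q.
Proof. by rewrite mulmx_sum_row; apply: eq_bigr => i _; rewrite rowK mxE. Qed.

Lemma adapted_frame_change_at U W H0 H1 U' W' H0' H1' t (C := fun s =>
    frame_mx W (c s) *m pinvmx (frame_mx W' (c s))) : J t -> 0 < t -> U (c t) -> U' (c t) ->
  adapted_frame U W H0 H1 -> adapted_frame U' W' H0' H1' ->
  [/\ has_deriv_within setT C t
      (2^-1 *: (frame_lin H1 t *m C t - C t *m frame_lin H1' t)),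
    frame_mx W (c t) = C t *m frame_mx W' (c t) &
    (curvature_mx X H0 H1 (c t))^T *m C t = C t *m (curvature_mx X H0' H1' (c t))^T].
Proof.
move=> Jt t0 Uc Uc' aW aW'.
have H := adapted_frame_change Jt t0 Uc Uc' aW aW'.
have [dC _ KC] := frame_change (C := C) H; rewrite !frame_curvE in KC.
split=> //; have [_ _ E] := nbhs_singleton H.
have u : invmx (curve_flow_mx t) \in unitmx by rewrite unitmx_inv; exact: curve_flow_mx_unit.
by apply: (can_inj (mulmxK u)); rewrite /pull_frame mulmxA in E.
Qed.

Lemma adapted_row_free_mx U W H0 H1 q : U q -> adapted_frame U W H0 H1 ->
  row_free (frame_mx W q).
Proof. by move=> Uq [lW _]; have [] := local_frameP lW Uq. Qed.

Lemma xget_eq (T : pointedType) (x0 x : T) (S : set T) :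
  S x -> (forall y, S y -> y = x) -> xget x0 S = x.
Proof. by move=> Sx Su; apply: Su; exact: xgetI Sx. Qed.

(** Any other frame offered to the choice in [curvature] gives the same vector, since the two
    curvature matrices are conjugate by the transition matrix. *)
Lemma curvatureE U W H0 H1 t (a : 'rV[R]_m) : J t -> 0 < t -> U (c t) ->
  adapted_frame U W H0 H1 ->
  curvature m N X V (c t) (a *m frame_mx W (c t)) =
    a *m (curvature_mx X H0 H1 (c t))^T *m frame_mx W (c t).
Proof.
move=> Jt t0 Uc aW; have [lW sm] := aW; rewrite /curvature; apply: xget_eq.
  exists U, W, H0, H1, a^T; split=> //; rewrite sum_frame_mx ?trmxK //.
  by rewrite trmx_mul trmxK.
move=> _ [U' [W' [H0' [H1' [a' [lW' Uc' sm' aE ->]]]]]].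
have aW' : adapted_frame U' W' H0' H1' by [].
have [_ WC KC] := adapted_frame_change_at Jt t0 Uc Uc' aW aW'.
move: WC KC aE; set C := _ *m pinvmx _ => WC KC.
rewrite !sum_frame_mx {1}WC mulmxA => /(row_free_inj (adapted_row_free_mx Uc' aW')) aC.
by rewrite trmx_mul -aC WC -(mulmxA a C) -KC !mulmxA.
Qed.

Lemma covariant_derivE U W H0 H1 t i : J t -> 0 < t -> U (c t) ->
  adapted_frame U W H0 H1 ->
  covariant_deriv m N X V J c (fun s => W i (c s)) t =
    2^-1 *: row i (frame_lin H1 t *m frame_mx W (c t)).
Proof.
move=> Jt t0 Uc aW; have [lW sm] := aW; rewrite /covariant_deriv.
have uE W' (H' : M -> 'M[R]_m) (f : 'I_m -> R -> R) (df : 'I_m -> R) :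
    \sum_j df j *: W' j (c t) + 2^-1 *: \sum_i \sum_j (f j t * H' (c t) i j) *: W' i (c t) =
    (\row_j df j + 2^-1 *: (\row_j f j t *m frame_lin H' t)) *m frame_mx W' (c t).
  rewrite mulmxDl -scalemxAl; congr (_ + _ *: _).
    by rewrite mulmx_sum_row; apply: eq_bigr => j _; rewrite rowK mxE.
  rewrite mulmx_sum_row; apply: eq_bigr => k _; rewrite rowK mxE scaler_suml.
  by apply: eq_bigr => j _; rewrite !mxE.
apply: xget_eq.
  exists U, W, H0, H1, (fun j _ => (i == j)%:R), (fun=> 0); split=> //.
  - suff : nbhs t (fun s => J s -> W i (c s) = \sum_j (i == j)%:R *: W j (c s)) by [].
    apply: (@filterE _ (nbhs t)) => s _.
    rewrite (bigD1 i) //= eqxx scale1r big1 ?addr0 // => j; rewrite eq_sym => /negPf ->.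
    by rewrite scale0r.
  - by move=> j; exact: hdw_cst.
  - rewrite uE; have -> : \row_(j < m) (0 : R) = 0 by apply/rowP => j; rewrite !mxE.
    have -> : \row_(j < m) (i == j)%:R = delta_mx 0 i :> 'rV[R]_m.
      by apply/rowP => j; rewrite !mxE eqxx eq_sym.
    by rewrite add0r -scalemxAl -mulmxA -rowE.
move=> _ [U' [W' [H0' [H1' [f [df [[lW' Uc' sm'] Yf dfE ->]]]]]]].
have aW' : adapted_frame U' W' H0' H1' by [].
have [dC WC _] := adapted_frame_change_at Jt t0 Uc Uc' aW aW'.
set C := fun s => frame_mx W (c s) *m pinvmx (frame_mx W' (c s)) in dC WC.
have nJ := J_interior Jt t0.
have Yf' : nbhs t (fun s => J s -> W i (c s) = \sum_j f j s *: W' j (c s)) := Yf.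
(* In the competing frame the coefficients of [W i] are forced to be a row of the transition matrix,
   whose derivative is known. *)
have fC : \forall s \near t, \row_j f j s = row i (C s).
  have n1 := adapted_near Jt t0 Uc' aW'; have H := adapted_frame_change Jt t0 Uc Uc' aW aW'.
  apply: filterS2 Yf' n1 => s /[swap] -[Js s0 Us'] /(_ Js) YE.
  rewrite /C row_mul rowK YE.
  have -> : \sum_j f j s *: W' j (c s) = \row_j f j s *m frame_mx W' (c s).
    by rewrite mulmx_sum_row; apply: eq_bigr => j _; rewrite rowK mxE.
  by rewrite (mulmxKp (adapted_row_free_mx Us' aW')).
have df1 : has_deriv_within setT (fun s => \row_j f j s) t (\row_j df j).
  apply: hdw_mx => k j; rewrite mxE; apply: hdw_interior nJ _.
  by apply: hdw_near (dfE j); [apply: (@filterE _ (nbhs t)) => s _; rewrite mxE|rewrite mxE].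
have dfC : \row_j df j = row i (2^-1 *: (frame_lin H1 t *m C t - C t *m frame_lin H1' t)).
  apply: (hdw_unique df1).
  have := hdw_mulmx (hdw_cst setT (delta_mx 0 i : 'rV[R]_m) t) dC.
  rewrite mul0mx add0r -rowE; apply: hdw_near; last by rewrite (nbhs_singleton fC) rowE.
  by apply: filterS fC => s -> _; rewrite rowE.
rewrite uE dfC (nbhs_singleton fC) WC !rowE -!scalemxAr -scalerDr -scalemxAl; congr (_ *: _).
rewrite !(mulmxBr, mulmxBl, mulmxDl, mulmxDr) !mulmxA subrK //.
Qed.

(** [A] and [A'] are the transition matrices between the basis used by [trace_on] and the frame; the
    trace is invariant under conjugation and transposition. *)
Lemma trace_curvatureE U W H0 H1 t : J t -> 0 < t -> U (c t) ->
  adapted_frame U W H0 H1 ->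
  trace_on (V (c t)) (curvature m N X V (c t)) = \tr (curvature_mx X H0 H1 (c t)).
Proof.
move=> Jt t0 Uc aW; have [lW sm] := aW.
have [Wfree VE] := local_frameP lW Uc.
set E := V (c t) in VE *; set F := frame_mx W (c t) in Wfree VE *.
set K := curvature_mx X H0 H1 (c t).
pose B := \matrix_(i < \dim E) (vbasis E)`_i; pose A := B *m pinvmx F.
pose A' := \matrix_(i < m) \row_j coord (vbasis E) j (row i F).
have bV i : (vbasis E)`_i \in E \/ (\dim E <= i)%N.
  case: (ltnP i (\dim E)) => iE; [left|by right].
  by apply: vbasis_mem; apply: mem_nth; rewrite size_tuple.
have BA : B = A *m F.
  rewrite /A mulmxKpV //; apply/row_subP => i; rewrite rowK.
  have [/VE[a ->]|] := bV i; first exact: submxMl.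
  by rewrite leqNgt ltn_ord.
have FA : F = A' *m B.
  apply/row_matrixP => i; rewrite row_mul mulmx_sum_row.
  have iV : row i F \in E by apply/VE; exists (delta_mx 0 i); rewrite rowE.
  rewrite {1}(coord_vbasis iV); apply: eq_bigr => j _.
  by rewrite [row j B]rowK [row i A']rowK [in RHS]mxE.
have Bfree : row_free B by apply/row_free_of_free/basis_free/vbasisP.
have A'A : A' *m A = 1%:M.
  by apply: (row_free_inj Wfree); rewrite -mulmxA -BA -FA mul1mx.
have EV : trace_on E (curvature m N X V (c t)) = \tr (A *m K^T *m A').
  rewrite /trace_on /mxtrace; apply: eq_bigr => i _.
  have -> : (vbasis E)`_i = row i A *m F.
    by rewrite -row_mul -BA rowK.
  rewrite (curvatureE _ Jt t0 Uc aW) -/F -/K {1}FA -row_mul mulmxA -row_mul.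
  rewrite mulmx_sum_row linear_sum.
  rewrite (bigD1 i) //= big1 ?addr0 => [|j ji].
    by rewrite linearZ /= rowK coord_free ?eqxx ?mulr1 ?mxE //; apply/basis_free/vbasisP.
  rewrite linearZ /= rowK coord_free ?(negPf ji) ?mulr0 //.
  exact/basis_free/vbasisP.
by rewrite EV -mulmxA mxtrace_mulC -mulmxA A'A mulmx1 mxtrace_tr.
Qed.

Definition jacobi_span W t := col_mx (pull_frame W t) (pull_frame (fun i => bracket X (W i)) t).

Lemma jacobi_span_indep U W H0 H1 U' W' H0' H1' t : U (c t) -> U' (c t) ->
  adapted_frame U W H0 H1 -> adapted_frame U' W' H0' H1' ->
  (jacobi_span W t <= jacobi_span W' t)%MS.
Proof.
move=> Uc Uc' [lW _] [lW' _]; rewrite /jacobi_span -!mul_col_mx; apply: submxMr.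
rewrite col_mx_sub; apply/andP; split; apply/row_subP => i; rewrite rowK;
  apply: (derived_sub lW' Uc'); by have [] := derived_frame X lW Uc i.
Qed.

Lemma jacobi_span_rank U W H0 H1 t : J t -> U (c t) -> adapted_frame U W H0 H1 ->
  \rank (jacobi_span W t) = (m + m)%N.
Proof. by move=> Jt Uc aW; apply/eqP; exact: (adapted_row_free Jt Uc aW). Qed.

Lemma adapted_lin_deriv U W H0 H1 t : J t -> U (c t) -> adapted_frame U W H0 H1 ->
  has_deriv_within J (frame_pot H0) t (field_deriv X H0 (c t))^T /\
  has_deriv_within J (frame_lin H1) t (frame_dlin H1 t).
Proof.
move=> Jt Uc [lW sm]; have [d0 d1] := structure_mx_differentiable reg lW sm Uc.
by split; apply: hdw_tr; exact: field_deriv_along.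
Qed.

(** The frame stacked on its brackets solves a linear equation with a companion block matrix, so its
    later row space lies in the earlier one; equality of ranks reverses the inclusion. *)
Lemma jacobi_span_const U W H0 H1 tau : J tau -> U (c tau) -> adapted_frame U W H0 H1 ->
  exists2 d, 0 < d & forall s t, J s -> J t -> s <= t -> `|s - tau| < d -> `|t - tau| < d ->
    [/\ U (c s), U (c t) & (jacobi_span W s <= jacobi_span W t)%MS].
Proof.
move=> Jtau Ut aW; have [oU _ sW _] := aW.1; have [_ J1 J2 _] := hJ.
have [dp dl] := adapted_lin_deriv Jtau Ut aW.
pose K := 1 + (`|frame_pot H0 tau| + 1) + (`|frame_lin H1 tau| + 1).
have K1 : 1 <= K.
  rewrite /K; move: (normr_ge0 (frame_pot H0 tau)) (normr_ge0 (frame_lin H1 tau)); lra.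
have [d1 d10 D1] := nbhs_dist (curve_near Jtau oU Ut).
have [d2 d20 D2] := nbhs_dist (near_norm_bounded dp).
have [d3 d30 D3] := nbhs_dist (near_norm_bounded dl).
pose L := (m + m)%:R * K; have L0 : 0 <= L by rewrite mulr_ge0 // (le_trans ler01).
have L1 : 0 < 4 * (L + 1) by rewrite mulr_gt0 // ltr_wpDl.
exists (Num.min (Num.min d1 (Num.min d2 d3)) (4 * (L + 1))^-1).
  by rewrite !lt_min d10 d20 d30 invr_gt0.
move=> s t Js Jt st; rewrite !lt_min.
move=> /andP[/andP[s1 /andP[s2 s3]] sL] /andP[/andP[t1 /andP[t2 t3]] tL].
have Us : U (c s) := D1 s s1 Js; have Utt : U (c t) := D1 t t1 Jt.
split; [exact: Us|exact: Utt|].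
have IJ u : s <= u <= t -> J u.
  by move=> /andP[su ut]; apply: (J2 _ _ _ ut Jt); rewrite (le_trans _ su) // J1.
have ID u k : s <= u <= t -> `|s - tau| < k -> `|t - tau| < k -> `|u - tau| < k.
  by move=> /andP[su ut]; rewrite !ltr_norml; lra.
pose A u := block_mx 0 1%:M (frame_pot H0 u) (frame_lin H1 u) : 'M[R]_(m + m).
have dG u : s <= u <= t -> has_deriv_within J (jacobi_span W) u (A u *m jacobi_span W u).
  move=> ust; have Uu : U (c u) := D1 u (ID u _ ust s1 t1) (IJ u ust).
  have D := hdw_col_mx (pull_frame_deriv (IJ u ust) oU Uu sW)
    (adapted_bracket_deriv (IJ u ust) Uu aW).
  by rewrite /A /jacobi_span mul_block_col mul0mx add0r mul1mx.
have ts : (jacobi_span W t <= jacobi_span W s)%MS.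
  apply: (linear_ode_submx (le_trans ler01 K1) st (short_interval L0 sL tL) (A := A)).
  move=> u ust; split.
    by apply: hdw_sub (dG u ust); apply: (@filterE _ (nbhs u)) => v /=; exact: IJ.
  have := D2 u (ID u _ ust s2 t2) (IJ u ust); have := D3 u (ID u _ ust s3 t3) (IJ u ust).
  move=> h3 h2; apply: (norm_block_le K1).
    by rewrite /K; move: h2 (normr_ge0 (frame_lin H1 tau)); lra.
  by rewrite /K; move: h3 (normr_ge0 (frame_pot H0 tau)); lra.
exact: submx_rank_eq ts (etrans (jacobi_span_rank Jt Utt aW) (esym (jacobi_span_rank Js Us aW))).
Qed.

Context (Nc : forall t, J t -> N (c t)).

(** The statement propagated in time quantifies over all frames adapted at that time, which allows
    changing frames between two steps. *)
Lemma jacobi_span_transport (w0 : 'M[R]_(m, n)) U W H0 H1 U0 W0 H00 H01 t : J t -> U (c t) ->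
  adapted_frame U W H0 H1 -> U0 (c 0) -> adapted_frame U0 W0 H00 H01 ->
  (w0 <= jacobi_span W0 0)%MS -> (w0 <= jacobi_span W t)%MS.
Proof.
move=> Jt Uc aW Uc0 aW0 sub0; have [J0 J1 J2 _] := hJ.
pose P s := forall U' W' H0' H1', U' (c s) -> adapted_frame U' W' H0' H1' ->
  (w0 <= jacobi_span W' s)%MS.
suff : P t by move=> /(_ U W H0 H1 Uc aW).
apply: (@interval_step_induction _ P t (J1 t Jt)).
  move=> U' W' H0' H1' Uc' aW'; apply: submx_trans sub0 _.
  exact: jacobi_span_indep Uc0 Uc' aW0 aW'.
move=> tau /andP[tau0 taut]; have Jtau := J2 _ _ tau0 taut Jt.
have [U1 [W1 [H10 [H11 [U1c aW1]]]]] := adapted_frame_exists Jtau (Nc Jtau).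
have [d d0 D] := jacobi_span_const Jtau U1c aW1; exists d => // s u s0 su ut sd ud Ps.
have Ju : J u := J2 _ _ (le_trans s0 su) ut Jt.
have [U1s U1u sub] := D s u (J2 _ _ s0 su Ju) Ju su sd ud.
move=> U' W' H0' H1' Uc' aW'; apply: (submx_trans (Ps _ _ _ _ U1s aW1)).
apply: submx_trans sub _; exact: jacobi_span_indep U1u Uc' aW1 aW'.
Qed.

(** The conditions on the metric speak only of smooth sections along [c]. A frame field restricted
    to [c] is one, its successive derivatives in a chart being the iterated derivatives along
    [X]. *)
Lemma frame_section U W H0 H1 t : J t -> U (c t) -> adapted_frame U W H0 H1 ->
  exists2 A, [/\ rel_open J A, A t, A `<=` J & \forall s \near t, J s -> A s] &
    forall i, section_along V c A (fun s => W i (c s)).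
Proof.
move=> Jt Uc [[oU UN sW bW] _].
have /nbhs_ballP[d /= d0 D] := curve_near Jt oU Uc.
exists (ball t d `&` J).
  split; first by exists (ball t d) => //; exact: ball_open.
  - by split=> //; exact: ballxx.
  - by move=> s [].
  - by apply: filterS (nbhsx_ballx t d d0) => s bs Js.
move=> i; have AU s : (ball t d `&` J) s -> U (c s) by move=> [/D Us /Us].
split=> [s /AU Us|e ae].
  apply: (basis_mem (bW _ Us)); apply/tnthP; exists i; by rewrite tnth_mktuple.
set A := _ `&` (c @^-1` _).
have sXU : smooth_field U X by apply: smooth_field_sub sX.
have oi := open_cimage ae oU.
pose Fk := fix Fk k : 'rV[R]_n -> 'rV[R]_n := if k is k'.+1
  then (fun y => 'd (Fk k') y (field_rep e X y)) else field_rep e (W i).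
have sF k : smooth_on (cimage e U) (Fk k).
  elim: k => [|k IH]; first exact: (field_rep_smooth ae (sW i)).
  exact: (smooth_diff_apply oi IH (field_rep_smooth ae sXU)).
(* [smooth_within] wants the given function itself at index 0, also at times where [c] is outside
   the chart; hence the separate case. *)
pose dk k s := if k is 0%N then tcoord e (c s) (W i (c s)) else Fk k (ccoord e (c s)).
have dkE k s : A s -> dk k s = Fk k (ccoord e (c s)).
  by case: k => [|k] [_ es] //=; rewrite field_repE // tcoordE.
exists dk; split=> // k s As; have [As' es] := As; have Us := AU _ As'; have [_ Js] := As'.
have /integral_curveP/(_ s Js)/(@integral_curve_at_chart _ _ _ _ _ _ _ e)/(_ ae es) dc := cc.
have dF := smooth_differentiable (sF k) (cimage_ccoord es Us).
have D1 : has_deriv_within A (Fk k \o (ccoord e \o c)) s (Fk k.+1 (ccoord e (c s))).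
  apply: hdw_sub (hdw_comp dc dF).
  by apply: (@filterE _ (nbhs s)) => u [[]].
rewrite (dkE k.+1 s As); apply: hdw_near D1; last by rewrite dkE.
by apply: (@filterE _ (nbhs s)) => u Au; rewrite dkE.
Qed.

(** * The metric and its Gram matrices *)

Context {g : R -> 'rV[R]_n -> 'rV[R]_n -> R}.
Context (mg : metric_along V c J g) (pg : parallel_metric m N X V c J g)
  (cg : curvature_symmetric m N X V c J g).

Definition gram W t : 'M[R]_m := \matrix_(i, j) g t (W i (c t)) (W j (c t)).

Lemma metric_sum t (I : Type) (r : seq I) (a : I -> R) (v : I -> 'rV[R]_n) w : J t ->
  (forall i, v i \in V (c t)) -> w \in V (c t) ->
  g t (\sum_(i <- r) a i *: v i) w = \sum_(i <- r) a i * g t (v i) w.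
Proof.
move=> Jt vV wV; have [glin _ _ _] := mg.
have g0 : g t 0 w = 0.
  have := glin t Jt 1 0 0 w (mem0v _) (mem0v _) wV.
  rewrite scaler0 addr0 mul1r => H; lra.
elim: r => [|i r IH]; first by rewrite !big_nil.
rewrite !big_cons glin ?IH //; apply: memv_suml => j _; exact: memvZ.
Qed.

Lemma metric_form U W H0 H1 t (a b : 'rV[R]_m) : J t -> U (c t) -> adapted_frame U W H0 H1 ->
  g t (a *m frame_mx W (c t)) (b *m frame_mx W (c t)) = (a *m gram W t *m b^T) 0 0.
Proof.
move=> Jt Uc [lW _]; have [_ gsym _ _] := mg; have [_ VE] := local_frameP lW Uc.
have rV (a' : 'rV[R]_m) : a' *m frame_mx W (c t) \in V (c t) by apply/VE; exists a'.
have WV i : W i (c t) \in V (c t).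
  by have := rV (delta_mx 0 i); rewrite -rowE rowK.
have E (a' : 'rV[R]_m) : a' *m frame_mx W (c t) = \sum_i a' 0 i *: W i (c t).
  by rewrite mulmx_sum_row; apply: eq_bigr => i _; rewrite rowK.
rewrite [a *m _]E (metric_sum _ _ Jt WV (rV b)) mxE.
under [RHS]eq_bigr do rewrite mxE big_distrl /=.
rewrite exchange_big /=; apply: eq_bigr => i _.
rewrite gsym // E (metric_sum _ _ Jt WV (WV i)) big_distrr /=; apply: eq_bigr => j _.
by rewrite gsym // !mxE -mulrA [b 0 j * _]mulrC.
Qed.

Lemma gram_sym U W H0 H1 t : J t -> U (c t) -> adapted_frame U W H0 H1 ->
  (gram W t)^T = gram W t.
Proof.
move=> Jt Uc [lW _]; have [_ gsym _ _] := mg; have [_ VE] := local_frameP lW Uc.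
have WV i : W i (c t) \in V (c t).
  by apply/VE; exists (delta_mx 0 i); rewrite -rowE rowK.
by apply/matrixP => i j; rewrite !mxE gsym.
Qed.

Lemma gram_pos U W H0 H1 t : J t -> U (c t) -> adapted_frame U W H0 H1 ->
  forall v : 'rV[R]_m, v != 0 -> 0 < (v *m gram W t *m v^T) 0 0.
Proof.
move=> Jt Uc aW v v0; have [lW _] := aW; have [_ _ gpos _] := mg.
have [fr VE] := local_frameP lW Uc.
rewrite -(metric_form _ _ Jt Uc aW); apply: gpos => //; first by apply/VE; exists v.
apply: contra v0 => /eqP vF; apply/eqP; apply: (row_free_inj fr).
by rewrite vF mul0mx.
Qed.

Lemma gram_change U W H0 H1 U' W' H0' H1' t (C : 'M[R]_m) : J t -> U (c t) -> U' (c t) ->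
  adapted_frame U W H0 H1 -> adapted_frame U' W' H0' H1' ->
  frame_mx W (c t) = C *m frame_mx W' (c t) -> gram W t = C *m gram W' t *m C^T.
Proof.
move=> Jt Uc Uc' aW aW' WC; apply/matrixP => i j.
have E k : W k (c t) = row k C *m frame_mx W' (c t) by rewrite -row_mul -WC rowK.
rewrite [LHS]mxE !E (metric_form _ _ Jt Uc' aW') -row_mul.
exact: row_mul_entry.
Qed.

Lemma frame_mx_row W q i : W i q = delta_mx 0 i *m frame_mx W q.
Proof. by rewrite -rowE rowK. Qed.

Lemma metric_curvature U W H0 H1 t : J t -> 0 < t -> U (c t) -> adapted_frame U W H0 H1 ->
  let K := (curvature_mx X H0 H1 (c t))^T in K *m gram W t = gram W t *m K^T.
Proof.
move=> Jt t0 Uc aW K; have [lW _] := aW; have [_ VE] := local_frameP lW Uc.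
have WV i : W i (c t) \in V (c t) by apply/VE; exists (delta_mx 0 i); exact: frame_mx_row.
have cE i : curvature m N X V (c t) (W i (c t)) = row i K *m frame_mx W (c t).
  by rewrite {1}frame_mx_row (curvatureE _ Jt t0 Uc aW) -rowE.
apply/matrixP => i j; have := cg Jt (WV i) (WV j); rewrite !cE.
rewrite (frame_mx_row W (c t) i) (frame_mx_row W (c t) j) !(metric_form _ _ Jt Uc aW).
by rewrite form_entryl form_entryr.
Qed.

(** Parallelism of [g] tested on pairs of frame fields, half of [frame_lin H1] being the connection
    matrix. *)
Lemma gram_deriv U W H0 H1 t : J t -> 0 < t -> U (c t) -> adapted_frame U W H0 H1 ->
  has_deriv_within setT (gram W) t
    (2^-1 *: (frame_lin H1 t *m gram W t + gram W t *m (frame_lin H1 t)^T)).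
Proof.
move=> Jt t0 Uc aW; have [A [roA At AJ JA] sA] := frame_section Jt Uc aW.
have nA : nbhs t A.
  by apply: filterS2 (J_interior Jt t0) JA => s Js; exact.
apply: hdw_interior nA _; apply: hdw_mx => i j.
have := pg roA (sA i) (sA j) At; rewrite !(covariant_derivE _ Jt t0 Uc aW).
have E k : 2^-1 *: row k (frame_lin H1 t *m frame_mx W (c t)) =
    row k (2^-1 *: frame_lin H1 t) *m frame_mx W (c t).
  by rewrite -row_mul -scalemxAl linearZ.
rewrite !E (frame_mx_row W (c t) i) (frame_mx_row W (c t) j) !(metric_form _ _ Jt Uc aW).
have L : (2^-1 *: (frame_lin H1 t *m gram W t + gram W t *m (frame_lin H1 t)^T)) i j =
    ((2^-1 *: frame_lin H1 t) *m gram W t) i j + (gram W t *m (2^-1 *: frame_lin H1 t)^T) i j.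
  by rewrite linearZ /= -scalemxAl -scalemxAr scalerDr [LHS]mxE.
rewrite form_entryl form_entryr L.
by apply: hdw_near; [apply: (@filterE _ (nbhs t)) => s _; rewrite mxE|rewrite mxE].
Qed.

(** Covers the end point 0, where the existence of a one-sided derivative is all that enters the
    continuity of the Wronskian. *)
Lemma gram_near0 U W H0 H1 t : J t -> U (c t) -> adapted_frame U W H0 H1 ->
  exists dG, has_deriv_within J (gram W) t dG.
Proof.
move=> Jt Uc aW; have [A [roA At AJ JA] sA] := frame_section Jt Uc aW.
exists (\matrix_(i, j) (g t (covariant_deriv m N X V J c (fun s => W i (c s)) t) (W j (c t)) +
  g t (W i (c t)) (covariant_deriv m N X V J c (fun s => W j (c s)) t))).
apply: hdw_mx => i j; rewrite mxE.
apply: hdw_near (hdw_sub JA (pg roA (sA i) (sA j) At)); last by rewrite mxE.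
by apply: (@filterE _ (nbhs t)) => s _; rewrite mxE.
Qed.

(** * The initial frame in adapted coordinates, its Wronskian and the Riccati trace *)

Context {U0 : set M} {W0 : 'I_m -> M -> 'rV[R]_n} {H00 H01 : M -> 'M[R]_m}.
Context (Uc0 : U0 (c 0)) (aW0 : adapted_frame U0 W0 H00 H01).

Definition init_frame : 'M[R]_(m, n) := pull_frame W0 0.

Definition jac_alpha W H t : 'M[R]_m :=
  jalpha init_frame (pull_frame W) (pull_frame (fun i => bracket X (W i))) (frame_lin H) t.
Definition jac_beta W t : 'M[R]_m :=
  jbeta init_frame (pull_frame W) (pull_frame (fun i => bracket X (W i))) t.

Lemma init_frame_sub U W H0 H1 t : J t -> U (c t) -> adapted_frame U W H0 H1 ->
  (init_frame <= jacobi_span W t)%MS.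
Proof.
move=> Jt Uc aW; apply: (jacobi_span_transport Jt Uc aW Uc0 aW0).
by rewrite -addsmxE addsmxSl.
Qed.

Lemma jac_coord U W H0 H1 t : J t -> U (c t) -> adapted_frame U W H0 H1 ->
  init_frame = jac_alpha W H1 t *m pull_frame W t + jac_beta W t *m
   (pull_frame (fun i => bracket X (W i)) t - 2^-1 *: (frame_lin H1 t *m pull_frame W t)).
Proof.
move=> Jt Uc aW.
exact: (coord_mxE (w := pull_frame W) (z := pull_frame (fun i => bracket X (W i)))
  (frame_lin H1) (init_frame_sub Jt Uc aW)).
Qed.

Lemma jac_deriv U W H0 H1 t : J t -> 0 < t -> U (c t) -> adapted_frame U W H0 H1 ->
  let K := (curvature_mx X H0 H1 (c t))^T in
  has_deriv_within setT (jac_alpha W H1) t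
    (jac_beta W t *m K - 2^-1 *: (jac_alpha W H1 t *m frame_lin H1 t)) /\
  has_deriv_within setT (jac_beta W) t
    (- jac_alpha W H1 t - 2^-1 *: (jac_beta W t *m frame_lin H1 t)).
Proof.
move=> Jt t0 Uc aW; rewrite -frame_curvE.
have sub : \forall s \near t, (init_frame <=
    col_mx (pull_frame W s) (pull_frame (fun i => bracket X (W i)) s))%MS.
  apply: filterS (adapted_near Jt t0 Uc aW) => s [Js _ Us].
  exact: init_frame_sub Js Us aW.
exact: (jacobi_deriv sub (adapted_jacobi_frame Jt t0 Uc aW)).
Qed.

(** With [W = C W'], both coordinate matrices are multiplied by [C] on the right and the Gram matrix
    changes by congruence. Hence the Wronskian is unchanged, [jac_S] is conjugated, and the
    invertibility of [jac_beta] does not depend on the frame. *)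
Lemma jac_change U W H0 H1 U' W' H0' H1' t : J t -> 0 < t -> U (c t) -> U' (c t) ->
  adapted_frame U W H0 H1 -> adapted_frame U' W' H0' H1' ->
  exists2 C : 'M[R]_m, C \in unitmx & [/\ gram W t = C *m gram W' t *m C^T,
    jac_alpha W' H1' t = jac_alpha W H1 t *m C & jac_beta W' t = jac_beta W t *m C].
Proof.
move=> Jt t0 Uc Uc' aW aW'.
pose C s := frame_mx W (c s) *m pinvmx (frame_mx W' (c s)).
have H := adapted_frame_change Jt t0 Uc Uc' aW aW'.
have [_ hC _] := frame_change (C := C) H.
have [_ _ wC] := nbhs_singleton H; rewrite -/(C t) in wC.
have [_ WC _] := adapted_frame_change_at Jt t0 Uc Uc' aW aW'; rewrite -/(C t) in WC.
exists (C t).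
  rewrite -row_free_unit; apply: inj_row_free => v vC.
  apply: (row_free_inj (adapted_row_free_mx Uc aW)).
  by rewrite mul0mx WC mulmxA vC mul0mx.
have E := combination_change (jac_coord Jt Uc aW) wC hC.
split; first exact: (gram_change Jt Uc Uc' aW aW' WC).
  exact: (coord_mx_unique (l := frame_lin H1') (adapted_row_free Jt Uc' aW') E).1.
exact: (coord_mx_unique (l := frame_lin H1') (adapted_row_free Jt Uc' aW') E).2.
Qed.

Definition wronsk W H t : 'M[R]_m :=
  jac_beta W t *m gram W t *m (jac_alpha W H t)^T -
  jac_alpha W H t *m gram W t *m (jac_beta W t)^T.

Lemma wronsk_deriv U W H0 H1 t : J t -> 0 < t -> U (c t) -> adapted_frame U W H0 H1 ->
  has_deriv_within setT (wronsk W H1) t 0.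
Proof.
move=> Jt t0 Uc aW; have [da db] := jac_deriv Jt t0 Uc aW.
exact: (wronskian_deriv da db (gram_deriv Jt t0 Uc aW) (metric_curvature Jt t0 Uc aW)).
Qed.

Lemma wronsk_change U W H0 H1 U' W' H0' H1' t : J t -> 0 < t -> U (c t) -> U' (c t) ->
  adapted_frame U W H0 H1 -> adapted_frame U' W' H0' H1' -> wronsk W H1 t = wronsk W' H1' t.
Proof.
move=> Jt t0 Uc Uc' aW aW'; have [C uC [GC aC bC]] := jac_change Jt t0 Uc Uc' aW aW'.
by rewrite /wronsk aC bC GC !trmx_mul !mulmxA.
Qed.

Lemma proper_within_J t : J t -> ProperFilter (within J t^').
Proof.
move=> Jt; have [_ J1 J2 J3] := hJ; apply: Build_ProperFilter_ex => P HP.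
have {}HP : nbhs t (fun s => s != t -> J s -> P s) := HP.
have [d d0 D] := nbhs_dist HP; have [b tb Jb] := J3 t Jt.
pose s := Num.min b (t + d / 2).
have ts : t < s by rewrite lt_min tb ltrDl divr_gt0.
have sb : s <= b by rewrite ge_min lexx.
have sd : s <= t + d / 2 by rewrite ge_min lexx orbT.
exists s; apply: D.
- by rewrite gtr0_norm ?subr_gt0 // ltrBlDl; lra.
- by rewrite gt_eqF.
- by apply: J2 Jb => //; rewrite (le_trans (J1 t Jt)) // ltW.
Qed.

Lemma jac_init : jac_alpha W0 H01 0 = 1%:M /\ jac_beta W0 0 = 0.
Proof.
have [J0 _ _ _] := hJ.
have E : init_frame = 1%:M *m pull_frame W0 0 + 0 *m
   (pull_frame (fun i => bracket X (W0 i)) 0 - 2^-1 *: (frame_lin H01 0 *m pull_frame W0 0)).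
  by rewrite mul1mx mul0mx addr0.
exact: (coord_mx_unique (l := frame_lin H01) (adapted_row_free J0 Uc0 aW0) E).
Qed.

(** The slope [-1] of [jac_beta], which vanishes at 0, shows that [jac_S] behaves like the identity
    divided by [t]. *)
Lemma jac_deriv0 : (exists da, has_deriv_within J (jac_alpha W0 H01) 0 da) /\
  has_deriv_within J (jac_beta W0) 0 (- 1%:M).
Proof.
have [J0 _ _ _] := hJ; have [oU _ sW _] := aW0.1; have [a1 b0] := jac_init.
have sub : \forall s \near 0, J s -> (init_frame <=
    col_mx (pull_frame W0 s) (pull_frame (fun i => bracket X (W0 i)) s))%MS.
  apply: filterS (curve_near J0 oU Uc0) => s Us Js.
  exact: init_frame_sub Js (Us Js) aW0.
have [da db] := coord_mx_deriv (proper_within_J J0) (adapted_row_free J0 Uc0 aW0)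
  (pull_frame_deriv J0 oU Uc0 sW) (adapted_bracket_deriv J0 Uc0 aW0) sub
  (init_frame_sub J0 Uc0 aW0).
have [_ dl] := adapted_lin_deriv J0 Uc0 aW0.
split.
  eexists; exact: (hdwD da (hdwZ (c := 2^-1) (hdw_mulmx db dl))).
have Ea : lsubmx (coord_mx init_frame (pull_frame W0)
    (pull_frame (fun i => bracket X (W0 i))) 0) = 1%:M.
  by move: a1; rewrite /jac_alpha /jalpha -/(jac_beta W0 0) b0 mul0mx scaler0 addr0.
by move: db; rewrite -/(jac_beta W0 0) b0 mul0mx subr0 Ea.
Qed.

(* Independent of the frame for [0 < t]; 0 is its limit at 0. *)
Definition wron t : 'M[R]_m := if t <= 0 then 0 else
  xget 0 [set x | exists U W H0 H1, [/\ U (c t), adapted_frame U W H0 H1 & x = wronsk W H1 t]].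

Lemma wronE U W H0 H1 t : J t -> 0 < t -> U (c t) -> adapted_frame U W H0 H1 ->
  wron t = wronsk W H1 t.
Proof.
move=> Jt t0 Uc aW; rewrite /wron leNgt t0 /=; apply: xget_eq; first by exists U, W, H0, H1.
move=> _ [U' [W' [H0' [H1' [Uc' aW' ->]]]]].
exact: (wronsk_change Jt t0 Uc' Uc aW' aW).
Qed.

Lemma wron_deriv t : J t -> 0 < t -> has_deriv_within setT wron t 0.
Proof.
move=> Jt t0; have [U [W [H0 [H1 [Uc aW]]]]] := adapted_frame_exists Jt (Nc Jt).
have D := wronsk_deriv Jt t0 Uc aW.
apply: hdw_near D; last by rewrite (wronE Jt t0 Uc aW).
apply: filterS (adapted_near Jt t0 Uc aW) => s [Js s0 Us] _.
by rewrite (wronE Js s0 Us aW).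
Qed.

(** Serves as continuity at 0, so that the mean value estimate applies on the closed interval
    [[0, t]]. *)
Lemma wron_deriv0 : exists dw, has_deriv_within J wron 0 dw.
Proof.
have [J0 J1 _ _] := hJ; have [[da Da] Db] := jac_deriv0; have [_ b0] := jac_init.
have [dG DG] := gram_near0 J0 Uc0 aW0.
have D := hdwD (hdw_mulmx (hdw_mulmx Db DG) (hdw_tr Da))
  (hdwN (hdw_mulmx (hdw_mulmx Da DG) (hdw_tr Db))).
have W00 : wronsk W0 H01 0 = wron 0.
  by rewrite /wronsk b0 !mul0mx trmx0 mulmx0 subr0 /wron lexx.
eexists; apply: hdw_near D; last exact: W00.
have [oU _ _ _] := aW0.1.
apply: filterS (curve_near J0 oU Uc0) => s Us Js.
have := J1 s Js; rewrite le_eqVlt => /predU1P[<-|s0]; first exact: W00.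
exact: esym (wronE Js s0 (Us Js) aW0).
Qed.

Lemma wron_eq0 t : J t -> 0 <= t -> wron t = 0.
Proof.
move=> Jt t0; have [J0 J1 J2 _] := hJ.
have IJ s : 0 <= s <= t -> J s by move=> /andP[s0 st]; exact: J2 s0 st Jt.
have w0 : wron 0 = 0 by rewrite /wron lexx.
suff : `|wron t - wron 0| <= 0 * (t - 0).
  by rewrite mul0r w0 subr0 normr_le0 => /eqP.
apply: (mvt_mx t0 (df := fun=> 0)).
- by move=> s /andP[s0 st]; apply: wron_deriv => //; apply: IJ; rewrite !ltW.
- by move=> s _; rewrite normr0.
apply/subspace_continuousP => s /=; rewrite in_itv /= => st.
have [ds D] : exists ds, has_deriv_within J wron s ds.
  have /andP[s0 _] := st; move: s0; rewrite le_eqVlt => /predU1P[<-|s0].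
    exact: wron_deriv0.
  by exists 0; apply/hdwT/wron_deriv => //; exact: IJ.
apply: (hdw_within_cvg (l := ds)); apply: hdw_sub D.
by apply: (@filterE _ (nbhs s)) => u /=; rewrite in_itv /=; exact: IJ.
Qed.

Definition jac_S W H t : 'M[R]_m := - (invmx (jac_beta W t) *m jac_alpha W H t).

(* Again independent of the frame when [jac_beta] is invertible. *)
Definition jac_u t : R :=
  xget 0 [set x : R | exists U W H0 H1,
    [/\ U (c t), adapted_frame U W H0 H1 & x = \tr (jac_S W H1 t)]].

Lemma jac_S_symmetric U W H0 H1 t : J t -> 0 < t -> U (c t) -> adapted_frame U W H0 H1 ->
  jac_beta W t \in unitmx -> jac_S W H1 t *m gram W t = gram W t *m (jac_S W H1 t)^T.
Proof.
move=> Jt t0 Uc aW ub; apply: wronskian_symmetric ub _.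
apply/eqP; rewrite -subr_eq0; apply/eqP.
by have := wronE Jt t0 Uc aW; rewrite (wron_eq0 Jt (ltW t0)).
Qed.

Lemma jac_uE U W H0 H1 t : J t -> 0 < t -> U (c t) -> adapted_frame U W H0 H1 ->
  jac_beta W t \in unitmx -> jac_u t = \tr (jac_S W H1 t).
Proof.
move=> Jt t0 Uc aW ub; apply: xget_eq; first by exists U, W, H0, H1.
move=> _ [U' [W' [H0' [H1' [Uc' aW' ->]]]]].
have [C uC [_ aC bC]] := jac_change Jt t0 Uc Uc' aW aW'.
rewrite /jac_S aC bC; move: ub; move: (jac_beta W t) (jac_alpha W H1 t) => b a ub.
rewrite !linearN /=; congr (- _).
have -> : invmx (b *m C) = invmx C *m invmx b.
  have u : b *m C \in unitmx by rewrite unitmx_mul ub.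
  apply: (can_inj (mulKmx u)); rewrite mulmxV // !mulmxA -(mulmxA b) mulmxV // mulmx1.
  by rewrite mulmxV.
by rewrite !mulmxA mxtrace_mulC !mulmxA mulmxV // mul1mx.
Qed.

Lemma jac_u_deriv U W H0 H1 t : J t -> 0 < t -> U (c t) -> adapted_frame U W H0 H1 ->
  jac_beta W t \in unitmx ->
  is_derive t 1 jac_u (- \tr (curvature_mx X H0 H1 (c t)) -
     \tr (jac_S W H1 t *m jac_S W H1 t)).
Proof.
move=> Jt t0 Uc aW ub; have [da db] := jac_deriv Jt t0 Uc aW.
have D := riccati_deriv ub da db; rewrite mxtrace_tr in D.
apply/hdwTE; apply: hdw_near D; last by rewrite (jac_uE Jt t0 Uc aW ub).
have nb : \forall s \near t, jac_beta W s \in unitmx := hdw_continuous db (unitmx_near ub).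
apply: filterS2 nb (adapted_near Jt t0 Uc aW) => s us [Js s0 Us] _.
by rewrite (jac_uE Js s0 Us aW us).
Qed.

Lemma jac_u_bounded (b : R) : 0 < b ->
  (forall t, 0 < t <= b -> J t -> U0 (c t) -> jac_beta W0 t \in unitmx) ->
  exists K d, 0 < d /\ forall t, 0 < t < d -> `|t * jac_u t| <= K.
Proof.
move=> b0 ub; have [J0 _ _ _] := hJ; have [[da Da] Db] := jac_deriv0; have [a1 beta0] := jac_init.
have Da' : jac_alpha W0 H01 s @[s --> within J 0^'] --> (1%:M : 'M[R]_m).
  by rewrite -a1; exact: hdw_cvg Da.
have u1 : - 1%:M \in @unitmx R m.
  by rewrite -scaleN1r unitmxZ ?unitmx1 // unitrN1.
have FF : Filter (within J 0^') by exact: within_filter.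
(* [h s] is [- s * jac_u s], written with the difference quotient of [jac_beta]; the latter tends to
   [- 1%:M], so its inverse stays bounded. *)
pose h s : R^o := \tr (invmx ((s - 0)^-1 *: (jac_beta W0 s - jac_beta W0 0)) *m jac_alpha W0 H01 s).
have Dh : h s @[s --> within J 0^'] --> (\tr (invmx (- 1%:M) *m 1%:M : 'M[R]_m) : R^o).
  exact: (cvg_mxtrace (cvg_mulmx (cvg_invmx u1 Db) Da')).
set L := (X in _ --> X) in Dh.
have H : nbhs 0 (fun s => s != 0 -> J s -> `|L - h s| <= 1).
  by have /cvgrPdist_le/(_ 1 ltr01) := Dh.
have [oU _ _ _] := aW0.1.
have [d1 d10 D1] := nbhs_dist (filterI H (filterI (curve_near J0 oU Uc0) (half_open_near hJ J0))).
exists (`|L| + 1), (Num.min d1 b); split; first by rewrite lt_min d10.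
move=> t; rewrite lt_min => /andP[t0 /andP[td tb]].
have tn : `|t - 0| < d1 by rewrite subr0 gtr0_norm.
have [ht [Ut JT]] := D1 t tn; have Jt : J t := JT (ltW t0).
have ubt : jac_beta W0 t \in unitmx by apply: ub (Ut Jt) => //; rewrite t0 ltW.
have -> : t * jac_u t = - h t.
  rewrite (jac_uE Jt t0 (Ut Jt) aW0 ubt) /h subr0 beta0 subr0 /jac_S.
  rewrite invmxZ; last by rewrite unitmxZ ?unitfE ?invr_eq0 ?gt_eqF.
  by rewrite invrK -scalemxAl raddfN /= mxtraceZ mulrN.
rewrite normrN; have := ht (lt0r_neq0 t0) Jt; move: (h t) => x Lx.
rewrite addrC -lerBlDr (le_trans (ler_norm _)) //.
by rewrite (le_trans (ler_dist_dist _ _)) // distrC.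
Qed.

(** If [v *m jac_beta W t = 0], the vector [v *m init_frame] of [V (c 0)] has no horizontal
    component at time [t], so the flow sends it into [V (c t)]; it is not 0 because the initial
    frame is free. *)
Lemma conjugate_of_singular U W H0 H1 t : J t -> 0 < t -> U (c t) -> adapted_frame U W H0 H1 ->
  jac_beta W t \notin unitmx -> conjugate_time X V c J t.
Proof.
move=> Jt t0 Uc aW nub; split=> // E; have [J0 _ _ _] := hJ.
have [v v0 vb] : exists2 v : 'rV[R]_m, v != 0 & v *m jac_beta W t = 0.
  move: nub; rewrite -row_free_unit -kermx_eq0 => /rowV0Pn[v vk v0].
  by exists v => //; apply/sub_kermxP.
have [f0 VE0] := local_frameP aW0.1 Uc0; have [f1 VE1] := local_frameP aW.1 Uc.
have I0 : init_frame = frame_mx W0 (c 0).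
  by rewrite /init_frame /pull_frame curve_flow_mx0 invmx1 mulmx1.
pose u := v *m init_frame.
have uQ : u *m curve_flow_mx t = v *m jac_alpha W H1 t *m frame_mx W (c t).
  rewrite /u (jac_coord Jt Uc aW) mulmxDr !mulmxA vb mul0mx addr0.
  by rewrite (mulmxKV (curve_flow_mx_unit Jt)).
have : [set 0] (mdiff (flow X t) (c 0) u).
  rewrite -E; split; last first.
    by rewrite mdiff_flow // uQ; apply/VE1; exists (v *m jac_alpha W H1 t).
  by exists u => //; apply/VE0; exists v; rewrite /u I0.
rewrite mdiff_flow // => /= /eqP u0; move/negP: v0; apply.
have uz : u = 0.
  apply: (can_inj (mulmxK (curve_flow_mx_unit Jt))); rewrite mul0mx; exact/eqP.
apply/eqP; apply: (row_free_inj f0).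
by rewrite mul0mx -I0.
Qed.

Lemma conjugate_time_exists (kappa : R) (Tst := pi * Num.sqrt (m%:R / kappa)) :
  (0 < m)%N -> 0 < kappa -> J Tst ->
  (forall t, J t -> kappa <= trace_on (V (c t)) (curvature m N X V (c t))) ->
  exists t, 0 < t <= Tst /\ conjugate_time X V c J t.
Proof.
move=> m0 k0 JT Ktr; have [_ _ J2 _] := hJ.
have T0 : 0 < Tst by rewrite mulr_gt0 ?pi_gt0 // sqrtr_gt0 divr_gt0 // ltr0n.
have IJ t : 0 < t <= Tst -> J t by move=> /andP[/ltW t0 tT]; exact: J2 t0 tT JT.
apply: contrapT => noconj.
have ub t U W H0 H1 : 0 < t <= Tst -> U (c t) -> adapted_frame U W H0 H1 ->
    jac_beta W t \in unitmx.
  move=> tT Uc aW; apply: contrapT => /negP nub; apply: noconj; exists t; split=> //.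
  by case/andP: (tT) => t0 _; exact: conjugate_of_singular (IJ t tT) t0 Uc aW nub.
apply: (@riccati_blowup _ m kappa jac_u m0 k0).
  move=> t tT; have Jt := IJ t tT; have /andP[t0 _] := tT.
  have [U [W [H0 [H1 [Uc aW]]]]] := adapted_frame_exists Jt (Nc Jt).
  have ubt := ub t U W H0 H1 tT Uc aW.
  exists (- \tr (curvature_mx X H0 H1 (c t)) - \tr (jac_S W H1 t *m jac_S W H1 t)).
    exact: (jac_u_deriv Jt t0 Uc aW ubt).
  have := Ktr t Jt; rewrite (trace_curvatureE Jt t0 Uc aW) (jac_uE Jt t0 Uc aW ubt).
  have := trace_sqr_ge m0 (gram_sym Jt Uc aW) (gram_pos Jt Uc aW) (jac_S_symmetric Jt t0 Uc aW ubt).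
  lra.
apply: (jac_u_bounded T0) => t tT Jt Ut; exact: ub tT Ut aW0.
Qed.

End FlowAlongCurve.

Lemma ereal_half_open (R : realType) (T : \bar R) : (0 < T)%E ->
  half_open_interval [set t : R | 0 <= t /\ (t%:E < T)%E].
Proof.
move=> T0; split=> /=.
- by rewrite lexx.
- by move=> t [].
- by move=> s t s0 st [_ tT]; split=> //; apply: le_lt_trans tT; rewrite lee_fin.
- move=> t [t0]; case: T T0 => [r| |] // _.
    rewrite lte_fin => tr; exists ((t + r) / 2); first by lra.
    by rewrite lte_fin; lra.
  by move=> _; exists (t + 1); rewrite ?ltry; lra.
Qed.

Unset Implicit Arguments.

Theorem theorem3p6 (R : realType) (n m : nat) (M : manifold R n)
    (X : M -> 'rV[R]_n) (T : \bar R) (c : R -> M)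
    (N : set M) (V : M -> {vspace 'rV[R]_n})
    (g : R -> 'rV[R]_n -> 'rV[R]_n -> R) (kappa : R) :
  let J := [set t : R | 0 <= t /\ (t%:E < T)%E] in
  let Tstar := pi * Num.sqrt (m%:R / kappa) in
  (0 < T)%E ->
  smooth_field setT X ->
  integral_curve X J c ->
  (forall s t, J s -> J t -> c s = c t -> s = t) ->
  open N ->
  (forall t, J t -> N (c t)) ->
  regular_dynamic_pair m N X V ->
  metric_along V c J g ->
  parallel_metric m N X V c J g ->
  curvature_symmetric m N X V c J g ->
  0 < kappa ->
  (forall t, J t -> kappa <= trace_on (V (c t)) (curvature m N X V (c t))) ->
  (Tstar%:E < T)%E ->
  exists t, 0 < t <= Tstar /\ conjugate_time X V c J t.
Proof.
move=> J Tstar T0 sX cc _ _ Nc reg mg pg cg kp Ktr TT.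
have hJ : half_open_interval J := ereal_half_open T0.
have [J0 _ _ _] := hJ.
have JT : J Tstar by split=> //; rewrite mulr_ge0 ?pi_ge0 ?sqrtr_ge0.
have [_ sd _ _ _] := reg; have [U [W [Uc lW]]] := sd _ (Nc 0 J0).
have [H0 [H1 sm]] := structure_matrices_exist reg lW.
(* For [m = 0] the trace would be an empty sum, contrary to the positive lower bound. *)
have m0 : (0 < m)%N.
  rewrite lt0n; apply/eqP => m0; have := Ktr 0 J0.
  have [_ _ _ bW] := lW; have dV : \dim (V (c 0)) = 0%N.
    exact: etrans (size_basis (bW _ Uc)) m0.
  rewrite /trace_on big1 => [|[i iV] _]; last by exfalso; rewrite dV in iV.
  by rewrite leNgt kp.
exact: (conjugate_time_exists sX hJ cc reg Nc mg pg cg Uc (conj lW sm) m0 kp JT Ktr).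
Qed.
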